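(* Let $n\geq 3$ and let $(R,\Lambda)$ be a form ring (with respect to an involution $r\mapsto\bar r$ and a central element $\lambda$ with $\lambda\bar\lambda=1$) such that $R$ is quasi-finite. Let $H$ be a subgroup of $U_{2n}(R,\Lambda)$. Then $H$ is normalized by $EU_{2n}(R,\Lambda)$ if and only if there exists a unique form ideal $(I,\Gamma)$ of $(R,\Lambda)$ such that \[EU_{2n}((R,\Lambda),(I,\Gamma))\subseteq H\subseteq CU_{2n}((R,\Lambda),(I,\Gamma)).\]
   Context: Rings are associative with $1\neq 0$. An involution on $R$ is a map $r\mapsto \bar r$ with $\overline{r+s}=\bar r+\bar s$, $\overline{rs}=\bar s\bar r$, $\bar{\bar r}=r$. Fix $\lambda\in\mathrm{center}(R)$ with $\lambda\bar\lambda=1$. A form parameter is an additive subgroup $\Lambda\subseteq R$ with $\{r-\lambda\bar r: r\in R\}\subseteq\Lambda\subseteq\{r\in R: r=-\lambda\bar r\}$ and $r\Lambda\bar r\subseteq\Lambda$ for all $r\in R$; then $(R,\Lambda)$ is a form ring. A form ideal $(I,\Gamma)$ of $(R,\Lambda)$ is a two-sided ideal $I$ with $\bar I=I$ together with an additive subgroup $\Gamma\subseteq I$ such that $\Gamma^I_{min}\subseteq\Gamma\subseteq I\cap\Lambda$ and $\alpha\Gamma\bar\alpha\subseteq\Gamma$ for all $\alpha\in R$, where $\Gamma^I_{min}=\{\xi-\lambda\bar\xi:\xi\in I\}+\langle\{\zeta\alpha\bar\zeta:\zeta\in I,\alpha\in\Lambda\}\rangle$. Rows and columns of $2n\times 2n$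 matrices are indexed by $\Omega=\{1,\dots,n,-n,\dots,-1\}$ in this order; $\epsilon(i)=1$ if $i>0$ and $\epsilon(i)=-1$ if $i<0$; $e$ is the identity matrix and $e^{ij}$ the matrix unit. For columns $u,v\in R^{2n}$ put $\mathbbm{f}(u,v)=\sum_{i=1}^n\bar u_iv_{-i}$ and $\mathbbm{h}(u,v)=\sum_{i=1}^n(\bar u_iv_{-i}+\lambda\bar u_{-i}v_i)$. The hyperbolic unitary group $U_{2n}(R,\Lambda)$ is the group of all $\sigma\in GL_{2n}(R)$ with $\mathbbm{h}(\sigma u,\sigma v)=\mathbbm{h}(u,v)$ and $\mathbbm{f}(\sigma u,\sigma u)-\mathbbm{f}(u,u)\in\Lambda$ for all $u,v$. For $i\neq\pm j$ and $\xi\in R$ let $T_{ij}(\xi)=e+\xi e^{ij}-\lambda^{(\epsilon(j)-\epsilon(i))/2}\bar\xi e^{-j,-i}$; for $i\in\Omega$ and $\alpha\in\lambda^{-(\epsilon(i)+1)/2}\Lambda$ let $T_{i,-i}(\alpha)=e+\alpha e^{i,-i}$. $EU_{2n}(R,\Lambda)$ is the subgroup generated by all these. For a form ideal $(I,\Gamma)$, $EU_{2n}((R,\Lambda),(I,\Gamma))$ is the normal closure in $EU_{2n}(R,\Lambda)$ of the subgroup generated by all $T_{ij}(\xi)$ ($i\neq\pm j$, $\xi\in I$) and all $T_{i,-i}(\alpha)$ ($\alpha\in\lambda^{-(\epsilon(i)+1)/2}\Gamma$). $U_{2n}((R,\Lambda),(I,\Gamma))$ is the (normal) subgroup of all $\sigma\in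 U_{2n}(R,\Lambda)$ with $\sigma\equiv e \pmod I$ and $\mathbbm{f}(\sigma u,\sigma u)-\mathbbm{f}(u,u)\in\Gamma$ for all $u$; $CU_{2n}((R,\Lambda),(I,\Gamma))$ is the preimage of the center of $U_{2n}(R,\Lambda)/U_{2n}((R,\Lambda),(I,\Gamma))$ under the canonical map. $R$ (with its involution and $\lambda$) is quasi-finite if it is a direct limit (directed union) of subrings $R_i$ which are almost commutative (module finite over their center), involution invariant and contain $\lambda$. *)

(* Defs.v *)
From HB Require Import structures.
From mathcomp Require Import all_boot all_order all_algebra.
Set Implicit Arguments. Unset Strict Implicit. Unset Printing Implicit Defensive.
Import GRing.Theory.
Local Open Scope ring_scope.

Section RingDefs.
Variable R : nzRingType.
Variables (inv : R -> R) (lam : R).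

Definition is_involution : Prop :=
  (forall x y, inv (x + y) = inv x + inv y) /\
  (forall x y, inv (x * y) = inv y * inv x) /\
  (forall x, inv (inv x) = x).

Definition central (c : R) : Prop := forall r, c * r = r * c.

Definition add_subgroup (S : R -> Prop) : Prop :=
  S 0 /\ (forall x y, S x -> S y -> S (x + y)) /\ (forall x, S x -> S (- x)).

Definition form_parameter (Lam : R -> Prop) : Prop :=
  add_subgroup Lam /\
  (forall r, Lam (r - lam * inv r)) /\
  (forall a, Lam a -> a = - (lam * inv a)) /\
  (forall r a, Lam a -> Lam (r * a * inv r)).

Definition two_sided_ideal (I : R -> Prop) : Prop :=
  add_subgroup I /\ (forall r x, I x -> I (r * x)) /\ (forall r x, I x -> I (x * r)).

Definition inv_stable (I : R -> Prop) : Prop :=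
  forall y, I y <-> exists x, I x /\ y = inv x.

Inductive gen_add (S : R -> Prop) : R -> Prop :=
| gen_add0 : gen_add S 0
| gen_addS x : S x -> gen_add S x
| gen_addD x y : gen_add S x -> gen_add S y -> gen_add S (x + y)
| gen_addN x : gen_add S x -> gen_add S (- x).

Definition Gamma_min (Lam I : R -> Prop) (x : R) : Prop :=
  exists xi y, I xi /\
    gen_add (fun z => exists zeta a, I zeta /\ Lam a /\ z = zeta * a * inv zeta) y /\
    x = (xi - lam * inv xi) + y.

Definition form_ideal (Lam I Gam : R -> Prop) : Prop :=
  two_sided_ideal I /\ inv_stable I /\
  add_subgroup Gam /\ (forall x, Gam x -> I x) /\
  (forall x, Gamma_min Lam I x -> Gam x) /\
  (forall x, Gam x -> I x /\ Lam x) /\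
  (forall a x, Gam x -> Gam (a * x * inv a)).

Definition subring (S : R -> Prop) : Prop :=
  add_subgroup S /\ S 1 /\ (forall x y, S x -> S y -> S (x * y)).

Definition almost_commutative (S : R -> Prop) : Prop :=
  exists (m : nat) (g : 'I_m -> R), (forall k, S (g k)) /\
    forall x, S x -> exists c : 'I_m -> R,
      (forall k, S (c k) /\ forall y, S y -> c k * y = y * c k) /\
      x = \sum_(k < m) c k * g k.

Definition quasi_finite : Prop :=
  exists (J : Type) (Ri : J -> R -> Prop),
    (forall j, subring (Ri j) /\ almost_commutative (Ri j) /\
               (forall x, Ri j x -> Ri j (inv x)) /\ Ri j lam) /\
    (forall j1 j2, exists j3, (forall x, Ri j1 x -> Ri j3 x) /\
                              (forall x, Ri j2 x -> Ri j3 x)) /\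
    (forall x, exists j, Ri j x).

(* Matrices of size 2n; Omega = {1..n,-n..-1} is identified with 'I_(n+n):
   position k < n  <-> index k+1,   position k >= n <-> index -(2n-k).
   Then -i corresponds to rev_ord, and eps(p) = 1 iff p < n. *)
Variable n : nat.
Local Notation M := 'M[R]_(n + n).
Local Notation V := 'cV[R]_(n + n).

Definition ipos (k : 'I_n) : 'I_(n + n) := lshift n k.
Definition ineg (k : 'I_n) : 'I_(n + n) := rev_ord (ipos k).
Definition epos (p : 'I_(n + n)) : bool := (p < n)%N.

Definition fform (u v : V) : R :=
  \sum_(k < n) inv (u (ipos k) 0) * v (ineg k) 0.
Definition hform (u v : V) : R :=
  \sum_(k < n) (inv (u (ipos k) 0) * v (ineg k) 0
                + lam * inv (u (ineg k) 0) * v (ipos k) 0).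

Definition invertible (s : M) : Prop :=
  exists t : M, s *m t = 1%:M /\ t *m s = 1%:M.

Definition U_grp (Lam : R -> Prop) (s : M) : Prop :=
  invertible s /\
  (forall u v, hform (s *m u) (s *m v) = hform u v) /\
  (forall u, Lam (fform (s *m u) (s *m u) - fform u u)).

(* lam^((eps(j) - eps(i))/2); lam^(-1) = bar lam *)
Definition lam_exp (p q : 'I_(n + n)) : R :=
  if epos q == epos p then 1 else if epos q then lam else inv lam.

Definition Tij (p q : 'I_(n + n)) (xi : R) : M :=
  1%:M + xi *: delta_mx p q
       - (lam_exp p q * inv xi) *: delta_mx (rev_ord q) (rev_ord p).

Definition Tii (p : 'I_(n + n)) (a : R) : M :=
  1%:M + a *: delta_mx p (rev_ord p).

(* alpha in lam^(-(eps(i)+1)/2) G *)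
Definition long_coef (G : R -> Prop) (p : 'I_(n + n)) (alpha : R) : Prop :=
  exists a, G a /\ alpha = (if epos p then inv lam * a else a).

Definition rel_gens (I Gam : R -> Prop) (s : M) : Prop :=
  (exists p q xi, p != q /\ p != rev_ord q /\ I xi /\ s = Tij p q xi) \/
  (exists p alpha, long_coef Gam p alpha /\ s = Tii p alpha).

Definition elem_gens (Lam : R -> Prop) (s : M) : Prop :=
  rel_gens (fun _ => True) Lam s.

Definition is_subgroup (G : M -> Prop) : Prop :=
  G 1%:M /\ (forall a b, G a -> G b -> G (a *m b)) /\
  (forall a, G a -> exists b, G b /\ a *m b = 1%:M /\ b *m a = 1%:M).

Definition gen_subgroup (S : M -> Prop) (s : M) : Prop :=
  forall G, is_subgroup G -> (forall t, S t -> G t) -> G s.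

Definition EU (Lam : R -> Prop) : M -> Prop := gen_subgroup (elem_gens Lam).

Definition normalized_by (K G : M -> Prop) : Prop :=
  forall e e' g, K e -> e *m e' = 1%:M -> e' *m e = 1%:M -> G g -> G (e *m g *m e').

Definition EU_rel (Lam I Gam : R -> Prop) (s : M) : Prop :=
  forall N, is_subgroup N -> (forall t, N t -> EU Lam t) ->
    normalized_by (EU Lam) N -> (forall t, rel_gens I Gam t -> N t) -> N s.

Definition U_rel (Lam I Gam : R -> Prop) (s : M) : Prop :=
  U_grp Lam s /\ (forall a b, I ((s - 1%:M) a b)) /\
  (forall u, Gam (fform (s *m u) (s *m u) - fform u u)).

(* preimage of the center of U / U(I,Gam): s t and t s have the same coset *)
Definition CU_rel (Lam I Gam : R -> Prop) (s : M) : Prop :=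
  U_grp Lam s /\
  forall t, U_grp Lam t -> exists nu, U_rel Lam I Gam nu /\ s *m t = t *m s *m nu.

End RingDefs.

(* Main.v *)
(** The form ideal attached to [H] is its level: [I] consists of the coefficients of the short
    root elements of [H], [Gamma] of those of its long root elements; commutator identities make
    this a form ideal with [EU(I, Gamma)] contained in [H].

    Two facts are proved over an arbitrary quasi-finite form ring, by working locally: the involution
    ring is a union of rings that are finite over a subring of symmetric central elements, and an
    identity can be checked after inverting elements outside a maximal ideal of that subring, where
    the ring is semilocal and stable range arguments apply. First, [EU] is normal in [U]. Applied to
    the fibre product of two copies of [R] over [R / I] this yields [[U(I, Gamma), EU]] inside
    [EU(I, Gamma)], hence, since [EU] is generated by commutators, [[CU(I, Gamma), EU]] inside
    [EU(I, Gamma)], which is the easy direction. Second, a subgroup normalised by [EU] without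
    nontrivial short root elements is central: commutators with suitable Eichler transvections turn
    any of its noncentral elements into a short root element.

    For the hard direction the second fact is applied over [R / I]. A short root element modulo [I]
    lifts to [T nu] with [nu] congruent to [1] modulo [I]; a few commutators move the form defect of
    [nu] into [Gamma], and then the relative commutator formula removes [nu]. The same device shows
    that elements of [H] congruent to [1] modulo [I] have form defect in [Gamma]. *)

Require Import Defs.
From HB Require Import structures.
From mathcomp Require Import all_boot all_order all_algebra zify.
From mathcomp Require boolp classical_sets.
Set Implicit Arguments. Unset Strict Implicit. Unset Printing Implicit Defensive.
Import GRing.Theory.
Local Open Scope ring_scope.

(** * Normalisation in abelian groups *)

(** No localisation is formed. That [a] is invertible at a maximal ideal [m] of the central subring
    [C] is expressed by an equation [b * a = s] with [s] in [C] outside [m], and denominators are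
    cleared: a statement is proved for a multiple by a power of [s]. The elements of [C] for whose
    multiples the statement holds form an ideal; if it were proper, some [m] would contain it,
    against the power of [s] just found. Elements of [C] are symmetric because such an [s] has to
    pass through both arguments of a sesquilinear form. The obstacle is that columns of a unitary
    matrix are arbitrary isotropic vectors. Root elements are therefore treated as Eichler
    transvections [trv u v a], which conjugate well, and the question becomes for which pairs [u],
    [v] they are elementary. They are when [u] vanishes on a hyperbolic plane; a column with a
    locally invertible coordinate has enough such vectors orthogonal to it, and stable range
    provides that coordinate. *)

Inductive zmod_expr :=
  | ZVar of nat | ZZero | ZAdd of zmod_expr & zmod_expr | ZOpp of zmod_expr.

Fixpoint zmod_eval (V : zmodType) (env : seq V) e : V :=
  match e with
  | ZVar i => env`_i
  | ZZero => 0
  | ZAdd a b => zmod_eval env a + zmod_eval env b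
  | ZOpp a => - zmod_eval env a
  end.

Fixpoint zmod_coef e (i : nat) : int :=
  match e with
  | ZVar j => (i == j)%:R
  | ZZero => 0
  | ZAdd a b => zmod_coef a i + zmod_coef b i
  | ZOpp a => - zmod_coef a i
  end.

Lemma zmod_evalE (V : zmodType) (env : seq V) e :
  zmod_eval env e = \sum_(i < size env) env`_i *~ zmod_coef e i.
Proof.
elim: e => [j||a IHa b IHb|a IHa] /=.
- case: (ltnP j (size env)) => [hj|hj].
    rewrite (bigD1 (Ordinal hj)) //= eqxx mulr1z big1 ?addr0 // => i.
    by rewrite -val_eqE /= => /negPf ->; rewrite mulr0z.
  rewrite nth_default // big1 // => i _.
  by rewrite (ltn_eqF (leq_trans (ltn_ord i) hj)) mulr0z.
- by rewrite big1 // => i _; rewrite mulr0z.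
- by rewrite IHa IHb -big_split; apply: eq_bigr => i _; rewrite mulrzDr.
- by rewrite IHa -sumrN; apply: eq_bigr => i _; rewrite mulrNz.
Qed.

Lemma zmod_normP (V : zmodType) (env : seq V) a b :
  all (fun i => zmod_coef a i == zmod_coef b i) (iota 0 (size env)) ->
  zmod_eval env a = zmod_eval env b.
Proof.
move=> /allP h; rewrite !zmod_evalE; apply: eq_bigr => i _.
by rewrite (eqP (h i _)) // mem_iota add0n /=.
Qed.

(* Products and scalings occur with several convertible structure instances, which
   are identified here. *)
Ltac zmod_same x y :=
  match constr:((x, y)) with
  | (?a, ?a) => constr:(true)
  | (?c *: ?a, ?c *: ?b) => zmod_same a b
  | (?a *m ?c, ?b *m ?c) => zmod_same a b
  | (?c *m ?a, ?c *m ?b) => zmod_same a b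
  | (?a * ?c, ?b * ?c) => zmod_same a b
  | (?c * ?a, ?c * ?b) => zmod_same a b
  | _ => constr:(false)
  end.
Ltac zmod_index env x :=
  lazymatch env with
  | ?y :: ?s =>
    lazymatch zmod_same x y with
    | true => constr:(0%N)
    | false => let i := zmod_index s x in constr:(S i)
    end
  end.
Ltac zmod_mem env x :=
  lazymatch env with
  | ?y :: ?s =>
    lazymatch zmod_same x y with true => constr:(true) | false => zmod_mem s x end
  | _ => constr:(false)
  end.
Ltac zmod_atoms env t :=
  lazymatch t with
  | ?a + ?b => let env := zmod_atoms env a in zmod_atoms env b
  | - ?a => zmod_atoms env a
  | 0 => env
  | _ => lazymatch zmod_mem env t with true => env | false => constr:(t :: env) end
  end.
Ltac zmod_reify env t :=
  lazymatch t with
  | ?a + ?b => let a := zmod_reify env a in let b := zmod_reify env b in constr:(ZAdd a b)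
  | - ?a => let a := zmod_reify env a in constr:(ZOpp a)
  | 0 => constr:(ZZero)
  | _ => let i := zmod_index env t in constr:(ZVar i)
  end.
Ltac abel :=
  lazymatch goal with
  | |- @eq ?T ?a ?b =>
    let env := zmod_atoms (@nil T) a in
    let env := zmod_atoms env b in
    let ea := zmod_reify env a in
    let eb := zmod_reify env b in
    refine (@zmod_normP _ env ea eb _); vm_compute; reflexivity
  end.

(** Noncommutative ring identities: products are expanded into monomials, which then serve as atoms
    for [abel]. *)
Ltac ncring :=
  rewrite ?(mulrDr, mulrDl, mulrN, mulNr, mulr1, mul1r, mulr0, mul0r, mulrA, opprD, opprK, oppr0);
  abel.

(** * The hyperbolic form *)

(** Bundled so that the results apply as well to the fibre product and to the quotient by the level,
    which are form rings on other carriers. *)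
Record form_ring (R : nzRingType) := FormRing {
  fbar : R -> R;
  flam : R;
  fLam : R -> Prop;
  fbarP : is_involution fbar;
  flam_central : central flam;
  flamU : flam * fbar flam = 1;
  fLamP : form_parameter fbar flam fLam }.

Lemma mul_eq0 (R : nzRingType) a b c d (A : 'M[R]_(a, b)) (B : 'M[R]_(b, c)) (Z : 'M[R]_(d, a)) :
  A *m B = 0 -> Z *m A *m B = 0.
Proof. by rewrite -mulmxA => ->; rewrite mulmx0. Qed.

Lemma mx11_central_scale (R : nzRingType) (c : R) a b d (A : 'M[R]_(a, b)) (B : 'M[R]_(b, d)) :
  central c -> A *m (c *: B) = c *: (A *m B).
Proof.
move=> hc; apply/matrixP => i j; rewrite !mxE mulr_sumr; apply: eq_bigr => k _.
by rewrite !mxE !mulrA hc.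
Qed.

Section Index.
Variable n : nat.
Implicit Types p q : 'I_(n + n).

Lemma epos_rev p : epos (rev_ord p) = ~~ epos p.
Proof. by rewrite /epos /= -leqNgt; case: p => p /= hp; apply/idP/idP; lia. Qed.

Lemma rev_neq p : (rev_ord p == p) = false.
Proof. by apply/eqP => h; move: (epos_rev p); rewrite h; case: (epos p). Qed.

Lemma neq_rev p : (p == rev_ord p) = false.
Proof. by rewrite eq_sym rev_neq. Qed.

Lemma rev_eq p q : (rev_ord p == q) = (p == rev_ord q).
Proof. by rewrite -(inj_eq rev_ord_inj) rev_ordK. Qed.

Lemma epos_ipos (k : 'I_n) : epos (ipos k). Proof. by rewrite /epos /=. Qed.

Lemma sum_epos (V : zmodType) (f : 'I_(n + n) -> V) :
  (forall p, ~~ epos p -> f p = 0) -> \sum_p f p = \sum_(k < n) f (ipos k).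
Proof.
move=> h; rewrite big_split_ord /= [X in _ + X]big1 ?addr0 // => i _.
by apply: h; rewrite /epos /= -leqNgt leq_addr.
Qed.
End Index.

Ltac idx :=
  try apply/negbTE; rewrite ?rev_ordK ?(inj_eq rev_ord_inj);
  first [ assumption | by rewrite neq_rev | by rewrite rev_neq | rewrite eq_sym; assumption
        | rewrite rev_eq; assumption | rewrite -rev_eq; assumption
        | rewrite eq_sym rev_eq; assumption | rewrite eq_sym -rev_eq; assumption
        | rewrite rev_eq eq_sym; assumption | rewrite -rev_eq eq_sym; assumption ].

Section Calculus.
Variables (R : nzRingType) (S : form_ring R).
Local Notation bar := (fbar S).
Local Notation lam := (flam S).
Local Notation li := (fbar S (flam S)).

Lemma barD x y : bar (x + y) = bar x + bar y. Proof. by case: (fbarP S). Qed.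
Lemma barM x y : bar (x * y) = bar y * bar x. Proof. by case: (fbarP S) => _ []. Qed.
Lemma barK x : bar (bar x) = x. Proof. by case: (fbarP S) => _ []. Qed.
Lemma bar0 : bar 0 = 0. Proof. by apply: (addrI (bar 0)); rewrite -barD !addr0. Qed.
Lemma barN x : bar (- x) = - bar x.
Proof. by apply: (addrI (bar x)); rewrite -barD !addrN bar0. Qed.
Lemma barB x y : bar (x - y) = bar x - bar y. Proof. by rewrite barD barN. Qed.
Lemma bar1 : bar 1 = 1. Proof. by rewrite -[RHS]barK -{2}(mul1r (bar 1)) barM barK mul1r. Qed.
Lemma bar_sum (I : Type) (r : seq I) (P : pred I) (F : I -> R) :
  bar (\sum_(i <- r | P i) F i) = \sum_(i <- r | P i) bar (F i).
Proof. exact: (big_morph bar barD bar0). Qed.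
Lemma bar_nat (b : bool) : bar b%:R = b%:R.
Proof. by case: b; rewrite ?bar1 ?bar0. Qed.

Lemma bar_central c : central c -> central (bar c).
Proof. by move=> hc r; rewrite -[r]barK -!barM hc. Qed.

Lemma lamC : central lam. Proof. exact: flam_central. Qed.
Lemma lam_li : lam * li = 1. Proof. exact: flamU. Qed.
Lemma li_lam : li * lam = 1. Proof. by rewrite -lamC lam_li. Qed.
Lemma liC : central li.
Proof. exact/bar_central/lamC. Qed.

Lemma Lam0 : fLam S 0. Proof. by case: (fLamP S) => [[]]. Qed.
Lemma LamD x y : fLam S x -> fLam S y -> fLam S (x + y).
Proof. by case: (fLamP S) => [[_ [h _]] _]; exact: h. Qed.
Lemma LamN x : fLam S x -> fLam S (- x). Proof. by case: (fLamP S) => [[_ [_ h]] _]; exact: h. Qed.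
Lemma Lam_min r : fLam S (r - lam * bar r). Proof. by case: (fLamP S) => _ []. Qed.
Lemma Lam_skew a : fLam S a -> a = - (lam * bar a).
Proof. by case: (fLamP S) => _ [_ [h _]]; exact: h. Qed.
Lemma Lam_conj r a : fLam S a -> fLam S (r * a * bar r).
Proof. by case: (fLamP S) => _ [_ [_ h]]; exact: h. Qed.

Definition adj a b (A : 'M[R]_(a, b)) : 'M[R]_(b, a) := \matrix_(i, j) bar (A j i).

Section Adj.
Variables a b : nat.
Implicit Types A B : 'M[R]_(a, b).
Lemma adjD A B : adj (A + B) = adj A + adj B.
Proof. by apply/matrixP => i j; rewrite !mxE barD. Qed.
Lemma adjN A : adj (- A) = - adj A.
Proof. by apply/matrixP => i j; rewrite !mxE barN. Qed.
Lemma adjB A B : adj (A - B) = adj A - adj B.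
Proof. by rewrite adjD adjN. Qed.
Lemma adj0 : adj (0 : 'M_(a, b)) = 0.
Proof. by apply/matrixP => i j; rewrite !mxE bar0. Qed.
Lemma adjK A : adj (adj A) = A.
Proof. by apply/matrixP => i j; rewrite !mxE barK. Qed.
Lemma adjZ c A : central c -> adj (c *: A) = bar c *: adj A.
Proof.
by move=> hc; apply/matrixP => i j; rewrite !mxE barM (bar_central hc).
Qed.
Lemma adjM c A (C : 'M_(b, c)) : adj (A *m C) = adj C *m adj A.
Proof.
apply/matrixP => i j; rewrite !mxE bar_sum; apply: eq_bigr => k _.
by rewrite !mxE barM.
Qed.
Lemma mulmxZ c d A (C : 'M_(b, d)) : central c -> A *m (c *: C) = c *: (A *m C).
Proof. exact: mx11_central_scale. Qed.
End Adj.

Lemma adj_scalar k (x : R) : adj (x%:M : 'M_k) = (bar x)%:M.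
Proof.
apply/matrixP => i j; rewrite !mxE eq_sym; case: eqP => _ /=.
  by rewrite !mulr1n.
by rewrite !mulr0n bar0.
Qed.

Definition Lam1 (a : 'M[R]_1) := fLam S (a 0 0).

Lemma Lam1_0 : Lam1 0. Proof. by rewrite /Lam1 mxE; exact: Lam0. Qed.
Lemma Lam1D a b : Lam1 a -> Lam1 b -> Lam1 (a + b).
Proof. by rewrite /Lam1 mxE; exact: LamD. Qed.
Lemma Lam1N a : Lam1 a -> Lam1 (- a).
Proof. by rewrite /Lam1 mxE; exact: LamN. Qed.
Lemma Lam1B a b : Lam1 a -> Lam1 b -> Lam1 (a - b).
Proof. by move=> ha /Lam1N; exact: Lam1D. Qed.
Lemma Lam1_min a : Lam1 (a - lam *: adj a).
Proof. by rewrite /Lam1 !mxE; exact: Lam_min. Qed.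
Lemma Lam1_skew a : Lam1 a -> a = - (lam *: adj a).
Proof. by move=> /Lam_skew h; apply/matrixP => i j; rewrite !ord1 [LHS]h !mxE. Qed.
Lemma Lam1_conj r a : Lam1 a -> Lam1 (r *m a *m adj r).
Proof.
move=> /(Lam_conj (r 0 0)); rewrite /Lam1 !mxE big_ord1 !mxE big_ord1; exact.
Qed.
Lemma Lam1_conj' r a : Lam1 a -> Lam1 (adj r *m a *m r).
Proof. by move=> h; rewrite -{2}(adjK r); exact: Lam1_conj. Qed.

Section Form.
Variable n : nat.
Local Notation N := (n + n)%N.
Local Notation col := 'cV[R]_N.
Implicit Types (u v w : col) (p q : 'I_N).

(** [Fmx] and [Jmx] are the Gram matrices of f and h; below, [star u] is the row of the functional
    h(u, -). *)
Definition Fmx : 'M[R]_N := \matrix_(p, q) (epos p && (q == rev_ord p))%:R.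
Definition Jmx : 'M[R]_N := Fmx + lam *: adj Fmx.
(** The forms, and later [trv], are locked so that rewriting with associativity does not take them
    apart into products of matrices. *)
Fact form_key : unit. Proof. by []. Qed.
Definition ff : col -> col -> 'M[R]_1 :=
  locked_with form_key (fun u v => adj u *m Fmx *m v).
Definition star : col -> 'rV[R]_N := locked_with form_key (fun u => adj u *m Jmx).

Lemma ffdef u v : ff u v = adj u *m Fmx *m v. Proof. by rewrite /ff locked_withE. Qed.
Lemma stardef u : star u = adj u *m Jmx. Proof. by rewrite /star locked_withE. Qed.

Lemma Fmx_mulE v p : (Fmx *m v) p 0 = if epos p then v (rev_ord p) 0 else 0.
Proof.
rewrite mxE (bigD1 (rev_ord p)) //= !mxE eqxx andbT big1 => [|q /negPf h].
  by case: (epos p); rewrite ?mul1r ?mul0r addr0.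
by rewrite mxE h andbF mul0r.
Qed.

Lemma fform_ff u v : fform bar u v = ff u v 0 0.
Proof.
rewrite !ffdef -mulmxA mxE sum_epos => [|p /negPf h]; last by rewrite Fmx_mulE h mulr0.
by apply: eq_bigr => k _; rewrite Fmx_mulE epos_ipos !mxE.
Qed.

Lemma star_ff u v : star u *m v = ff u v + lam *: adj (ff v u).
Proof.
rewrite stardef !ffdef /Jmx !adjM adjK mulmxDr mulmxDl mulmxZ; last exact: lamC.
by rewrite -scalemxAl !mulmxA.
Qed.

Lemma hform_star u v : hform bar lam u v = (star u *m v) 0 0.
Proof.
have E (A B : 'M[R]_1) : (A + lam *: adj B) 0 0 = A 0 0 + lam * bar (B 0 0) by rewrite !mxE.
rewrite star_ff E -!fform_ff /hform /fform bar_sum mulr_sumr -big_split /=.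
by apply: eq_bigr => k _; rewrite barM barK mulrA.
Qed.

Lemma starD u v : star (u + v) = star u + star v.
Proof. by rewrite !stardef adjD mulmxDl. Qed.
Lemma starN u : star (- u) = - star u.
Proof. by rewrite !stardef adjN mulNmx. Qed.
Lemma star0 : star 0 = 0.
Proof. by rewrite !stardef adj0 mul0mx. Qed.
Lemma starM u (x : 'M_1) : star (u *m x) = adj x *m star u.
Proof. by rewrite !stardef adjM mulmxA. Qed.
Lemma starZ c u : central c -> star (c *: u) = bar c *: star u.
Proof. by move=> hc; rewrite !stardef adjZ // -scalemxAl. Qed.

Lemma ffDl u v w : ff (u + v) w = ff u w + ff v w.
Proof. by rewrite !ffdef adjD !mulmxDl. Qed.
Lemma ffDr u v w : ff u (v + w) = ff u v + ff u w.
Proof. by rewrite !ffdef mulmxDr. Qed.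
Lemma ffN u v : ff (- u) (- v) = ff u v.
Proof. by rewrite !ffdef adjN mulmxN !mulNmx opprK. Qed.
Lemma ffNl u v : ff (- u) v = - ff u v.
Proof. by rewrite !ffdef adjN !mulNmx. Qed.
Lemma ffNr u v : ff u (- v) = - ff u v.
Proof. by rewrite !ffdef mulmxN. Qed.
Lemma ff0l v : ff 0 v = 0. Proof. by rewrite !ffdef adj0 !mul0mx. Qed.
Lemma ff0r v : ff v 0 = 0. Proof. by rewrite !ffdef mulmx0. Qed.
Lemma ffM u v (x y : 'M_1) : ff (u *m x) (v *m y) = adj x *m ff u v *m y.
Proof. by rewrite !ffdef adjM !mulmxA. Qed.
Lemma ffMr u v (y : 'M_1) : ff u (v *m y) = ff u v *m y.
Proof. by rewrite !ffdef !mulmxA. Qed.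
Lemma ffMl u v (x : 'M_1) : ff (u *m x) v = adj x *m ff u v.
Proof. by rewrite !ffdef adjM !mulmxA. Qed.
Lemma ffZ c u v : central c -> c * bar c = 1 -> ff (c *: u) (c *: v) = ff u v.
Proof.
move=> hc h1; rewrite !ffdef adjZ // mulmxZ // -!scalemxAl scalerA h1 scale1r //.
Qed.

Lemma star_sym u v : star u *m v = lam *: adj (star v *m u).
Proof.
rewrite !star_ff adjD adjZ; last exact: lamC.
by rewrite adjK scalerDr scalerA lam_li scale1r addrC.
Qed.

Lemma star_eq0_sym u v : star u *m v = 0 -> star v *m u = 0.
Proof. by move=> h; rewrite star_sym h adj0 scaler0. Qed.

(** The polarisation of u -> f(u, u) is h(u, v) modulo Lambda, because h(u, v) - f(u, v) = lam bar
    f(v, u). *)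
Lemma ff_sum_min u v : Lam1 (ff u v + ff v u - star u *m v).
Proof.
by rewrite star_ff opprD addrACA subrr add0r; exact: Lam1_min.
Qed.

Lemma Jmx_entry p q : Jmx p q = if q == rev_ord p then (if epos p then 1 else lam) else 0.
Proof.
rewrite !mxE bar_nat; have -> : (p == rev_ord q) = (q == rev_ord p) by rewrite -rev_eq eq_sym.
case: eqP => [->|_]; last by rewrite !andbF mulr0 addr0.
rewrite epos_rev !andbT; case: (epos p); rewrite /= ?mulr0 ?mulr1 ?addr0 ?add0r //.
Qed.

(** The value h(e_p, e_{-p}), a central unit; it converts matrix entries into values of the form. *)
Definition mu p : R := if epos p then 1 else lam.

Lemma muC p : central (mu p).
Proof. by rewrite /mu; case: (epos p); [move=> r; rewrite mul1r mulr1|exact: lamC]. Qed.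
Lemma bar_muC p : central (bar (mu p)).
Proof. by rewrite /mu; case: (epos p); [move=> r; rewrite bar1 mul1r mulr1|exact: liC]. Qed.
Lemma muV p : mu p * bar (mu p) = 1.
Proof. by rewrite /mu; case: (epos p); rewrite ?lam_li ?bar1 ?mul1r. Qed.
Lemma muVl p : bar (mu p) * mu p = 1.
Proof. by rewrite -muC muV. Qed.
Lemma muK p x : x * bar (mu p) * mu p = x.
Proof. by rewrite -mulrA muVl mulr1. Qed.
Lemma muKV p x : x * mu p * bar (mu p) = x.
Proof. by rewrite -mulrA muV mulr1. Qed.

Lemma star_entry u q : star u 0 q = bar (u (rev_ord q) 0) * mu (rev_ord q).
Proof.
rewrite stardef mxE (bigD1 (rev_ord q)) //= Jmx_entry rev_ordK eqxx mxE big1 ?addr0 //.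
by move=> p /negPf h; rewrite Jmx_entry -rev_eq eq_sym h mulr0.
Qed.

Definition ee p : col := delta_mx p 0.

Lemma star_ee p v : star (ee p) *m v = (mu p * v (rev_ord p) 0)%:M.
Proof.
rewrite [LHS]mx11_scalar mxE (bigD1 (rev_ord p)) //= star_entry rev_ordK big1.
  by rewrite !mxE !eqxx bar1 mul1r addr0.
move=> q /negPf h; rewrite star_entry !mxE eqxx andbT rev_eq h bar0 !mul0r //.
Qed.

Lemma mul_ee m (A : 'M[R]_(m, N)) p (q : 'I_m) : (A *m ee p) q 0 = A q p.
Proof.
rewrite mxE (bigD1 p) //= !mxE !eqxx mulr1 big1 ?addr0 // => r /negPf h.
by rewrite mxE h mulr0.
Qed.

Lemma star_mul_ee u p : star u *m ee p = (bar (u (rev_ord p) 0) * mu (rev_ord p))%:M.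
Proof. by rewrite [LHS]mx11_scalar mul_ee star_entry. Qed.

Lemma star_mulE u v : (star u *m v) 0 0 = \sum_p bar (u p 0) * mu p * v (rev_ord p) 0.
Proof.
rewrite mxE (reindex_inj rev_ord_inj) /=; apply: eq_bigr => p _.
by rewrite star_entry rev_ordK.
Qed.

Lemma ffE u v : ff u v 0 0 = \sum_(p | epos p) bar (u p 0) * v (rev_ord p) 0.
Proof.
rewrite !ffdef -mulmxA mxE [RHS]big_mkcond; apply: eq_bigr => p _.
by rewrite Fmx_mulE mxE; case: (epos p); rewrite ?mulr0.
Qed.

Lemma mulmx1_entry u (x : 'M_1) p : (u *m x) p 0 = u p 0 * x 0 0.
Proof. by rewrite mxE big_ord1. Qed.

Lemma ee_entry p q : ee p q 0 = (q == p)%:R.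
Proof. by rewrite mxE eqxx andbT. Qed.

Lemma eex_entry p (x : 'M_1) q : (ee p *m x) q 0 = if q == p then x 0 0 else 0.
Proof. by rewrite mulmx1_entry ee_entry; case: eqP; rewrite ?mul1r ?mul0r. Qed.

Lemma col_sum u : u = \sum_p ee p *m (u p 0)%:M.
Proof.
apply/matrixP => i j; rewrite ord1 summxE (bigD1 i) //= eex_entry eqxx mxE mulr1n.
by rewrite big1 ?addr0 // => p h; rewrite eex_entry eq_sym (negPf h).
Qed.

End Form.
End Calculus.

(** * Eichler transvections *)

(** Inverses are carried explicitly: over a noncommutative ring a one-sided inverse of a matrix need
    not be two-sided. *)
Definition inv2 (R : nzRingType) m (a b : 'M[R]_m) : Prop := a *m b = 1%:M /\ b *m a = 1%:M.

Lemma inv2_sym (R : nzRingType) m (a b : 'M[R]_m) : inv2 a b -> inv2 b a.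
Proof. by case. Qed.

Lemma inv2_mul (R : nzRingType) m (a a' b b' : 'M[R]_m) :
  inv2 a a' -> inv2 b b' -> inv2 (a *m b) (b' *m a').
Proof.
move=> [h1 h2] [h3 h4]; split; rewrite mulmxA.
  by rewrite -(mulmxA a) h3 mulmx1.
by rewrite -(mulmxA b') h2 mulmx1.
Qed.

Lemma inv2_conj (R : nzRingType) m (s s' a b : 'M[R]_m) :
  inv2 s s' -> inv2 a b -> inv2 (s *m a *m s') (s *m b *m s').
Proof.
move=> ss ab; have := inv2_mul (inv2_mul ss ab) (inv2_sym ss).
by rewrite mulmxA.
Qed.

Lemma inv2_uniq (R : nzRingType) m (a b c : 'M[R]_m) : inv2 a b -> inv2 a c -> b = c.
Proof. by move=> [h1 h2] [h3 h4]; rewrite -(mulmx1 b) -h3 mulmxA h2 mul1mx. Qed.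

Section Transvections.
Variables (R : nzRingType) (S : form_ring R) (n : nat).
Local Notation bar := (fbar S).
Local Notation lam := (flam S).
Local Notation li := (fbar S (flam S)).
Local Notation N := (n + n)%N.
Local Notation col := 'cV[R]_N.
Local Notation star := (star S).
Local Notation ff := (ff S).
Local Notation adj := (adj S).
Local Notation Lam1 := (Lam1 S).
Local Notation ee := (@ee R n).
Local Notation J := (Jmx S n).
Implicit Types (u v w : col) (p q : 'I_N) (s t : 'M[R]_N).

(** The map w -> w + u h(v, w) - li v h(u, w) + u a h(u, w). For [u] isotropic and orthogonal to [v]
    it preserves h when a + li adj a + li h(v, v) = 0. *)
Definition trv : col -> col -> 'M[R]_1 -> 'M[R]_N := locked_with form_key (fun u v a =>
  1%:M + u *m star v - li *: (v *m star u) + u *m a *m star u).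

Lemma trvdef u v a :
  trv u v a = 1%:M + u *m star v - li *: (v *m star u) + u *m a *m star u.
Proof. by rewrite /trv locked_withE. Qed.

Lemma trvE u v a w : trv u v a *m w =
  w + u *m (star v *m w) - li *: (v *m (star u *m w)) + u *m a *m (star u *m w).
Proof. by rewrite !trvdef !mulmxDl mul1mx mulNmx -scalemxAl !mulmxA. Qed.

Lemma trv00 u : trv u 0 0 = 1%:M.
Proof. by rewrite trvdef star0 !(mulmx0, mul0mx) scaler0 !addr0 oppr0 addr0. Qed.

Ltac expand := rewrite ?(mulmxDl, mulmxDr, mulNmx, mulmxN, mulmx1, mul1mx, mulmxA, scalerDr,
  scalerN, (mulmxZ _ _ (@liC _ S)), (mulmxZ _ _ (@lamC _ S)), opprD, opprK, scalerA, oppr0,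
  starD, starN, starM, star0, adj0, adjN, mul0mx, mulmx0, scaler0, adjK) -?scalemxAl.

Ltac zap h := rewrite ?(mul_eq0 _ h) ?h ?(mul0mx, mulmx0, scaler0, oppr0, addr0, add0r).

(** For fixed isotropic [u] the transvections multiply as in a Heisenberg group, h(v, v') being the
    central cocycle. *)
Lemma trv_mul u v v' a a' : star u *m u = 0 -> star u *m v = 0 -> star u *m v' = 0 ->
  trv u v a *m trv u v' a' = trv u (v + v') (a + a' - li *: (star v *m v')).
Proof.
move=> uu uv uv'; have vu := star_eq0_sym uv; have v'u := star_eq0_sym uv'.
rewrite !trvdef; expand; expand; zap uu; zap uv; zap vu; zap uv'; zap v'u.
abel.
Qed.

(** Without quadratic part the two vectors play symmetric roles; a difficult [u] can thus be traded
    for an easy [v]. *)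
Lemma trv_swap u v x : trv u (v *m x) 0 = trv v (- (lam *: (u *m adj x))) 0.
Proof.
rewrite !trvdef; expand; rewrite starZ; last exact: lamC.
expand; rewrite li_lam scale1r; abel.
Qed.

Lemma trv_scale u v a x : trv (u *m x) v a = trv u (v *m adj x) (x *m a *m adj x).
Proof. by rewrite !trvdef; expand. Qed.

(** Splits a transvection along a sum of orthogonal isotropic vectors, the last factor being the
    cross term. It is used backwards: conjugation produces the vector x + y, and the factor at [y]
    is extracted. *)
Lemma trv_add x y v c : star x *m x = 0 -> star y *m y = 0 -> star x *m y = 0 ->
  star x *m v = 0 -> star y *m v = 0 -> c + li *: adj c + li *: (star v *m v) = 0 ->
  trv (x + y) v c = trv x v c *m trv y v c *m trv y (x *m adj c) 0.
Proof.
move=> xx yy xy xv yv /eqP; rewrite addrC addr_eq0 => /eqP vv.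
have yx := star_eq0_sym xy; have vx := star_eq0_sym xv; have vy := star_eq0_sym yv.
rewrite !trvdef; expand; expand; zap xx; zap yy; zap xy; zap yx; zap xv; zap yv; zap vx; zap vy.
have E : li *: (x *m star v *m v *m star y) = x *m (li *: (star v *m v)) *m star y.
  by rewrite mulmxZ; [rewrite -scalemxAl !mulmxA|exact: liC].
rewrite E vv; expand; abel.
Qed.

Lemma adj_unit_star s : adj s *m J *m s = J -> forall t, s *m t = 1%:M ->
  forall u, star u *m t = star (s *m u).
Proof.
move=> hs t st u; rewrite !stardef adjM -!mulmxA; congr (_ *m _).
by rewrite -{1}hs -!mulmxA st mulmx1.
Qed.

Lemma trv_conj s t u v a : adj s *m J *m s = J -> inv2 s t ->
  s *m trv u v a *m t = trv (s *m u) (s *m v) a.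
Proof.
move=> hs [st ts]; rewrite !trvdef -!(adj_unit_star hs st).
by expand; rewrite st.
Qed.

Lemma trv_ring_inv u v a : star u *m u = 0 -> star u *m v = 0 ->
  inv2 (trv u v a) (trv u (- v) (- a - li *: (star v *m v))).
Proof.
move=> uu uv; split; rewrite trv_mul ?mulmxN ?uv ?oppr0 // ?addrN ?addNr -[RHS](trv00 u);
  congr trv; expand; expand; abel.
Qed.

Definition iso u : Prop := Lam1 (ff u u).

Lemma iso_star u : iso u -> star u *m u = 0.
Proof. by move=> h; rewrite star_ff {1}(Lam1_skew h) addNr. Qed.

Lemma isoM u (x : 'M_1) : iso u -> iso (u *m x).
Proof. by rewrite /iso ffM; exact: Lam1_conj'. Qed.

(** Normalises the quadratic part: the unitary transvections at isotropic [u] in an orthogonal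
    direction [v] are parametrised by [al] in Lambda. *)
Definition tv u v al := trv u v (- (li *: (ff v v + al))).

Lemma tv_cond v al (c := - (li *: (ff v v + al))) : Lam1 al ->
  c + li *: adj c + li *: (star v *m v) = 0.
Proof.
move=> h; rewrite /c star_ff adjN adjZ; last exact: liC.
rewrite barK {1}(Lam1_skew h) adjD; expand; expand; rewrite li_lam !scale1r; abel.
Qed.

Lemma tv_mulE u v v' al al' : star u *m u = 0 -> star u *m v = 0 -> star u *m v' = 0 ->
  tv u v al *m tv u v' al' =
  tv u (v + v') (al + al' - (ff v v' + ff v' v - star v *m v')).
Proof.
move=> uu uv uv'; rewrite /tv trv_mul //; congr trv.
rewrite -!scalerN -!scalerDr; congr (_ *: _).
by rewrite ffDl !ffDr; abel.
Qed.

Lemma tv_inv u v al : star u *m u = 0 -> star u *m v = 0 -> Lam1 al ->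
  exists2 be, Lam1 be & inv2 (tv u v al) (tv u (- v) be).
Proof.
move=> uu uv h; exists (- al - (ff v v + ff v v - star v *m v)).
  exact: Lam1B (Lam1N h) (ff_sum_min _ _ _).
have -> : tv u (- v) (- al - (ff v v + ff v v - star v *m v)) =
  trv u (- v) (- (- (li *: (ff v v + al))) - li *: (star v *m v)); last exact: trv_ring_inv.
rewrite /tv; congr trv; rewrite -!scalerN -!scalerDr; congr (_ *: _); rewrite ffN; abel.
Qed.

Lemma trv0_tv u v : iso v -> exists2 al, Lam1 al & trv u v 0 = tv u v al.
Proof.
move=> h; exists (- ff v v); first exact: Lam1N.
by rewrite /tv subrr scaler0 oppr0.
Qed.

(** The form defect of [s] at [u]. It is a cocycle ([phiM]), and its values decide membership in the
    unitary group and in its congruence subgroups. *)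
Definition phi s u := ff (s *m u) (s *m u) - ff u u.

Definition unitary s := U_grp bar lam (fLam S) s.

Lemma unitaryP s : unitary s <->
  [/\ exists t, inv2 s t, adj s *m J *m s = J & forall u, Lam1 (phi s u)].
Proof.
have E (u v : col) : star (s *m u) *m (s *m v) = adj u *m (adj s *m J *m s) *m v.
  by rewrite !stardef adjM !mulmxA.
have L u : Lam1 (phi s u) = fLam S (fform bar (s *m u) (s *m u) - fform bar u u).
  by rewrite !fform_ff /Lam1 /phi !mxE.
split=> [[h1 [h2 h3]]|[h1 h2 h3]].
  split; [exact: h1| |by move=> u; rewrite L].
  apply/matrixP => p q; have := h2 (ee p) (ee q); rewrite !hform_star E.
  have D (A : 'M[R]_N) : (adj (ee p) *m A *m ee q) 0 0 = A p q.
    rewrite mul_ee mxE (bigD1 p) //= mxE ee_entry eqxx bar1 mul1r big1 ?addr0 // => i /negPf h.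
    by rewrite mxE ee_entry h bar0 mul0r.
  by rewrite D !stardef D.
split; first by case: h1 => t ht; exists t.
split=> [u v|u]; last by rewrite -L; exact: h3.
by rewrite !hform_star E h2 stardef.
Qed.

Lemma unitary_inv2 s : unitary s -> exists t, inv2 s t.
Proof. by case/unitaryP. Qed.
Lemma unitary_J s : unitary s -> adj s *m J *m s = J.
Proof. by case/unitaryP. Qed.
Lemma unitary_phi s u : unitary s -> Lam1 (phi s u).
Proof. by case/unitaryP. Qed.

Lemma unitary_star s u v : unitary s -> star (s *m u) *m (s *m v) = star u *m v.
Proof.
by move=> h; rewrite !stardef -{2}(unitary_J h) adjM !mulmxA.
Qed.

Lemma unitary_iso s u : unitary s -> iso u -> iso (s *m u).
Proof.
move=> h hu; rewrite /iso; have := Lam1D (unitary_phi u h) hu.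
by rewrite /phi subrK.
Qed.

Lemma phiM s t u : phi (s *m t) u = phi s (t *m u) + phi t u.
Proof. by rewrite /phi -!mulmxA addrA subrK. Qed.

Lemma phi1 u : phi 1%:M u = 0.
Proof. by rewrite /phi mul1mx subrr. Qed.

Lemma unitary1 : unitary 1%:M.
Proof.
apply/unitaryP; split; first by exists 1%:M; split; rewrite mulmx1.
  by rewrite adj_scalar bar1 mul1mx mulmx1 .
by move=> u; rewrite phi1; exact: Lam1_0.
Qed.

Lemma unitaryM s t : unitary s -> unitary t -> unitary (s *m t).
Proof.
move=> /unitaryP [[s' ss'] Js Ls] /unitaryP [[t' tt'] Jt Lt]; apply/unitaryP; split.
- by exists (t' *m s'); exact: inv2_mul.
- by rewrite adjM !mulmxA -(mulmxA (adj t)) -(mulmxA (adj t) _ s) Js Jt.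
- by move=> u; rewrite phiM; exact: Lam1D.
Qed.

Lemma unitaryV s t : unitary s -> inv2 s t -> unitary t.
Proof.
move=> /unitaryP [_ Js Ls] [st ts]; apply/unitaryP; split; first by exists s.
  have h : adj t *m adj s = 1%:M by rewrite -adjM st adj_scalar bar1.
  by rewrite -{1}Js !mulmxA h mul1mx -mulmxA st mulmx1.
move=> u; have := phiM s t u; rewrite st phi1 => /eqP; rewrite eq_sym addr_eq0 => /eqP h.
by have := Lam1N (Ls (t *m u)); rewrite h opprK.
Qed.

End Transvections.

(** * The elementary group *)

Section Elementary.
Variables (R : nzRingType) (S : form_ring R) (n : nat).
Local Notation bar := (fbar S).
Local Notation lam := (flam S).
Local Notation li := (fbar S (flam S)).
Local Notation N := (n + n)%N.
Local Notation col := 'cV[R]_N.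
Local Notation star := (star S).
Local Notation ff := (ff S).
Local Notation adj := (adj S).
Local Notation Lam1 := (Lam1 S).
Local Notation ee := (@ee R n).
Local Notation mu := (@mu R S n).
Local Notation trv := (trv S).
Local Notation tv := (tv S).
Local Notation iso := (iso S).
Implicit Types (u v w : col) (p q : 'I_N) (s t : 'M[R]_N) (x y al : 'M[R]_1).

Ltac expand := rewrite ?(mulmxDl, mulmxDr, mulNmx, mulmxN, mulmx1, mul1mx, mulmxA, scalerDr,
  scalerN, (mulmxZ _ _ (@liC _ S)), (mulmxZ _ _ (@lamC _ S)), opprD, opprK, scalerA, oppr0,
  starD, starN, starM, star0, adj0, adjN, adjD, mul0mx, mulmx0, scaler0, adjK) -?scalemxAl.

Ltac zap h := rewrite ?(mul_eq0 _ h) ?h ?(mul0mx, mulmx0, scaler0, oppr0, addr0, add0r).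

Lemma mulmx_central (a b : nat) (A : 'M[R]_(a, b)) c : central c -> A *m c%:M = c *: A.
Proof. by move=> hc; rewrite -[c%:M]mulr1 -[_ * _]/(c%:M *m 1%:M) mul_scalar_mx mulmxZ ?mulmx1. Qed.

Lemma star_liZ u : star (li *: u) = lam *: star u.
Proof. by rewrite starZ; [rewrite barK|exact: liC]. Qed.

Lemma ff_liZ u v : ff (li *: u) (li *: v) = ff u v.
Proof. by apply: ffZ; [exact: liC|rewrite barK li_lam]. Qed.

Lemma trv_form u v a : star u *m u = 0 -> star u *m v = 0 ->
  a + li *: adj a + li *: (star v *m v) = 0 -> forall w w',
  star (trv u v a *m w) *m (trv u v a *m w') = star w *m w'.
Proof.
move=> uu uv ha w w'; have vu := star_eq0_sym uv.
rewrite !trvE; set x := star v *m w; set y := star u *m w.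
have hx : star w *m v = lam *: adj x by rewrite star_sym.
have hy : star w *m u = lam *: adj y by rewrite star_sym.
clearbody x y.
rewrite -!(mulmxA u a) !(starD, starN, star_liZ, starM) !(mulmxDl, mulmxDr, mulNmx, mulmxN).
rewrite !(mulmxZ _ _ (@liC _ S)) -?scalemxAl ?adjM ?mulmxA.
rewrite !hx !hy; zap uu; zap uv; zap vu; rewrite -?scalemxAl ?mulmxA.
rewrite ?scalerA ?li_lam ?lam_li ?scale1r -/x -/y -!(mulmxA _ (star v) w').
rewrite -!(mulmxA _ (star u) w'); set x' := star v *m w'; set y' := star u *m w'; clearbody x' y'.
(* The terms that survive the expansion are the condition [ha], placed between the values of h(u, -)
   on the two arguments. *)
have : lam *: (adj y *m (a + li *: adj a + li *: (star v *m v)) *m y') = 0.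
  by rewrite ha mulmx0 mul0mx scaler0.
rewrite !(mulmxDr, mulmxDl) !(mulmxZ _ _ (@liC _ S)) -!scalemxAl !scalerDr !scalerA lam_li !scale1r.
rewrite !mulmxA => h; rewrite -[RHS]addr0 -h; abel.
Qed.

Lemma trv_phi u v al w : iso u -> star u *m v = 0 -> Lam1 al -> Lam1 (phi S (tv u v al) w).
Proof.
move=> hu uv hal; have uu := iso_star hu.
rewrite /phi /tv; set a := - _; rewrite trvE -(mulmxA u a).
set x := star v *m w; set y := star u *m w.
have ha : adj a = - (lam *: adj (ff v v)) + al.
  rewrite /a adjN adjZ; last exact: liC.
  by rewrite barK adjD scalerDr {2}(Lam1_skew hal) opprD.
have -> : w + u *m x - li *: (v *m y) + u *m (a *m y) =
          w + (u *m (x + a *m y) - li *: (v *m y)) by rewrite mulmxDr; abel.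
set z := x + _; set d := u *m z - _.
(* [d] is the displacement of [w]; by polarisation the defect equals f(d, d) + h(d, w) modulo
   Lambda. *)
have hd : Lam1 (ff d d + star d *m w).
  have h1 := ff_sum_min S (u *m z) (- (li *: (v *m y))).
  rewrite starM -!mulmxA mulmxN mulmxZ ?(mulmxA (star u)) ?uv ?(mul0mx, mulmx0, scaler0, oppr0, subr0) in h1;
    last exact: liC.
  have -> : ff d d + star d *m w = (ff (u *m z) (- (li *: (v *m y))) + ff (- (li *: (v *m y))) (u *m z))
     + ff (u *m z) (u *m z) + (adj x *m y - lam *: adj (adj x *m y)) +
     adj y *m (ff v v - lam *: adj (ff v v) + al) *m y.
    rewrite /d ffDl !ffDr ffN ff_liZ !ffM starD starM starN star_liZ starM.
    rewrite mulmxDl mulNmx -scalemxAl -!mulmxA -/y -/x.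
    clearbody x y; have az : adj z = adj x + adj y *m adj a by rewrite /z adjD adjM.
    rewrite (adjM _ (adj x)) adjK az ha; clearbody z.
    by rewrite !mulmxDl !mulmxDr !mulmxA !mulmxDl ?mulmxN ?mulNmx ?mulmxA; abel.
  by apply: Lam1D; [apply: Lam1D; [apply: Lam1D => //; exact: isoM|exact: Lam1_min]|
    apply: Lam1_conj'; apply: Lam1D => //; exact: Lam1_min].
have -> : ff (w + d) (w + d) - ff w w = ff d d + star d *m w + (ff d w + ff w d - star d *m w).
  by rewrite ffDl !ffDr; abel.
by apply: Lam1D => //; exact: ff_sum_min.
Qed.

Lemma tv_unitary u v al : iso u -> star u *m v = 0 -> Lam1 al -> unitary S (tv u v al).
Proof.
move=> hu uv hal; have uu := iso_star hu.
have [be _ hi] := tv_inv uu uv hal.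
split; first by exists (tv u (- v) be).
split=> [w w'|w]; first by rewrite !hform_star trv_form //; exact: tv_cond.
by have := trv_phi w hu uv hal; rewrite !fform_ff /Lam1 /phi !mxE.
Qed.

Lemma ff_ee0 p q : q != rev_ord p -> ff (ee p) (ee q) = 0.
Proof.
move=> h; rewrite [LHS]mx11_scalar ffE big1 ?raddf0 // => i _; rewrite !ee_entry.
case: (i =P p) => [->|_]; last by rewrite bar0 mul0r.
by rewrite eq_sym (negPf h) mulr0.
Qed.

Lemma iso_eex p x : iso (ee p *m x).
Proof. by rewrite /iso ffM ff_ee0 ?neq_rev // mulmx0 mul0mx; exact: Lam1_0. Qed.

Lemma iso_ee p : iso (ee p).
Proof. by rewrite -[ee p]mulmx1; exact: iso_eex. Qed.

Lemma star_ee_row p : star (ee p) = mu p *: delta_mx 0 (rev_ord p).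
Proof.
apply/matrixP => i j; rewrite ord1 star_entry ee_entry rev_eq !mxE eqxx /=.
case: eqP => [->|_]; first by rewrite rev_ordK bar1 mul1r mulr1.
by rewrite bar0 mul0r mulr0.
Qed.

Lemma eex_delta p x q : ee p *m x *m delta_mx 0 q = x 0 0 *: delta_mx p q.
Proof.
apply/matrixP => i j; rewrite mxE big_ord1 eex_entry !mxE eqxx /=.
by case: (i == p); rewrite ?mul0r ?mulr0.
Qed.

(** The generators are transvections at basis vectors. The column index is reversed because h pairs
    e_q with e_{-q}. *)
Lemma trv_Tij p q x :
  trv (ee p) (ee q *m x) 0 = Tij bar lam p (rev_ord q) (bar (x 0 0) * mu q).
Proof.
rewrite trvdef mulmx0 mul0mx addr0 starM mulmxA !star_ee_row.
rewrite !(mulmxZ _ _ (@muC _ S _ _)) !eex_delta /Tij rev_ordK mxE !scalerA muC.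
congr (_ + _ - _ *: _); rewrite barM barK /lam_exp epos_rev /mu.
case: (epos p); case: (epos q); rewrite /= ?bar1 ?mul1r ?mulr1 ?mulrA ?li_lam ?lam_li ?mul1r //.
Qed.

Lemma Tij_trv p q (xi : R) :
  Tij bar lam p q xi = trv (ee p) (ee (rev_ord q) *m (mu (rev_ord q) * bar xi)%:M) 0.
Proof.
by rewrite trv_Tij rev_ordK mxE mulr1n barM barK -mulrA muVl mulr1.
Qed.

Lemma trv_Tii p x : trv (ee p) 0 x = Tii p (x 0 0 * mu p).
Proof.
rewrite trvdef star0 mul0mx mulmx0 scaler0 oppr0 !addr0 star_ee_row.
by rewrite (mulmxZ _ _ (@muC _ S _ _)) eex_delta scalerA muC.
Qed.

Lemma trv_long p al :
  trv (ee p) 0 (- (li *: al)) = Tii p (if epos p then li * - al 0 0 else - al 0 0).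
Proof.
rewrite trv_Tii !mxE /mu; case: (epos p); first by rewrite mulr1 mulrN.
by rewrite mulNr -lamC mulrA lam_li mul1r.
Qed.

Definition short_gen (I : R -> Prop) s : Prop :=
  exists p q x, [/\ q != p, q != rev_ord p, I (bar (x 0 0) * mu q) & s = trv (ee p) (ee q *m x) 0].
Definition long_gen (G : R -> Prop) s : Prop :=
  exists p al, G (- al 0 0) /\ s = trv (ee p) 0 (- (li *: al)).

Lemma rel_gensP I G s : rel_gens bar lam I G s <-> short_gen I s \/ long_gen G s.
Proof.
split=> [[[p [q [xi [h1 [h2 [h3 ->]]]]]]|[p [a [[g [hg ->]] ->]]]]|
         [[p [q [x [h1 h2 h3 ->]]]]|[p [al [hg ->]]]]].
- left; exists p, (rev_ord q), (mu (rev_ord q) * bar xi)%:M; split.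
  + by rewrite eq_sym.
  + by rewrite (inj_eq rev_ord_inj) eq_sym.
  + by rewrite mxE mulr1n barM barK -mulrA muVl mulr1.
  + exact: Tij_trv.
- right; exists p, (- g)%:M; rewrite mxE mulr1n opprK; split=> //.
  by rewrite trv_long !mxE mulr1n opprK.
- left; exists p, (rev_ord q), (bar (x 0 0) * mu q); split; first by rewrite eq_sym rev_eq.
  split; first by rewrite rev_ordK eq_sym.
  by split=> //; exact: trv_Tij.
- right; exists p; eexists; split; last exact: trv_long.
  by exists (- al 0 0).
Qed.

Local Notation EU := (@EU R bar lam n (fLam S)).

Lemma EU_min (P : 'M[R]_N -> Prop) s : is_subgroup P ->
  (forall p q x, q != p -> q != rev_ord p -> P (trv (ee p) (ee q *m x) 0)) ->
  (forall p al, Lam1 al -> P (trv (ee p) 0 (- (li *: al)))) -> EU s -> P s.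
Proof.
move=> hP h1 h2; apply => // t /rel_gensP [[p [q [x [hp hq _ ->]]]]|[p [al [hg ->]]]].
  exact: h1.
by apply: h2; rewrite /Lam1 -(opprK (al 0 0)); exact: LamN.
Qed.

Lemma EU1 : EU 1%:M. Proof. by move=> G []. Qed.
Lemma EUM s t : EU s -> EU t -> EU (s *m t).
Proof. by move=> hs ht G hG h; case: (hG) => _ [hM _]; apply: hM; [exact: hs|exact: ht]. Qed.

Lemma EU_short p q x : q != p -> q != rev_ord p -> EU (trv (ee p) (ee q *m x) 0).
Proof.
by move=> h1 h2 G _; apply; apply/rel_gensP; left; exists p, q, x.
Qed.
Lemma EU_long p al : Lam1 al -> EU (trv (ee p) 0 (- (li *: al))).
Proof.
by move=> h G _; apply; apply/rel_gensP; right; exists p, al; split=> //; exact: LamN.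
Qed.

Lemma star_ee_eex p q x : q != rev_ord p -> star (ee p) *m (ee q *m x) = 0.
Proof. by move=> h; rewrite star_ee eex_entry eq_sym (negPf h) mulr0 raddf0. Qed.

Lemma star_ee_ee p q : q != rev_ord p -> star (ee p) *m ee q = 0.
Proof. by move=> h; rewrite -[ee q]mulmx1; exact: star_ee_eex. Qed.

Lemma star_ee_rev p : star (ee p) *m ee (rev_ord p) = (mu p)%:M.
Proof. by rewrite star_ee ee_entry eqxx mulr1. Qed.

Lemma short_inv p q x : q != rev_ord p ->
  inv2 (trv (ee p) (ee q *m x) 0) (trv (ee p) (ee q *m - x) 0).
Proof.
move=> h; have uv := star_ee_eex x h; have uu := iso_star (iso_ee p).
have := trv_ring_inv 0 uu uv; rewrite (iso_star (iso_eex q x)).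
by rewrite scaler0 subr0 oppr0 mulmxN.
Qed.

Lemma long_inv p al : inv2 (trv (ee p) 0 (- (li *: al))) (trv (ee p) 0 (- (li *: - al))).
Proof.
have := @trv_ring_inv _ _ _ (ee p) 0 (- (li *: al)) (iso_star (iso_ee p)) (mulmx0 _ _).
by rewrite star0 mul0mx scaler0 subr0 oppr0 scalerN.
Qed.

Lemma EU_inv s : EU s -> exists2 t, EU t & inv2 s t.
Proof.
move=> hs; pose P (s : 'M[R]_N) := EU s /\ exists2 t, EU t & inv2 s t.
suff [] : P s by []. apply: EU_min hs.
- split; first by split; [exact: EU1|exists 1%:M; [exact: EU1|split; rewrite mulmx1]].
  split=> [a b [ha [a' ha' aa]] [hb [b' hb' bb]]|a [ha [a' ha' aa]]].
    split; first exact: EUM.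
    by exists (b' *m a'); [exact: EUM|exact: inv2_mul].
  by exists a'; split; [split=> //; exists a => //; exact: inv2_sym|case: aa].
- move=> p q x h1 h2; split; first exact: EU_short.
  by exists (trv (ee p) (ee q *m - x) 0); [exact: EU_short|exact: short_inv].
- move=> p al h; split; first exact: EU_long.
  by exists (trv (ee p) 0 (- (li *: - al))); [apply: EU_long; exact: Lam1N|exact: long_inv].
Qed.

Lemma EUV s t : EU s -> inv2 s t -> EU t.
Proof. by case/EU_inv => t' h i1 i2; rewrite (inv2_uniq i2 i1). Qed.

Lemma unitary_subgroup : is_subgroup (unitary S (n := n)).
Proof.
split; [exact: unitary1|split; [exact: unitaryM|move=> a ha]].
have [b hb] := unitary_inv2 ha; exists b; split; first exact: unitaryV hb.
by case: hb.
Qed.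

Lemma EU_unitary s : EU s -> unitary S s.
Proof.
apply: EU_min; first exact: unitary_subgroup.
- move=> p q x h1 h2; have [al hal ->] := trv0_tv (ee p) (iso_eex q x).
  by apply: tv_unitary => //; [exact: iso_ee|exact: star_ee_eex].
- move=> p al h; have -> : trv (ee p) 0 (- (li *: al)) = tv (ee p) 0 al.
    by rewrite /tv ff0l add0r.
  by apply: tv_unitary => //; [exact: iso_ee|rewrite mulmx0].
Qed.

Lemma EU_cancel_l s t : EU s -> EU (s *m t) -> EU t.
Proof.
move=> /EU_inv [s' hs' [h1 h2]] h; rewrite -(mul1mx t) -h2 -mulmxA; exact: EUM.
Qed.
Lemma EU_cancel_r s t : EU t -> EU (s *m t) -> EU s.
Proof.
move=> /EU_inv [t' ht' [h1 h2]] h; rewrite -(mulmx1 s) -h1 mulmxA; exact: EUM.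
Qed.

(** All unitary transvections at [u] in direction [v] are elementary. The quantification over [al]
    absorbs the cocycle of the Heisenberg law, so that for isotropic [u] the property is additive in
    [v] and may be checked on spanning vectors. *)
Definition good u v := star u *m v = 0 /\ forall al, Lam1 al -> EU (tv u v al).

Lemma good_add u v v' : star u *m u = 0 -> good u v -> good u v' -> good u (v + v').
Proof.
move=> uu [uv hv] [uv' hv']; split; first by rewrite mulmxDr uv uv' addr0.
move=> al hal; set K := ff v v' + ff v' v - star v *m v'.
have := EUM (hv 0 (Lam1_0 S)) (hv' (al + K) (Lam1D hal (ff_sum_min _ _ _))).
rewrite tv_mulE // -/K.
by have -> : 0 + (al + K) - K = al by abel.
Qed.

(** The transvections with direction 0 adjust the parameter, so one value of [al] suffices. *)
Lemma good_one u v al : star u *m u = 0 -> star u *m v = 0 -> good u 0 ->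
  Lam1 al -> EU (tv u v al) -> good u v.
Proof.
move=> uu uv [u0 h0] hal h; split=> // be hbe.
have := EUM h (h0 _ (Lam1B hbe hal)).
rewrite tv_mulE ?mulmx0 // ff0l ff0r !(subr0, addr0).
by rewrite addrC subrK.
Qed.

Lemma good_trv0 u v : star u *m u = 0 -> star u *m v = 0 -> good u 0 -> iso v ->
  EU (trv u v 0) -> good u v.
Proof.
move=> uu uv h0 hv; have [al hal ->] := trv0_tv u hv; exact: good_one.
Qed.

Lemma good_trv u v : iso v -> good u v -> EU (trv u v 0).
Proof. by move=> hv [_ h]; have [al hal ->] := trv0_tv u hv; exact: h. Qed.

Lemma good_sum u (I : finType) (P : pred I) (F : I -> col) : star u *m u = 0 -> good u 0 ->
  (forall i, P i -> good u (F i)) -> good u (\sum_(i | P i) F i).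
Proof.
by move=> uu h0 h; apply: big_ind => // v v'; exact: good_add.
Qed.

Lemma tv_self u x al : iso u -> Lam1 al ->
  exists2 be, Lam1 be & tv u (u *m x) al = tv u 0 be.
Proof.
move=> hu hal; exists (ff (u *m x) (u *m x) + al + (x - lam *: adj x)).
  by apply: Lam1D; [apply: Lam1D => //; exact: isoM|exact: Lam1_min].
rewrite /tv !trvdef ff0l; expand; expand; rewrite li_lam scale1r; abel.
Qed.

Lemma good_self u x : iso u -> good u 0 -> good u (u *m x).
Proof.
move=> hu [_ h0]; split=> [|al hal]; first by rewrite mulmxA (iso_star hu) mul0mx.
by have [be hbe ->] := tv_self x hu hal; exact: h0.
Qed.

Lemma good_ee p v : v (rev_ord p) 0 = 0 -> good (ee p) v.
Proof.
move=> hv; have uu := iso_star (iso_ee p).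
have h0 : good (ee p) 0.
  split=> [|al hal]; first exact: mulmx0.
  by rewrite /tv ff0l add0r; exact: EU_long.
rewrite (col_sum v); apply: good_sum => // q _.
have [->|h2] := eqVneq q (rev_ord p); first by rewrite hv raddf0 mulmx0.
have [->|h1] := eqVneq q p; first by apply: good_self => //; exact: iso_ee.
by apply: good_trv0; [|exact: star_ee_eex| |exact: iso_eex|exact: EU_short].
Qed.

Lemma iso_scale c u : central c -> iso u -> iso (c *: u).
Proof. by move=> hc hu; rewrite -mulmx_central //; exact: isoM. Qed.

Lemma isoN u : iso u -> iso (- u).
Proof. by rewrite /iso ffN. Qed.

(** After swapping the two vectors this is a transvection at e_{-l}, whose directions are the
    columns with vanishing [l]-th coordinate. *)
Lemma EU_trv_eex w l y : iso w -> w l 0 = 0 -> EU (trv w (ee (rev_ord l) *m y) 0).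
Proof.
move=> hw wl; rewrite trv_swap; apply: good_trv.
  by apply: isoN; apply: iso_scale; [exact: lamC|exact: isoM].
by apply: good_ee; rewrite rev_ordK mxE [X in - X]mxE mulmx1_entry wl mul0r mulr0 oppr0.
Qed.

(* Conjugating the transvection at [e_{-l}] by the one taking [e_{-l}] to [e_{-l} + w]
   splits off the transvection at [w]. *)
Lemma EU_zero_plane w l v al : iso w -> w l 0 = 0 -> w (rev_ord l) 0 = 0 ->
  star w *m v = 0 -> v l 0 = 0 -> v (rev_ord l) 0 = 0 -> Lam1 al -> EU (tv w v al).
Proof.
move=> hw wl wl' wv vl vl' hal.
have hc : central (- (lam * bar (mu l))).
  by move=> r; rewrite mulNr mulrN -mulrA bar_muC !mulrA lamC.
(* Rescaled so that the transvection at e_l in direction [w0] sends e_{-l} to exactly e_{-l} + w. *)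
set w0 := w *m (- (lam * bar (mu l)))%:M.
have w0q q : w q 0 = 0 -> w0 q 0 = 0 by move=> h; rewrite mulmx1_entry h mul0r.
have hw0 : iso w0 by exact: isoM.
have hT : EU (trv (ee l) w0 0) by apply: good_trv => //; apply: good_ee; exact: w0q.
have [T' hT' iT] := EU_inv hT.
set c := - (li *: (ff v v + al)).
have ex : star (ee (rev_ord l)) *m v = 0 by rewrite star_ee rev_ordK vl mulr0 raddf0.
have e1 : EU (trv (ee (rev_ord l)) v c).
  have [_ h] : good (ee (rev_ord l)) v by apply: good_ee; rewrite rev_ordK.
  exact: h.
have lw : star (ee l) *m w = 0 by rewrite star_ee wl' mulr0 raddf0.
have lw' : star (ee (rev_ord l)) *m w = 0 by rewrite star_ee rev_ordK wl mulr0 raddf0.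
have Te : trv (ee l) w0 0 *m ee (rev_ord l) = ee (rev_ord l) + w.
  rewrite trvE mulmx0 mul0mx addr0 /w0 starM -mulmxA (star_eq0_sym lw') !mulmx0 addr0.
  rewrite star_ee_rev -mulmxA -scalar_mxM mulNr -mulrA muVl mulr1.
  rewrite mulmx_central; last by move=> r; rewrite mulNr mulrN lamC.
  by rewrite scalerA mulrN li_lam scaleN1r opprK.
have Tv : trv (ee l) w0 0 *m v = v.
  rewrite trvE mulmx0 mul0mx addr0 /w0 starM -mulmxA wv !mulmx0 addr0.
  by rewrite star_ee vl' mulr0 raddf0 !mulmx0 scaler0 subr0.
have := EUM (EUM hT e1) hT'.
rewrite trv_conj ?Te ?Tv //; last exact: unitary_J (EU_unitary hT).
rewrite trv_add //; last exact: tv_cond.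
- move=> h; apply: (EU_cancel_l e1); apply: EU_cancel_r h; exact: EU_trv_eex.
- exact: iso_star (iso_ee _).
- exact: iso_star.
Qed.

(** The components of [v] in the plane of [l] and [-l] are directions along basis vectors and are
    split off by additivity; the rest is covered by [EU_zero_plane]. *)
Lemma good_zero_plane w l v : iso w -> w l 0 = 0 -> w (rev_ord l) 0 = 0 ->
  star w *m v = 0 -> good w v.
Proof.
move=> hw wl wl' wv; have ww := iso_star hw.
have h0 : good w 0.
  split=> [|al hal]; first by rewrite mulmx0.
  by apply: (EU_zero_plane (l := l)) => //; rewrite ?mulmx0 // mxE.
have sl q : w q 0 = 0 -> star w *m ee (rev_ord q) = 0.
  by move=> h; apply: star_eq0_sym; rewrite star_ee rev_ordK h mulr0 raddf0.
have hg q : w q 0 = 0 -> forall y, good w (ee (rev_ord q) *m y).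
  move=> h y; apply: good_trv0 => //; first by rewrite mulmxA sl // mul0mx.
    exact: iso_eex.
  exact: EU_trv_eex.
pose y : 'M[R]_1 := (v l 0)%:M; pose y' : 'M[R]_1 := (v (rev_ord l) 0)%:M.
set v' := v - ee l *m y - ee (rev_ord l) *m y'.
have -> : v = v' + ee l *m y + ee (rev_ord l) *m y' by rewrite /v'; abel.
have := hg _ wl' y; rewrite rev_ordK => gl.
have gl' := hg _ wl y'.
apply: good_add => //; apply: good_add => //.
have vE q : v' q 0 = v q 0 - (if q == l then v l 0 else 0) -
    (if q == rev_ord l then v (rev_ord l) 0 else 0).
  have E (a b c : col) : (a - b - c) q 0 = a q 0 - b q 0 - c q 0 by rewrite !mxE.
  by rewrite /v' E !eex_entry !mxE !mulr1n.
split=> [|al hal].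
  rewrite /v' !mulmxBr !mulmxA wv sl //.
  have := sl _ wl'; rewrite rev_ordK => ->.
  by rewrite !mul0mx !subr0.
apply: (EU_zero_plane (l := l)) => //.
- by rewrite /v' !mulmxBr !mulmxA wv sl //; have := sl _ wl'; rewrite rev_ordK => ->; rewrite !mul0mx !subr0.
- by rewrite vE eqxx neq_rev subr0 subrr.
- by rewrite vE eqxx rev_neq subr0 subrr.
Qed.

End Elementary.

(** * Rings finite over a central subring, locally at a maximal ideal *)

Lemma exists_max (T : Type) (P : T -> Prop) (f : T -> nat) b :
  (exists t, P t) -> (forall t, P t -> (f t <= b)%N) ->
  exists2 t, P t & forall t', P t' -> (f t' <= f t)%N.
Proof.
move=> [t0 h0] hb; pose Q k := boolp.asbool (exists2 t, P t & f t = k).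
have hQ : exists k, Q k by exists (f t0); apply/boolp.asboolP; exists t0.
have hQb k : Q k -> (k <= b)%N by move=> /boolp.asboolP [t ht <-]; exact: hb.
case: (ex_maxnP hQ hQb) => k /boolp.asboolP [t ht <-] hk.
by exists t => // t' ht'; apply: hk; apply/boolp.asboolP; exists t'.
Qed.

Lemma exists_min (T : Type) (P : T -> Prop) (f : T -> nat) :
  (exists t, P t) -> exists2 t, P t & forall t', P t' -> (f t <= f t')%N.
Proof.
move=> [t0 h0]; pose Q k := boolp.asbool (exists2 t, P t & f t = k).
have hQ : exists k, Q k by exists (f t0); apply/boolp.asboolP; exists t0.
case: (ex_minnP hQ) => k /boolp.asboolP [t ht <-] hk.
by exists t => // t' ht'; apply: hk; apply/boolp.asboolP; exists t'.
Qed.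

(** Everything is a predicate on the ambient ring: [C] commutes with [A], not necessarily with all
    of [R]. *)
Record finite_over (R : nzRingType) (C A : R -> Prop) (r : nat) (g : 'I_r -> R) : Prop :=
  FiniteOver {
    fo_C : subring C;
    fo_A : subring A;
    fo_CA : forall c, C c -> A c;
    fo_comm : forall c a, C c -> A a -> c * a = a * c;
    fo_gen : forall k, A (g k);
    fo_span : forall a, A a -> exists2 c : 'I_r -> R, (forall k, C (c k)) & a = \sum_k c k * g k }.

(** Maximality is recorded as invertibility modulo [m] of every element of [C] outside [m]. *)
Record maximal_in (R : nzRingType) (C m : R -> Prop) : Prop := MaximalIn {
  mi_C : forall c, m c -> C c;
  mi_0 : m 0;
  mi_D : forall c d, m c -> m d -> m (c + d);
  mi_M : forall c d, C c -> m d -> m (c * d);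
  mi_1 : ~ m 1;
  mi_inv : forall c, C c -> ~ m c -> exists2 d, C d & m (d * c - 1) }.

Section LocalAlgebra.
Variables (R : nzRingType) (C A m : R -> Prop) (r : nat) (g : 'I_r -> R).
Hypotheses (FO : finite_over C A g) (MI : maximal_in C m).

Let C1 : C 1. Proof. by case: (fo_C FO) => _ []. Qed.
Let C0 : C 0. Proof. by case: (fo_C FO) => [[]]. Qed.
Let CD x y : C x -> C y -> C (x + y).
Proof. by case: (fo_C FO) => [[_ [h _]] _]; exact: h. Qed.
Let CN x : C x -> C (- x).
Proof. by case: (fo_C FO) => [[_ [_ h]] _]; exact: h. Qed.
Let CM x y : C x -> C y -> C (x * y).
Proof. by case: (fo_C FO) => _ [_ h]; exact: h. Qed.
Let A1 : A 1. Proof. by case: (fo_A FO) => _ []. Qed.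
Let A0 : A 0. Proof. by case: (fo_A FO) => [[]]. Qed.
Let AD x y : A x -> A y -> A (x + y).
Proof. by case: (fo_A FO) => [[_ [h _]] _]; exact: h. Qed.
Let AN x : A x -> A (- x).
Proof. by case: (fo_A FO) => [[_ [_ h]] _]; exact: h. Qed.
Let AB x y : A x -> A y -> A (x - y).
Proof. by move=> hx /AN; exact: AD. Qed.
Let AM x y : A x -> A y -> A (x * y).
Proof. by case: (fo_A FO) => _ [_ h]; exact: h. Qed.
Let CA := fo_CA FO.
Let gA := fo_gen FO.
Let mC := mi_C MI.

Let mN x : m x -> m (- x).
Proof. by move=> h; rewrite -mulN1r; apply: (mi_M MI) => //; exact: CN. Qed.

Lemma max_prime c d : C c -> C d -> ~ m c -> ~ m d -> ~ m (c * d).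
Proof.
move=> hc hd nc nd h; apply: nd; have [e he hm] := mi_inv MI hc nc.
suff: m (e * (c * d) - (e * c - 1) * d).
  by rewrite mulrBl mul1r mulrA opprB addrCA subrr addr0.
apply: (mi_D MI); first exact: (mi_M MI).
apply: mN; rewrite (fo_comm FO (mC hm) (CA hd)).
exact: (mi_M MI).
Qed.

Lemma max_exp c k : C c -> ~ m c -> ~ m (c ^+ k) /\ C (c ^+ k).
Proof.
move=> hc nc; elim: k => [|k [IH1 IH2]]; first by rewrite expr0; split; [exact: mi_1 MI|].
by rewrite exprS; split; [exact: max_prime|exact: CM].
Qed.

Definition mA (a : R) : Prop := exists2 c : 'I_r -> R, (forall k, m (c k)) & a = \sum_k c k * g k.

Let mA0 : mA 0.
Proof. by exists (fun=> 0) => [_|]; [exact: mi_0 MI|rewrite big1 // => k _; rewrite mul0r]. Qed.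
Let mAD x y : mA x -> mA y -> mA (x + y).
Proof.
move=> [c hc ->] [d hd ->]; exists (fun k => c k + d k) => [k|]; first exact: (mi_D MI).
by rewrite -big_split; apply: eq_bigr => k _; rewrite mulrDl.
Qed.
Let mA_sum (I : finType) (F : I -> R) : (forall i, mA (F i)) -> mA (\sum_i F i).
Proof. by move=> h; apply: big_ind => // x y; exact: mAD. Qed.
Let mA_scale c a : m c -> A a -> mA (c * a).
Proof.
move=> hc /(fo_span FO) [d hd ->]; exists (fun k => c * d k) => [k|].
  rewrite (fo_comm FO (mC hc) (CA (hd k))); exact: (mi_M MI).
by rewrite mulr_sumr; apply: eq_bigr => k _; rewrite mulrA.
Qed.
Lemma mA_A x : mA x -> A x.
Proof.
move=> [c hc ->]; apply: big_ind => // k _; apply: AM => //; exact/CA/mC.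
Qed.
Lemma mA_l a x : A a -> mA x -> mA (a * x).
Proof.
move=> ha [c hc ->]; rewrite mulr_sumr; apply: mA_sum => k.
rewrite mulrA -(fo_comm FO (mC (hc k)) ha) -mulrA; apply: mA_scale => //; exact: AM.
Qed.
Lemma mA_r a x : A a -> mA x -> mA (x * a).
Proof.
move=> ha [c hc ->]; rewrite mulr_suml; apply: mA_sum => k.
rewrite -mulrA; apply: mA_scale => //; exact: AM.
Qed.

Lemma mAN x : mA x -> mA (- x).
Proof. by move=> h; rewrite -mulN1r; apply: mA_l => //; exact: AN. Qed.

Lemma A_span_ind (L : R -> Prop) : (forall x y, L x -> L y -> L (x + y)) -> L 0 ->
  (forall k c, C c -> L (c * g k)) -> forall a, A a -> L a.
Proof.
move=> hD h0 h a /(fo_span FO) [c hc ->].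
by apply: big_ind => // k _; exact: h.
Qed.

(* Nakayama's lemma, by elimination of the generators one at a time; this needs no
   determinants over the noncommutative ring. *)
Lemma nakayama (L : R -> Prop) : L 0 -> (forall x y, L x -> L y -> L (x + y)) ->
  (forall c x, C c -> L x -> L (c * x)) ->
  (forall a, A a -> exists2 l, L l & mA (a - l)) ->
  exists s, [/\ C s, ~ m s & forall a, A a -> L (s * a)].
Proof.
move=> L0 LD LM h.
have LB x y : L x -> L y -> L (x - y).
  by move=> hx hy; apply: LD => //; rewrite -mulN1r; apply: LM => //; exact: CN.
(* Modulo [L], some [s] outside [m] carries every generator to an [m]-combination of the generators
   of index below [i]: the hypothesis for i = r, the claim for i = 0. *)
suff H i : (i <= r)%N -> exists s, [/\ C s, ~ m s & forall k, exists c : 'I_r -> R,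
   [/\ forall j, m (c j), forall j : 'I_r, (i <= j)%N -> c j = 0 & L (s * g k - \sum_j c j * g j)]].
  have [s [hs ns H0]] := H 0%N isT; exists s; split=> //.
  apply: A_span_ind => //.
  - by move=> x y hx hy; rewrite mulrDr; exact: LD.
  - by rewrite mulr0.
  - move=> k c hc; have [d [_ hd]] := H0 k.
    rewrite big1 ?subr0 => [hL|j _]; last by rewrite hd // mul0r.
    rewrite mulrA (fo_comm FO hs (CA hc)) -mulrA; exact: LM.
move=> hi; have [d hd] : exists d, (i + d = r)%N by exists (r - i)%N; rewrite subnKC.
elim: d i hi hd => [|d IH] i hi hd.
  exists 1; split; [by []|exact: mi_1 MI|move=> k].
  have [l hl [c hc e]] := h _ (gA k); exists c; split=> //.
    by move=> j hj; have := ltn_ord j; lia.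
  by rewrite mul1r -e opprB addrC subrK.
have hi' : (i < r)%N by rewrite -hd addnS ltnS leq_addr.
have [s [hs ns H]] := IH i.+1 hi' (etrans (addSnnS _ _) hd).
pose i0 := Ordinal hi'; have [c0 [hc0 z0 L0i]] := H i0.
(* The generator [i0] occurs in its own relation with a coefficient in [m]; hence [t] stays outside
   [m] and the relation can be solved for it. *)
set c := c0 i0; pose t := s - c.
have ht : C t by apply: CD => //; apply: CN; exact/mC/hc0.
have nt : ~ m t.
  by move=> hm; apply: ns; have := mi_D MI hm (hc0 i0); rewrite subrK.
exists (t * s); split; [exact: CM|exact: max_prime|move=> k].
have [d0 [hd0 zd Lk]] := H k.
(* s g_k = sum d0_j g_j and t g_{i0} = sum_{j<>i0} c0_j g_j modulo L *)
exists (fun j => if j == i0 then 0 else t * d0 j + d0 i0 * c0 j); split.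
- move=> j; case: eqP => _; first exact: mi_0 MI.
  by apply: (mi_D MI); apply: (mi_M MI) => //; exact: mC.
- move=> j hj; case: eqP => // hji.
  have hij : (i < j)%N by rewrite ltn_neqAle hj andbT; apply/eqP => e; apply: hji; apply: val_inj.
  by rewrite zd // z0 // !mulr0 addr0.
have E1 := LM _ _ ht Lk; have E2 := LM _ _ (mC (hd0 i0)) L0i.
have := LD _ _ E1 E2; congr L.
rewrite !mulrBr (mulrA t s) !mulr_sumr (bigD1 i0) //= [X in _ + (_ - X)](bigD1 i0) //=.
rewrite [in RHS](bigD1 i0) //= eqxx mul0r add0r.
rewrite [X in _ = _ - X](eq_bigr (fun j => t * (d0 j * g j) + d0 i0 * (c0 j * g j))); last first.
  by move=> j /negPf ->; rewrite mulrDl !mulrA.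
rewrite big_split /=; set X := \sum_(_ | _) _; set Y := \sum_(_ | _) _.
have -> : t * (d0 i0 * g i0) = d0 i0 * (s * g i0) - d0 i0 * (c * g i0).
  rewrite mulrA (fo_comm FO ht (CA (mC (hd0 i0)))) -mulrA /t mulrBl mulrBr //.
rewrite -/c; abel.
Qed.

(** Nakayama for the left ideal A a: a left inverse modulo m A lifts to a left inverse up to a
    scalar outside [m]. *)
Lemma nakayama_unit (a b : R) : A a -> A b -> mA (b * a - 1) ->
  exists b' s, [/\ A b', C s, ~ m s & b' * a = s].
Proof.
move=> ha hb h.
have [|x y [u hu ->] [v hv ->]|c x hc [u hu ->]|x hx|s [hs ns H]] :=
    @nakayama (fun y => exists2 u, A u & y = u * a).
- by exists 0; rewrite ?mul0r.
- by exists (u + v); [exact: AD|rewrite mulrDl].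
- by exists (c * u); [apply: AM => //; exact: CA|rewrite mulrA].
- exists (x * (b * a)); first by exists (x * b); [exact: AM|rewrite mulrA].
  rewrite -[X in X - _]mulr1 -mulrBr -opprB mulrN -mulNr; apply: mA_l => //; exact: AN.
have [u hu e] := H 1 A1; exists u, s; split=> //.
by rewrite -e mulr1.
Qed.

Lemma nakayama_unit_r (a b : R) : A a -> A b -> mA (a * b - 1) ->
  exists b' s, [/\ A b', C s, ~ m s & a * b' = s].
Proof.
move=> ha hb h.
have [|x y [u hu ->] [v hv ->]|c x hc [u hu ->]|x hx|s [hs ns H]] :=
    @nakayama (fun y => exists2 u, A u & y = a * u).
- by exists 0; rewrite ?mulr0.
- by exists (u + v); [exact: AD|rewrite mulrDr].
- by exists (c * u); [apply: AM => //; exact: CA|rewrite mulrA (fo_comm FO hc ha) mulrA].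
- exists ((a * b) * x); first by exists (b * x); [exact: AM|rewrite mulrA].
  rewrite -[X in X - _]mul1r -mulrBl -opprB mulNr -mulrN; apply: mA_r => //; exact: AN.
have [u hu e] := H 1 A1; exists u, s; split=> //.
by rewrite -e mulr1.
Qed.

Definition sub_mod (N : R -> Prop) : Prop :=
  [/\ forall x, N x -> A x, forall x, mA x -> N x, forall x y, N x -> N y -> N (x + y) &
      forall c x, C c -> N x -> N (c * x)].
Definition is_left_ideal (N : R -> Prop) : Prop :=
  [/\ forall x, N x -> A x, forall x, mA x -> N x, forall x y, N x -> N y -> N (x + y) &
      forall a x, A a -> N x -> N (a * x)].

Lemma left_ideal_sub N : is_left_ideal N -> sub_mod N.
Proof. by case=> h1 h2 h3 h4; split=> // c x /CA; exact: h4. Qed.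

Let subB N x y : sub_mod N -> N x -> N y -> N (x - y).
Proof.
by case=> _ _ h3 h4 hx hy; apply: h3 => //; rewrite -mulN1r; apply: h4 => //; exact: CN.
Qed.

(** The flag of A / m A spanned by the first [i] generators, pulled back to [A]. *)
Definition filt (i : nat) (a : R) : Prop := exists c : 'I_r -> R,
  [/\ forall k, C (c k), forall k : 'I_r, (i <= k)%N -> m (c k) & a = \sum_k c k * g k].

(* The number of jumps in the filtration induced by the generators replaces the
   dimension over the residue field [C / m]. *)
Definition jumps (N : R -> Prop) : {set 'I_r} :=
  [set k : 'I_r | boolp.asbool (exists2 x, N x & filt k (x - g k))].
Definition len (N : R -> Prop) : nat := #|jumps N|.

Lemma len_max N : (len N <= r)%N.
Proof. by rewrite -[X in (_ <= X)%N]card_ord; exact: max_card. Qed.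

Lemma sum_delta (i : 'I_r) (d : R) : \sum_k (if k == i then d else 0) * g k = d * g i.
Proof.
by rewrite (bigD1 i) //= eqxx big1 ?addr0 // => k /negPf ->; rewrite mul0r.
Qed.

(** An element of N' is reduced along the flag: a leading coefficient outside [m] is a jump of N',
    hence of N, and can be cancelled by an element of N. *)
Lemma len_eq N N' : sub_mod N -> sub_mod N' -> (forall x, N x -> N' x) ->
  (len N' <= len N)%N -> forall x, N' x -> N x.
Proof.
move=> sN sN' hNN' hlen; have [hNA hNm hND hNM] := sN; have [hA' hm' hD' hM'] := sN'.
have sJ : jumps N \subset jumps N'.
  apply/subsetP => k; rewrite !inE => /boolp.asboolP [x hx fx]; apply/boolp.asboolP.
  by exists x => //; exact: hNN'.
have eJ : jumps N = jumps N' by apply/eqP; rewrite eqEcard sJ.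
suff H i x : N' x -> filt i x -> N x.
  move=> x hx; apply: (H r) => //; have [c hc e] := fo_span FO (hA' _ hx).
  by exists c; split=> // k; rewrite leqNgt ltn_ord.
elim: i x => [|i IH] x hx [c [hc hcm e]].
  by apply: hNm; exists c => // k; exact: hcm.
have [hri|hir] := leqP r i.
  apply: IH => //; exists c; split=> // k hk; by have := ltn_ord k; lia.
pose i0 := Ordinal hir.
have lt_i (k : 'I_r) : (i <= k)%N -> k = i0 \/ (i < k)%N.
  by rewrite leq_eqVlt => /orP [/eqP h|]; [left; apply: val_inj|right].
case: (boolp.pselect (m (c i0))) => hm.
  by apply: IH => //; exists c; split=> // k /lt_i [->|] //; exact: hcm.
(* Scaled to leading coefficient 1 modulo [m], the element exhibits a jump of N' at [i0]. *)
have [d hd hdm] := mi_inv MI (hc i0) hm.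
have : i0 \in jumps N'.
  rewrite inE; apply/boolp.asboolP; exists (d * x); first exact: hM'.
  exists (fun k => d * c k - (if k == i0 then 1 else 0)); split.
  - move=> k; apply: CD; first exact: CM.
    by apply: CN; case: eqP.
  - move=> k /lt_i [->|hk]; first by rewrite eqxx.
    case: eqP => [h|_]; first by move: hk; rewrite h /= ltnn.
    by rewrite subr0; apply: (mi_M MI) => //; exact: hcm.
  - rewrite e mulr_sumr -[in LHS](mul1r (g i0)) -(sum_delta i0 1) -sumrB.
    by apply: eq_bigr => k _; rewrite mulrBl mulrA.
rewrite -eJ inE => /boolp.asboolP [y hy [u [hu hum eu]]].
have hxy : N (x - c i0 * y).
  apply: IH; first by apply: subB => //; apply: hM' => //; exact: hNN'.
  have ey : y = \sum_k u k * g k + g i0 by rewrite -eu subrK.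
  exists (fun k => c k - c i0 * u k - (if k == i0 then c i0 else 0)); split.
  - move=> k; apply: CD; last by apply: CN; case: eqP.
    by apply: CD => //; apply: CN; exact: CM.
  - move=> k hk; have hmk : m (- (c i0 * u k)).
      by apply: mN; apply: (mi_M MI) => //; exact: hum.
    case/lt_i: (hk) => [hki|hk']; first by rewrite hki in hmk *; rewrite eqxx addrAC subrr add0r.
    case: eqP => [h|_]; first by move: hk'; rewrite h /= ltnn.
    by rewrite subr0; apply: (mi_D MI) => //; exact: hcm.
  - rewrite ey e mulrDr opprD addrA mulr_sumr -(sum_delta i0 (c i0)) -!sumrB.
    by apply: eq_bigr => k _; rewrite !mulrBl mulrA.
rewrite -[x](subrK (c i0 * y)); apply: hND => //; exact: hNM.
Qed.

Lemma chain_up (F : nat -> R -> Prop) : (forall k, sub_mod (F k)) ->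
  (forall k x, F k x -> F k.+1 x) -> exists k, forall x, F k.+1 x -> F k x.
Proof.
move=> hs hF.
have [k _ hk] := @exists_max nat (fun=> True) (fun k => len (F k)) r
  (ex_intro _ 0%N I) (fun k _ => len_max _).
by exists k; apply: len_eq => //; [exact: hF|exact: hk].
Qed.

Lemma chain_down (F : nat -> R -> Prop) : (forall k, sub_mod (F k)) ->
  (forall k x, F k.+1 x -> F k x) -> exists k, forall x, F k x -> F k.+1 x.
Proof.
move=> hs hF.
have [k _ hk] := @exists_min nat (fun=> True) (fun k => len (F k)) (ex_intro _ 0%N I).
by exists k; apply: len_eq => //; [exact: hF|exact: hk].
Qed.

(** The preimage in [A] of the Jacobson radical of A / m A, through left invertibility of all 1 + a
    x b. *)
Definition rad (x : R) : Prop := A x /\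
  forall a b, A a -> A b -> exists2 c, A c & mA (c * (1 + a * x * b) - 1).

Lemma rad_A x : rad x -> A x. Proof. by case. Qed.
Lemma mA_rad x : mA x -> rad x.
Proof.
move=> h; split=> [|a b ha hb]; first exact: mA_A.
by exists 1 => //; rewrite mul1r addrC addKr; apply: mA_r => //; exact: mA_l.
Qed.
Lemma radD x y : rad x -> rad y -> rad (x + y).
Proof.
move=> [hx Hx] [hy Hy]; split=> [|a b ha hb]; first exact: AD.
have [c hc h1] := Hx a b ha hb; have [c' hc' h2] := Hy (c * a) b (AM hc ha) hb.
exists (c' * c); first exact: AM.
have -> : c' * c * (1 + a * (x + y) * b) - 1 =
    c' * (c * (1 + a * x * b) - 1) + (c' * (1 + c * a * y * b) - 1).
  by rewrite !mulrDr !mulrDl !mulrDr ?mulr1 ?mulrN1 !mulrA; abel.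
by apply: mAD => //; exact: mA_l.
Qed.
Lemma rad_l d x : A d -> rad x -> rad (d * x).
Proof.
move=> hd [hx Hx]; split=> [|a b ha hb]; first exact: AM.
by have [c hc h] := Hx _ _ (AM ha hd) hb; exists c => //; rewrite mulrA.
Qed.
Lemma rad_r d x : A d -> rad x -> rad (x * d).
Proof.
move=> hd [hx Hx]; split=> [|a b ha hb]; first exact: AM.
by have [c hc h] := Hx _ _ ha (AM hd hb); exists c => //; rewrite -!mulrA in h *.
Qed.
Lemma radN x : rad x -> rad (- x).
Proof. by move=> h; rewrite -mulN1r; apply: rad_l => //; exact: AN. Qed.
Lemma radB x y : rad x -> rad y -> rad (x - y).
Proof. by move=> hx /radN; exact: radD. Qed.
Lemma rad0 : rad 0. Proof. exact: mA_rad. Qed.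

Let left_idealI (N : R -> Prop) : (forall x, N x -> A x) -> (forall x, rad x -> N x) ->
  (forall x y, N x -> N y -> N (x + y)) -> (forall a x, A a -> N x -> N (a * x)) -> is_left_ideal N.
Proof. by move=> h1 h2 h3 h4; split=> // x /mA_rad; exact: h2. Qed.

(** If the square of a left ideal is radical, then (1 - a x b) (1 + a x b) = 1 - a (x b a x) b is
    left invertible modulo m A, and so is 1 + a x b. *)
Lemma rad_semiprime (L : R -> Prop) x : (forall x, L x -> A x) ->
  (forall a x, A a -> L x -> L (a * x)) -> (forall x y, L x -> L y -> rad (x * y)) ->
  L x -> rad x.
Proof.
move=> hA hM hL hx; split=> [|a b ha hb]; first exact: hA.
have [_ hz] := hL _ _ hx (hM _ _ (AM hb ha) hx).
have [c hc h] := hz (- a) b (AN ha) hb.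
exists (c * (1 - a * x * b)).
  by apply: AM => //; apply: AB => //; apply: AM => //; apply: AM => //; exact: hA.
have E : (1 - a * x * b) * (1 + a * x * b) = 1 + - a * (x * (b * a * x)) * b.
  by rewrite mulrDr mulr1 mulrBl mul1r !mulNr !mulrA; abel.
by rewrite -mulrA E.
Qed.

(** Brauer's argument. A left ideal [L] minimal above the radical has an element [y] with L y
    nonzero, so L y = L and e y = y for some [e] in [L]; the annihilator of [y] in [L] is radical by
    minimality and contains e e - e. *)
Lemma idempotent_exists (K : R -> Prop) : is_left_ideal K -> (forall x, rad x -> K x) ->
  (exists2 x, K x & ~ rad x) -> exists e, [/\ K e, ~ rad e & rad (e * e - e)].
Proof.
move=> hK hrK [x0 hx0 nx0].
pose P (L : R -> Prop) := [/\ is_left_ideal L, forall x, rad x -> L x, forall x, L x -> K x &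
  exists2 x, L x & ~ rad x].
have [|L [hL hrL hLK [x1 hx1 nx1]] hmin] := @exists_min _ P len.
  by exists K; split=> //; exists x0.
have [LA Lm LD LM] := hL.
have [y [z [hy hz nzy]]] : exists y z, [/\ L y, L z & ~ rad (z * y)].
  apply: boolp.contrapT => h; apply: nx1; apply: (rad_semiprime LA LM) => // z y hz hy.
  by apply: boolp.contrapT => n; apply: h; exists y, z.
pose L1 x := exists2 z, L z & rad (x - z * y).
have L1L x : L1 x -> L x.
  move=> [u hu h]; rewrite -[x](subrK (u * y)); apply: LD; first exact: hrL.
  by apply: LM => //; exact: LA.
have hL1 : is_left_ideal L1.
  apply: left_idealI => [x /L1L /LA //|x hx|x x' [u hu h] [u' hu' h']|a x ha [u hu h]].
  - by exists 0; [exact: hrL rad0|rewrite mul0r subr0].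
  - exists (u + u'); first exact: LD.
    by rewrite mulrDl opprD addrACA; exact: radD.
  - exists (a * u); first exact: LM.
    by rewrite -mulrA -mulrBr; exact: rad_l.
have LL1 : forall x, L x -> L1 x.
  apply: len_eq => //; [exact: left_ideal_sub|exact: left_ideal_sub|apply: hmin; split=> //].
  - by move=> x hx; exists 0; [exact: hrL rad0|rewrite mul0r subr0].
  - by move=> x /L1L /hLK.
  - by exists (z * y) => //; exists z => //; rewrite subrr; exact: rad0.
have [e he hye] := LL1 y hy.
pose L2 z := L z /\ rad (z * y).
have hL2 : is_left_ideal L2.
  apply: left_idealI => [x [/LA //]|x hx|x x' [u h] [u' h']|a x ha [u h]].
  - by split; [exact: hrL|apply: rad_r => //; exact: LA].
  - by split; [exact: LD|rewrite mulrDl; exact: radD].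
  - by split; [exact: LM|rewrite -mulrA; exact: rad_l].
have L2r x : L2 x -> rad x.
  move=> hx; apply: boolp.contrapT => n.
  have [] // : L2 z; apply: (@len_eq L2 L) => //; try exact: left_ideal_sub.
    by move=> w [].
  apply: hmin; split=> //; last by exists x.
    by move=> w hw; split; [exact: hrL|apply: rad_r => //; exact: LA].
  by move=> w [/hLK].
exists e; split; first exact: hLK.
- move=> re; apply: nzy; apply: rad_l; first exact: LA.
  rewrite -[y](subrK (e * y)); apply: radD => //; apply: rad_r => //; exact: LA.
- apply: L2r; split.
    by apply: subB; [exact: left_ideal_sub|apply: LM => //; exact: LA|].
  have -> : (e * e - e) * y = - (e * (y - e * y)) by rewrite mulrBl mulrBr mulrA opprB.
  by apply/radN/rad_l => //; exact: LA.
Qed.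

(** Modulo the radical every left ideal is generated by an idempotent. Take [e] with the smallest
    annihilator [K e] in [L]; a nonzero idempotent [f] of [K e] would shrink it further through e +
    f - e f. *)
Lemma left_ideal_idempotent (L : R -> Prop) : is_left_ideal L -> (forall x, rad x -> L x) ->
  exists e, [/\ L e, rad (e * e - e) & forall z, L z -> rad (z - z * e)].
Proof.
move=> hL hrL; have [LA Lm LD LM] := hL; have sL := left_ideal_sub hL.
pose K e z := L z /\ rad (z * e).
have hK e : L e -> is_left_ideal (K e).
  move=> he; apply: left_idealI => [x [/LA //]|x hx|x x' [u h] [u' h']|a x ha [u h]].
  - by split; [exact: hrL|apply: rad_r => //; exact: LA].
  - by split; [exact: LD|rewrite mulrDl; exact: radD].
  - by split; [exact: LM|rewrite -mulrA; exact: rad_l].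
have hrK e : L e -> forall x, rad x -> K e x.
  by move=> he x hx; split; [exact: hrL|apply: rad_r => //; exact: LA].
pose P e := L e /\ rad (e * e - e).
have [|e [he ee] hmin] := @exists_min _ P (fun e => len (K e)).
  by exists 0; split; [exact: hrL rad0|rewrite mul0r subr0; exact: rad0].
have eA := LA _ he.
exists e; split=> // z hz.
case: (boolp.pselect (exists2 x, K e x & ~ rad x)) => [h|h]; last first.
  apply: boolp.contrapT => n; apply: h; exists (z - z * e) => //; split.
    by apply: subB => //; apply: LM => //; exact: LA.
  have -> : (z - z * e) * e = - (z * (e * e - e)) by rewrite mulrBl mulrBr mulrA opprB.
  by apply/radN/rad_l => //; exact: LA.
have [f [[hf w] nf ff]] := idempotent_exists (hK _ he) (hrK _ he) h.
have fA := LA _ hf.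
pose e' := e + f - e * f.
have he' : L e' by apply: subB => //; [exact: LD|exact: LM].
case: nf; suff : rad (f * e').
  rewrite /e' mulrBr mulrDr mulrA => h1.
  have h2 : rad (f * f).
    rewrite -[f * f](addrK (f * e)) -[f * f + f * e](subrK (f * e * f)).
    rewrite [f * f + _]addrC; apply: radB => //; apply: radD => //; exact: rad_r.
  by have := radB h2 ff; rewrite opprB addrC subrK.
have [] // : K e' f; apply: (@len_eq (K e') (K e)) => //.
- exact/left_ideal_sub/hK.
- exact/left_ideal_sub/hK.
- move=> x [hx h1]; have xA := LA _ hx; split=> //.
  have h2 := rad_r eA h1.
  have E : x * e = x * e' * e - x * (f * e) + x * e * (f * e) - x * (e * e - e).
    rewrite /e' !mulrBr !mulrDr !mulrBl !mulrDl !mulrA; abel.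
  rewrite E; apply: radB; last exact: rad_l.
  apply: radD; last by apply: rad_l => //; exact: AM.
  by apply: radB => //; exact: rad_l.
- apply: hmin; split=> //.
  have -> : e' * e' - e' = (e * e - e) + (f * f - f) - (e * e - e) * f - e * (f * f - f)
     + f * e - f * e * f - e * (f * e) + e * (f * e) * f.
    rewrite /e' !mulrBr !mulrBl !mulrDr !mulrDl !mulrA; abel.
  have rw := rad_r fA w; have rw' := rad_l eA w.
  apply: radD; last exact: rad_r.
  apply: radB => //; apply: radB => //; apply: radD => //.
  apply: radB; last exact: rad_l.
  apply: radB; last exact: rad_r.
  exact: radD.
Qed.

Definition ideal_mod (a x : R) : Prop := exists2 z, A z & rad (x - z * a).

Lemma ideal_mod_left a : A a -> is_left_ideal (ideal_mod a).
Proof.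
move=> ha; apply: left_idealI => [x [u hu h]|x hx|x x' [u hu h] [u' hu' h']|d x hd [u hu h]].
- by rewrite -[x](subrK (u * a)); apply: AD; [exact: rad_A|exact: AM].
- by exists 0; rewrite ?mul0r ?subr0.
- exists (u + u'); first exact: AD.
  by rewrite mulrDl opprD addrACA; exact: radD.
- exists (d * u); first exact: AM.
  by rewrite -mulrA -mulrBr; exact: rad_l.
Qed.

Lemma ideal_mod_self a : ideal_mod a a.
Proof. by exists 1 => //; rewrite mul1r subrr; exact: rad0. Qed.

(* The value of [t] that maximises the left ideal of [a + t b] makes it contain [b]:
   the complement of the annihilator is cut out by an idempotent central modulo [rad]. *)
Lemma stable_generator a b : A a -> A b ->
  exists t y, [/\ A t, A y & rad (b - y * (a + t * b))].
Proof.
move=> ha hb.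
have [|t ht hmax] := @exists_max R A (fun t => len (ideal_mod (a + t * b))) r _ (fun _ _ => len_max _).
  by exists 0.
set a' := a + t * b in hmax; have ha' : A a' by apply: AD => //; exact: AM.
suff [y hy h] : ideal_mod a' b by exists t, y.
have hI := ideal_mod_left ha'; have [IA Im ID IM] := hI.
have Irad x : rad x -> ideal_mod a' x by exists 0; rewrite ?mul0r ?subr0.
(* The left annihilator of [a'] modulo the radical, generated by an idempotent [e]. *)
pose K y := A y /\ rad (y * a').
have hK : is_left_ideal K.
  apply: left_idealI => [x []//|x hx|x x' [u h] [u' h']|d x hd [u h]].
  - by split; [exact: rad_A|exact: rad_r].
  - by split; [exact: AD|rewrite mulrDl; exact: radD].
  - by split; [exact: AM|rewrite -mulrA; exact: rad_l].
have hrK x : rad x -> K x by move=> h; split; [exact: rad_A|exact: rad_r].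
have [e [[he hea] hee heK]] := left_ideal_idempotent hK hrK.
(* Adding e c to [t] gives a2 = a' + e c b. Since e a' is radical, (1 - e) a2 is a' modulo the
   radical, so A a2 contains A a'; maximality gives equality, hence e c b lies in A a'. *)
have step c : A c -> ideal_mod a' (e * c * b).
  move=> hc; have htc : A (t + e * c) by apply: AD => //; exact: AM.
  pose a2 := a + (t + e * c) * b.
  have ha2 : A a2 by apply: AD => //; exact: AM.
  have a2E : a2 = a' + e * c * b by rewrite /a2 /a' mulrDl addrA.
  have hI2 := ideal_mod_left ha2; have [IA2 Im2 ID2 IM2] := hI2.
  have h1 : ideal_mod a2 a'.
    exists (1 - e); first exact: AB.
    have -> : a' - (1 - e) * a2 = e * a' + (e * e - e) * (c * b).
      by rewrite a2E mulrBl mul1r mulrDr !mulrBl !mulrA; abel.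
    by apply: radD => //; apply: rad_r => //; exact: AM.
  have sub x : ideal_mod a' x -> ideal_mod a2 x.
    move=> [z hz h]; rewrite -[x](subrK (z * a')); apply: ID2; last exact: IM2.
    by exists 0; rewrite ?mul0r ?subr0.
  have sub2 := len_eq (left_ideal_sub hI) (left_ideal_sub hI2) sub (hmax _ htc).
  have -> : e * c * b = a2 - a' by rewrite a2E addrC addKr.
  by apply: subB; [exact: left_ideal_sub|apply/sub2/ideal_mod_self|exact: ideal_mod_self].
(* The two-sided ideal of the [y] with y A b inside A a'. It contains the annihilator [K] and is
   generated by an idempotent [f]. *)
pose Z y := A y /\ forall c, A c -> ideal_mod a' (y * c * b).
have hZ : is_left_ideal Z.
  apply: left_idealI => [x []//|x hx|x x' [u h] [u' h']|d x hd [u h]].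
  - split=> [|c hc]; first exact: rad_A.
    by apply: Irad; apply: rad_r => //; exact: rad_r.
  - split=> [|c hc]; first exact: AD.
    by rewrite !mulrDl; apply: ID; [exact: h|exact: h'].
  - split=> [|c hc]; first exact: AM.
    by rewrite -!mulrA; apply: IM => //; rewrite mulrA; exact: h.
have hrZ x : rad x -> Z x.
  move=> hx; split=> [|c hc]; first exact: rad_A.
  by apply: Irad; apply: rad_r => //; exact: rad_r.
have ZR x d : A d -> Z x -> Z (x * d).
  move=> hd [hx h]; split=> [|c hc]; first exact: AM.
  by rewrite -(mulrA x); apply: h; exact: AM.
have [ZA Zm ZD ZM] := hZ.
have KZ y : K y -> Z y.
  move=> hy; have yA : A y by case: hy.
  rewrite -[y](subrK (y * e)); apply: ZD; first exact/hrZ/heK.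
  by apply: ZM => //; split=> // c; exact: step.
have [f [hf hff hfZ]] := left_ideal_idempotent hZ hrZ.
have fA := ZA _ hf.
(* [f] is central modulo the radical: d f - f d f lies in [Z] and is annihilated by [f] on the left,
   so it generates a left ideal with radical square. *)
have hcen d : A d -> rad (f * d - d * f).
  move=> hd; pose x := d * f - f * d * f.
  have h1 : rad (f * d - f * d * f) by apply: hfZ; exact: ZR.
  have xZ : Z x by apply: subB; [exact: left_ideal_sub|exact: ZM|rewrite -mulrA; apply: (ZM) => //; exact: ZM].
  have fx : rad (f * x).
    have -> : f * x = - ((f * f - f) * (d * f)) by rewrite /x mulrBr !mulrBl !mulrA opprB.
    by apply/radN/rad_r => //; exact: AM.
  have xA := ZA _ xZ.
  pose L y := exists2 z, A z & rad (y - z * x).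
  have hLL : is_left_ideal L := ideal_mod_left xA.
  have [LA _ _ LM] := hLL.
  have rx : rad x.
    apply: (@rad_semiprime L) => //; last exact: ideal_mod_self.
    move=> y y' [z hz h] [z' hz' h'].
    have h2 : rad (x * z' * x).
      have h3 := rad_r xA (hfZ _ (ZR _ _ hz' xZ)).
      rewrite -[_ * x](subrK (x * z' * (f * x))); apply: radD.
        by move: h3; rewrite mulrBl !mulrA.
      by apply: rad_l => //; exact: AM.
    have -> : y * y' = (y - z * x) * y' + z * x * (y' - z' * x) + z * (x * z' * x).
      by clearbody x; rewrite !mulrBr !mulrBl !mulrA; abel.
    apply: radD; last exact: rad_l.
    have y'A : A y' by apply: LA; exists z'.
    by apply: radD; [exact: rad_r|apply: rad_l => //; exact: AM].
  have -> : f * d - d * f = (f * d - f * d * f) - x by rewrite /x; abel.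
  exact: radB.
have h1f : A (1 - f) by exact: AB.
have hcen' d : A d -> rad ((1 - f) * d - d * (1 - f)).
  move=> hd; have -> : (1 - f) * d - d * (1 - f) = - (f * d - d * f).
    by rewrite mulrBl mulrBr mul1r mulr1; abel.
  exact/radN/hcen.
have inj y : A y -> rad (y * f) -> rad (y * a') -> rad y.
  move=> hy h1 h2; have /KZ /hfZ h3 : K y by [].
  by rewrite -[y](subrK (y * f)); exact: radD.
have aA k : A (a' ^+ k) by elim: k => [|k IH]; rewrite ?expr0 // exprS; exact: AM.
(* On the part cut out by 1 - f right multiplication by [a'] is injective. The descending chain of
   the ideals A (1 - f) a'^k stops, and cancelling powers of [a'] puts 1 - f into A a'. *)
pose F k y := exists2 z, A z & rad (y - z * ((1 - f) * a' ^+ k)).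
have FA k : A ((1 - f) * a' ^+ k) by exact: AM.
have [k hk] : exists k, forall x, F k x -> F k.+1 x.
  apply: chain_down => [k|k x [z hz h]]; first exact/left_ideal_sub/ideal_mod_left.
  exists (z * a'); first exact: AM.
  rewrite exprS in h; rewrite -[x](subrK (z * ((1 - f) * (a' * a' ^+ k)))) -addrA; apply: radD => //.
  have -> : z * ((1 - f) * (a' * a' ^+ k)) - z * a' * ((1 - f) * a' ^+ k) =
     z * ((1 - f) * a' - a' * (1 - f)) * a' ^+ k.
    by move: (a') => w; ncring.
  by apply: rad_r => //; apply: rad_l => //; exact: hcen'.
have [z hz h] := hk _ (ideal_mod_self _).
have hu : ideal_mod a' (1 - f).
  exists (z * (1 - f)); first exact: AM.
  set v := _ - _.
  have vA : A v by apply: AB => //; apply: AM => //; exact: AM.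
  have vf : rad (v * f).
    have -> : v * f = - (f * f - f) + z * (f * f - f) * a' - z * (1 - f) * (a' * f - f * a').
      by rewrite /v; move: (a') => w; ncring.
    apply: radB; first by apply: radD; [exact: radN|apply: rad_r => //; exact: rad_l].
    by apply: rad_l; [exact: AM|rewrite -opprB; exact/radN/hcen].
  have : rad (v * a' ^+ k).
    have <- : (1 - f) * a' ^+ k - z * ((1 - f) * a' ^+ k.+1) = v * a' ^+ k.
      by rewrite exprS /v; move: (a' ^+ k) (a') => w w'; ncring.
    exact: h.
  elim: k {hk h} => [|k IH]; first by rewrite expr0 mulr1.
  rewrite exprSr mulrA => h; apply: IH; apply: inj => //; first exact: AM.
  have -> : v * a' ^+ k * f = v * f * a' ^+ k - v * (f * a' ^+ k - a' ^+ k * f).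
    by rewrite mulrBr !mulrA; abel.
  by apply: radB; [exact: rad_r|apply: rad_l => //; exact: hcen].
have -> : b = f * 1 * b + (((1 - f) * b - b * (1 - f)) + b * (1 - f)).
  by rewrite subrK mulr1 mulrBl mul1r; abel.
by apply: (ID); [case: hf => _; exact|apply: ID; [exact/Irad/hcen'|exact: IM]].
Qed.

(** Right multiplication by [a] is surjective modulo m A, hence injective because the kernels of its
    powers stabilise. It kills a b - s, so [b] is also a right inverse modulo [m], and Nakayama
    lifts it. *)
Lemma unit_two_sided a b s : A a -> A b -> C s -> ~ m s -> b * a = s ->
  exists b' s', [/\ A b', C s', ~ m s', b' * a = s' & a * b' = s'].
Proof.
move=> ha hb hs ns e.
have [d hd hds] := mi_inv MI hs ns; have sA := CA hs; have dA := CA hd.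
have sc x : A x -> s * x = x * s by exact: (fo_comm FO).
have aA k : A (a ^+ k) by elim: k => [|k IH]; rewrite ?expr0 // exprS; exact: AM.
have hds' : mA (d * s - 1) by rewrite -[_ - 1]mulr1; exact: mA_scale.
have surj k y : A y -> exists2 z, A z & mA (y - z * a ^+ k).
  elim: k y => [|k IH] y hy; first by exists y; rewrite // expr0 mulr1 subrr.
  have [z hz h] := IH y hy; exists (z * d * b); first by apply: AM => //; exact: AM.
  rewrite -[y](subrK (z * a ^+ k)) -addrA; apply: mAD => //.
  have -> : z * a ^+ k - z * d * b * a ^+ k.+1 = - (z * (d * s - 1) * a ^+ k).
    by rewrite exprS -e mulrBr mulrBl mulr1 !mulrA opprB.
  by apply/mAN/mA_r => //; exact: mA_l.
pose F k y := A y /\ mA (y * a ^+ k).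
have [k hk] : exists k, forall x, F k.+1 x -> F k x.
  apply: chain_up => [k|k x [hx h]]; last first.
    by split=> //; rewrite exprSr mulrA; exact: mA_r.
  apply: left_ideal_sub; split=> [x []//|x hx|x x' [u h] [u' h']|c x hc [u h]].
  - by split; [exact: mA_A|exact: mA_r].
  - by split; [exact: AD|rewrite mulrDl; exact: mAD].
  - by split; [exact: AM|rewrite -mulrA; exact: mA_l].
have inj y : A y -> mA (y * a) -> mA y.
  move=> hy h; have [z hz hyz] := surj k y hy.
  have [//|_ h2] := hk z.
    split=> //; rewrite exprSr.
    have -> : z * (a ^+ k * a) = y * a - (y - z * a ^+ k) * a by rewrite mulrBl mulrA; abel.
    by apply: mAD => //; apply/mAN/mA_r.
  by rewrite -[y](subrK (z * a ^+ k)); exact: mAD.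
have h1 : mA (a * b - s).
  apply: inj; first by apply: AB => //; exact: AM.
  by rewrite mulrBl -mulrA e sc // subrr.
have [b' [s' [hb' hs' ns' e']]] : exists b' s, [/\ A b', C s, ~ m s & a * b' = s].
  apply: (@nakayama_unit_r a (b * d)) => //; first exact: AM.
  have -> : a * (b * d) - 1 = (a * b - s) * d + (d * s - 1).
    by rewrite mulrBl sc // mulrA; abel.
  by apply: mAD => //; exact: mA_r.
have sc' x : A x -> s' * x = x * s' by exact: (fo_comm FO).
have E : b * s' = s * b' by rewrite -e' mulrA e.
exists (b * s'), (s * s'); split; [|exact: CM|exact: max_prime| |].
- by apply: AM => //; exact: CA.
- by rewrite -mulrA sc' // mulrA e.
- by rewrite E mulrA -sc // -mulrA e'.
Qed.

Lemma unit_of_rad a b : A a -> A b -> rad (b * a - 1) ->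
  exists b' s', [/\ A b', C s', ~ m s', b' * a = s' & a * b' = s'].
Proof.
move=> ha hb [_ h]; have [c hc] := h 1 1 A1 A1; rewrite mul1r mulr1 (addrC 1) subrK mulrA => h1.
have [b' [s [hb' hs ns e]]] := nakayama_unit ha (AM hc hb) h1.
exact: unit_two_sided e.
Qed.

Lemma unit_of_right a b s : A a -> A b -> C s -> ~ m s -> a * b = s ->
  exists b' s', [/\ A b', C s', ~ m s', b' * a = s' & a * b' = s'].
Proof.
move=> ha hb hs ns e.
have [y [s' [hy hs' ns' e1 e2]]] := unit_two_sided hb ha hs ns e.
have sc' x : A x -> s' * x = x * s' by exact: (fo_comm FO).
have E : a * s' = s * y by rewrite -e2 mulrA e.
exists (b * s'), (s * s'); split; [|exact: CM|exact: max_prime| |].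
- by apply: AM => //; exact: CA.
- by rewrite -mulrA sc' // E mulrA -(fo_comm FO hs hb) -mulrA e2.
- by rewrite mulrA e.
Qed.

End LocalAlgebra.

Lemma maximal_ideal_exists (R : nzRingType) (C A : R -> Prop) r (g : 'I_r -> R) (S : R -> Prop) :
  finite_over C A g -> (forall x, S x -> C x) -> S 0 ->
  (forall x y, S x -> S y -> S (x + y)) -> (forall c x, C c -> S x -> S (c * x)) -> ~ S 1 ->
  exists2 m, maximal_in C m & forall x, S x -> m x.
Proof.
move=> FO SC S0 SD SM S1.
have [[C0 [CD CN]] [C1 CM]] := fo_C FO.
have cC x y : C x -> C y -> x * y = y * x by move=> hx /(fo_CA FO); exact: (fo_comm FO).
pose idl (I : R -> Prop) := [/\ forall x, I x -> C x, forall x, S x -> I x,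
  forall x y, I x -> I y -> I (x + y), forall c x, C c -> I x -> I (c * x) & ~ I 1].
pose P (I : classical_sets.set R) := (forall x, ~ I x) \/ idl I.
have [F FP Ftot|M [PM hM]] := @classical_sets.Zorn_bigcup R P.
  case: (boolp.pselect (exists2 I, F I & exists x, I x)) => [[I0 hI0 [x0 hx0]]|h]; last first.
    by left=> x [I hI hx]; apply: h; exists I => //; exists x.
  have get I x : F I -> I x -> idl I.
    by move=> /FP [h /h|].
  right; split.
  - by move=> x [I hI hx]; have [h _ _ _ _] := get _ _ hI hx; exact: h.
  - by move=> x hx; exists I0 => //; have [_ h _ _ _] := get _ _ hI0 hx0; exact: h.
  - move=> x y [I hI hx] [I' hI' hy]; have [h|h] := Ftot _ _ hI hI'.
      by exists I' => //; have [_ _ h' _ _] := get _ _ hI' hy; apply: h' => //; exact: h.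
    by exists I => //; have [_ _ h' _ _] := get _ _ hI hx; apply: h' => //; exact: h.
  - move=> c x hc [I hI hx]; exists I => //; have [_ _ _ h _] := get _ _ hI hx; exact: h.
  - by move=> [I hI hx]; have [_ _ _ _ h] := get _ _ hI hx.
have idM : idl M.
  case: PM => // hM0; case: (hM S); first by split=> [x /hM0|/(_ 0 S0) /hM0].
  by right; split.
have [MC SM' MD MM M1] := idM.
have M0 := SM' _ S0.
exists M => //; split=> // c hc nc.
apply: boolp.contrapT => h.
pose I x := exists2 a, M a & exists2 d, C d & x = a + d * c.
case: (hM I).
  split=> [x hx|/(_ c) hx]; first by exists x => //; exists 0; rewrite // mul0r addr0.
  by apply/nc/hx; exists 0 => //; exists 1; rewrite // mul1r add0r.
right; split.
- by move=> x [a /MC ha [d hd ->]]; apply: CD => //; exact: CM.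
- by move=> x /SM' hx; exists x => //; exists 0; rewrite // mul0r addr0.
- move=> x y [a ha [d hd ->]] [a' ha' [d' hd' ->]]; exists (a + a'); first exact: MD.
  by exists (d + d'); [exact: CD|rewrite mulrDl addrACA].
- move=> e x he [a ha [d hd ->]]; exists (e * a); first exact: MM.
  by exists (e * d); [exact: CM|rewrite mulrDr mulrA].
- move=> [a ha [d hd e]]; apply: h; exists d => //.
  have -> : d * c - 1 = -1 * a by rewrite mulN1r [X in _ - X]e opprD addrCA subrr addr0.
  by apply: MM => //; exact: CN.
Qed.

(** * Making a coordinate a local unit *)

(** Symmetry of [C] lets a denominator pass from one argument of the form to the other. *)
Record local_subring (R : nzRingType) (S : form_ring R) (C A : R -> Prop) (r : nat)
    (g : 'I_r -> R) : Prop := LocalSubring {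
  ls_fin : finite_over C A g;
  ls_sym : forall c, C c -> fbar S c = c;
  ls_bar : forall a, A a -> A (fbar S a);
  ls_lam : A (flam S) }.

(** The form in which quasi-finiteness is used. It passes to quotients ([locally_finite_image]) and
    to the fibre product ([dbl_locally_finite]). *)
Definition locally_finite (R : nzRingType) (S : form_ring R) : Prop :=
  forall F : seq R, exists (C A : R -> Prop) (r : nat) (g : 'I_r -> R),
    local_subring S C A g /\ forall x, x \in F -> A x.

Lemma scal11 (R : nzRingType) (x : R) : (x%:M : 'M_1) 0 0 = x.
Proof. by rewrite mxE mulr1n. Qed.

Section Coordinates.
Variables (R : nzRingType) (S : form_ring R) (n : nat).
Local Notation bar := (fbar S).
Local Notation li := (fbar S (flam S)).
Local Notation N := (n + n)%N.
Local Notation col := 'cV[R]_N.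
Local Notation ee := (@ee R n).
Local Notation mu := (@mu R S n).
Implicit Types (u v w : col) (p q : 'I_N).

Definition hh u v : R := (star S u *m v) 0 0.

Lemma hhE u v : hh u v = \sum_p bar (u p 0) * mu p * v (rev_ord p) 0.
Proof. exact: star_mulE. Qed.

Lemma hh_ee p v : hh (ee p) v = mu p * v (rev_ord p) 0.
Proof. by rewrite /hh star_ee mxE mulr1n. Qed.

Lemma hh_mul_ee u p : hh u (ee p) = bar (u (rev_ord p) 0) * mu (rev_ord p).
Proof. by rewrite /hh star_mul_ee mxE mulr1n. Qed.

Lemma hhDl u v w : hh (u + v) w = hh u w + hh v w.
Proof. by rewrite /hh starD mulmxDl mxE. Qed.
Lemma hhDr u v w : hh u (v + w) = hh u v + hh u w.
Proof. by rewrite /hh mulmxDr mxE. Qed.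
Lemma hhMl u x v : hh (u *m x) v = bar (x 0 0) * hh u v.
Proof. by rewrite /hh starM -mulmxA mxE big_ord1 mxE. Qed.
Lemma hhMr u x v : hh u (v *m x) = hh u v * x 0 0.
Proof. by rewrite /hh mulmxA mxE big_ord1. Qed.
Lemma hh_eex p x v : hh (ee p *m x) v = bar (x 0 0) * mu p * v (rev_ord p) 0.
Proof. by rewrite hhMl hh_ee mulrA. Qed.

Lemma star_hh u v : star S u *m v = (hh u v)%:M.
Proof. exact: mx11_scalar. Qed.

Lemma hh0P u v : hh u v = 0 <-> star S u *m v = 0.
Proof. by rewrite star_hh; split=> [->|/matrixP /(_ 0 0)]; rewrite ?raddf0 // !mxE. Qed.

Lemma trv_coord u v a w q : (trv S u v a *m w) q 0 =
  w q 0 + u q 0 * hh v w - li * (v q 0 * hh u w) + u q 0 * (a 0 0 * hh u w).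
Proof.
have E (a1 a2 a3 a4 : col) c : (a1 + a2 - c *: a3 + a4) q 0 =
  a1 q 0 + a2 q 0 - c * a3 q 0 + a4 q 0 by rewrite !mxE.
by rewrite trvE E !mulmx1_entry (mulrA _ (a 0 0)).
Qed.

Lemma short_coord p q x w c : (trv S (ee p) (ee q *m x) 0 *m w) c 0 =
  w c 0 + (if c == p then bar (x 0 0) * mu q * w (rev_ord q) 0 else 0)
  - li * (if c == q then x 0 0 * (mu p * w (rev_ord p) 0) else 0).
Proof.
rewrite trv_coord eex_entry ee_entry hh_eex hh_ee mxE !mul0r mulr0 addr0.
by congr (_ + _ - _ * _); case: eqP; rewrite ?mul1r ?mul0r.
Qed.

Lemma mx_mul_col (g h : 'M[R]_N) u : g *m h *m u = g *m (h *m u).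
Proof. by rewrite mulmxA. Qed.

End Coordinates.

Section Local.
Variables (R : nzRingType) (S : form_ring R) (n : nat).
Local Notation bar := (fbar S).
Local Notation lam := (flam S).
Local Notation li := (fbar S (flam S)).
Local Notation N := (n + n)%N.
Local Notation col := 'cV[R]_N.
Local Notation ee := (@ee R n).
Local Notation mu := (@mu R S n).
Local Notation EU := (@EU R bar lam n (fLam S)).
Local Notation hh := (hh S).
Implicit Types (u v w : col) (p q : 'I_N).
Variables (C A m : R -> Prop) (r : nat) (g : 'I_r -> R).
Hypotheses (LS : local_subring S C A g) (MI : maximal_in C m).
Let FO := ls_fin LS.
Let A1 : A 1. Proof. by case: (fo_A FO) => _ []. Qed.
Let A0 : A 0. Proof. by case: (fo_A FO) => [[]]. Qed.
Let AD x y : A x -> A y -> A (x + y).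
Proof. by case: (fo_A FO) => [[_ [h _]] _]; exact: h. Qed.
Let AN x : A x -> A (- x).
Proof. by case: (fo_A FO) => [[_ [_ h]] _]; exact: h. Qed.
Let AB x y : A x -> A y -> A (x - y).
Proof. by move=> hx /AN; exact: AD. Qed.
Let AM x y : A x -> A y -> A (x * y).
Proof. by case: (fo_A FO) => _ [_ h]; exact: h. Qed.
Let Abar := ls_bar LS.
Let Alam := ls_lam LS.
Let Ali : A li. Proof. exact: Abar. Qed.
Let A_sum (I : finType) (P : pred I) (F : I -> R) : (forall i, P i -> A (F i)) -> A (\sum_(i | P i) F i).
Proof. by move=> h; apply: big_ind => // x y; exact: AD. Qed.

Lemma A_mu p : A (mu p). Proof. by rewrite /mu; case: (epos p). Qed.

Definition colA u := forall p, A (u p 0).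

Lemma A_hh u v : colA u -> colA v -> A (hh u v).
Proof.
move=> hu hv; rewrite hhE; apply: A_sum => p _; apply: AM => //; apply: AM; last exact: A_mu.
exact: Abar.
Qed.

Lemma colA_trv u v (a : 'M[R]_1) w : colA u -> colA v -> A (a 0 0) -> colA w -> colA (trv S u v a *m w).
Proof.
move=> hu hv ha hw q; rewrite trv_coord.
apply: AD; last by apply: AM => //; apply: AM => //; exact: A_hh.
apply: AB; first by apply: AD => //; apply: AM => //; exact: A_hh.
by apply: AM => //; apply: AM => //; exact: A_hh.
Qed.

Lemma colA_ee p : colA (ee p).
Proof. by move=> q; rewrite ee_entry; case: eqP. Qed.

Lemma colA_eex p (x : 'M[R]_1) : A (x 0 0) -> colA (ee p *m x).
Proof. by move=> hx q; rewrite eex_entry; case: eqP. Qed.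

Lemma A_ff u v : colA u -> colA v -> A (ff S u v 0 0).
Proof.
by move=> hu hv; rewrite ffE; apply: A_sum => p _; apply: AM => //; exact: Abar.
Qed.

Lemma A_tv_coef u : colA u -> A ((- (li *: (ff S u u + 0)) : 'M_1) 0 0).
Proof.
move=> hu; have -> : (- (li *: (ff S u u + 0)) : 'M_1) 0 0 = - (li * ff S u u 0 0).
  by rewrite addr0 mxE [X in - X]mxE.
by apply: AN; apply: AM => //; exact: A_ff.
Qed.

Local Notation rad := (rad A m g).
Local Notation ideal_mod := (ideal_mod A m g).

Lemma ideal_mod_trans a b x : A a -> A b -> ideal_mod b a -> ideal_mod a x -> ideal_mod b x.
Proof.
move=> ha hb [y hy h] [z hz h']; exists (z * y); first exact: AM.
have -> : x - z * y * b = (x - z * a) + z * (a - y * b) by ncring.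
by apply: (radD FO MI) => //; apply: (rad_l FO).
Qed.

(** Stable range one, iterated: modulo the radical the left ideal of several elements is generated
    by the first one plus a combination of the others. *)
Lemma stable_generator_seq (u : 'I_N -> R) (s : seq 'I_N) a : (forall p, A (u p)) -> A a -> uniq s ->
  exists t : 'I_N -> R, let d := a + \sum_(p <- s) t p * u p in
    [/\ forall p, A (t p), A d, ideal_mod d a & forall p, p \in s -> ideal_mod d (u p)].
Proof.
move=> hu; elim: s a => [|p s IH] a ha /=.
  move=> _; exists (fun=> 0); rewrite big_nil addr0; split=> //; exact: (ideal_mod_self FO MI).
move=> /andP [hp us]; have [t [y [ht hy hr]]] := stable_generator FO MI ha (hu p).
set a1 := a + t * u p in hr.
have ha1 : A a1 by apply: AD => //; exact: AM.
have [t' [ht' hd h1 h2]] := IH a1 ha1 us.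
exists (fun q => if q == p then t else t' q).
rewrite big_cons eqxx addrA -/a1.
have -> : \sum_(q <- s) (if q == p then t else t' q) * u q = \sum_(q <- s) t' q * u q.
  apply: eq_big_seq => q hq; case: eqP => // e; by rewrite -e hq in hp.
have [_ _ ID IM] := ideal_mod_left FO MI hd.
have hup : ideal_mod (a1 + \sum_(q <- s) t' q * u q) (u p).
  by apply: (ideal_mod_trans ha1 hd) => //; exists y.
split=> //; first by move=> q; case: eqP.
- have -> : a = a1 + (- t) * u p by rewrite /a1 mulNr addrK.
  by apply: ID => //; apply: IM => //; exact: AN.
- by move=> q; rewrite inE => /orP [/eqP ->|/h2].
Qed.

Lemma good_tv0 p v : v (rev_ord p) 0 = 0 -> EU (tv S (ee p) v 0).
Proof. by move=> hv; have [_ h] := good_ee S hv; apply: h; exact: Lam1_0. Qed.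

(* First the coordinates [+-i] are made to generate, then the coordinate [-j] is killed
   modulo the radical inside the Levi factor; after that the quadratic correction in the
   [j]-th coordinate of a transvection along [e_j] is harmless. *)
Lemma unit_coordinate i j l u (w : 'I_N -> R) : j != i -> j != rev_ord i ->
  l != i -> l != rev_ord i -> l != j -> l != rev_ord j ->
  colA u -> (forall p, A (w p)) -> \sum_p w p * u p 0 = 1 ->
  exists (h : 'M[R]_N) (x b s : R),
    [/\ EU h, h *m ee i = ee i + ee j *m x%:M, A x, forall w, colA w -> colA (h *m w) &
        [/\ A b, C s, ~ m s, b * (h *m u) j 0 = s & (h *m u) j 0 * b = s]].
Proof.
move=> ji ji' li1 li2 lj lj' hu hw hwu.
have il : (i == l) = false by rewrite eq_sym (negPf li1).
have ij : (i == j) = false by rewrite eq_sym (negPf ji).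
have [t [ht hd _ Hd]] := @stable_generator_seq (fun p => u p 0) [seq p <- enum 'I_N | p != i]
  (u i 0) hu (hu i) (filter_uniq _ (enum_uniq _)).
set d := u i 0 + _ in hd Hd.
have dE : d = u i 0 + \sum_(p | p != i) t p * u p 0 by rewrite /d big_filter big_enum_cond.
have [beta hbeta hb] : ideal_mod d 1.
  have [_ _ ID IM] := ideal_mod_left FO MI hd.
  have hall p : ideal_mod d (u p 0).
    have [->|h] := eqVneq p i; last by apply: Hd; rewrite mem_filter h mem_enum.
    have -> : u i 0 = d + \sum_(p | p != i) (- t p) * u p 0.
      by rewrite dE -addrA -big_split big1 ?addr0 //= => q _; rewrite mulNr subrr.
    apply: (ID); first exact: (ideal_mod_self FO MI).
    apply: big_ind => [|x y|q hq]; first by exists 0; rewrite ?mul0r ?subr0 //; exact: (rad0 FO MI).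
      exact: ID.
    by apply: IM; [exact: AN|apply: Hd; rewrite mem_filter hq mem_enum].
  rewrite -hwu; apply: big_ind => [|x y|q hq]; first by exists 0; rewrite ?mul0r ?subr0 //; exact: (rad0 FO MI).
    exact: ID.
  exact: IM.
(* Chosen so that h(v, u) is the sum of the [t p * u p 0] over [p] other than [i] and [-i]; the term
   at [-i] and the quadratic part [kap] are accounted for in [u1i]. *)
pose v : col := \col_q (if (q == i) || (q == rev_ord i) then 0 else bar (bar (mu q) * t (rev_ord q))).
have vi : v i 0 = 0 by rewrite mxE eqxx.
have vi' : v (rev_ord i) 0 = 0 by rewrite mxE eqxx orbT.
have hv : colA v.
  move=> q; rewrite mxE; case: ifP => // _; apply: Abar; apply: AM => //; apply: Abar; exact: A_mu.
pose h1 := tv S (ee i) v 0; set u1 := h1 *m u.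
have hu1 : colA u1 by apply: colA_trv => //; [exact: colA_ee|exact: A_tv_coef].
pose kap := (- (li *: (ff S v v + 0)) : 'M_1) 0 0 * mu i.
have hkap : A kap by apply: AM; [exact: A_tv_coef|exact: A_mu].
have u1i' : u1 (rev_ord i) 0 = u (rev_ord i) 0.
  by rewrite /u1 trv_coord ee_entry rev_neq vi' !mul0r mulr0 subr0 !addr0.
have u1i : u1 i 0 + (t (rev_ord i) - kap) * u1 (rev_ord i) 0 = d.
  rewrite u1i' /u1 trv_coord ee_entry eqxx vi !mul1r mul0r mulr0 subr0 hh_ee mulrA -/kap.
  rewrite dE (bigD1 (rev_ord i)) /= ?rev_neq //.
  have -> : hh v u = \sum_(p | (p != i) && (p != rev_ord i)) t p * u p 0.
    rewrite hhE (reindex_inj rev_ord_inj) [RHS]big_mkcond /=; apply: eq_bigr => q _.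
    rewrite mxE rev_ordK (inj_eq rev_ord_inj) rev_eq orbC -negb_or; case: ifP => _ /=.
      by rewrite bar0 !mul0r.
    by rewrite barK bar_muC -!mulrA (mulrA (bar _)) muVl mul1r.
  set X := (Z in _ + Z + _ + _ = _); set Y := (Z in _ = _ + (_ + Z)).
  have -> : Y = X by [].
  by move: X (kap) => X k; ncring.
(* Stable range for the coordinates [-l] and [-j]: adding a multiple of the second to the first
   makes it divide the second modulo the radical, which [h3] then subtracts. *)
have [t2 [y [ht2 hy hr]]] := stable_generator FO MI (hu1 (rev_ord l)) (hu1 (rev_ord j)).
pose h2 := trv S (ee (rev_ord l)) (ee j *m (bar (t2 * bar (mu j)))%:M) 0.
set u2 := h2 *m u1.
have hAt2 : A (bar (t2 * bar (mu j))) by apply: Abar; apply: AM => //; apply: Abar; exact: A_mu.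
have hu2 : colA u2.
  by apply: colA_trv => //; [exact: colA_ee|apply: colA_eex; rewrite scal11|rewrite mxE].
have u2l : u2 (rev_ord l) 0 = u1 (rev_ord l) 0 + t2 * u1 (rev_ord j) 0.
  rewrite /u2 short_coord eqxx scal11 barK muK.
  by rewrite rev_eq (negPf lj') mulr0 subr0.
pose h3 := trv S (ee (rev_ord j)) (ee l *m (bar (- y * bar (mu l)))%:M) 0.
set u3 := h3 *m u2.
have hAy : A (bar (- y * bar (mu l))).
  by apply: Abar; apply: AM; [exact: AN|apply: Abar; exact: A_mu].
have hu3 : colA u3.
  by apply: colA_trv => //; [exact: colA_ee|apply: colA_eex; rewrite scal11|rewrite mxE].
have jl : (j == l) = false by rewrite eq_sym (negPf lj).
have u3j : u3 (rev_ord j) 0 = u1 (rev_ord j) 0 - y * (u1 (rev_ord l) 0 + t2 * u1 (rev_ord j) 0).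
  rewrite /u3 short_coord eqxx scal11 barK -u2l muK.
  have -> : (rev_ord j == l) = false by idx.
  rewrite mulr0 subr0.
  rewrite mulNr; congr (_ - _).
  by rewrite /u2 short_coord (inj_eq rev_ord_inj) jl rev_neq mulr0 subr0 addr0.
have keep q : q != j -> q != l -> q != rev_ord j -> q != rev_ord l -> u3 q 0 = u1 q 0.
  move=> /negPf e1 /negPf e2 /negPf e3 /negPf e4.
  by rewrite /u3 short_coord e2 e3 mulr0 subr0 addr0 /u2 short_coord e1 e4 mulr0 subr0 addr0.
have u3i : u3 i 0 = u1 i 0.
  by apply: keep; idx.
have u3i' : u3 (rev_ord i) 0 = u1 (rev_ord i) 0.
  by apply: keep; idx.
(* Since beta d is 1 modulo the radical, adding W d to the [j]-th coordinate makes it 1 there; [y1]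
   and [y2] realise W d as h(V, u3). *)
pose W := (1 - u3 j 0) * beta.
have hW : A W by apply: AM => //; exact: AB.
pose y1 : 'M[R]_1 := (bar (W * bar (mu (rev_ord i))))%:M.
pose y2 : 'M[R]_1 := (bar (W * (t (rev_ord i) - kap) * bar (mu i)))%:M.
pose V := ee (rev_ord i) *m y1 + ee i *m y2.
have hy1 : A (y1 0 0) by rewrite scal11; apply: Abar; apply: AM => //; apply: Abar; exact: A_mu.
have hy2 : A (y2 0 0).
  by rewrite mxE; apply: Abar; apply: AM; [apply: AM => //; exact: AB|apply: Abar; exact: A_mu].
have VE q : V q 0 = (if q == rev_ord i then y1 0 0 else 0) + (if q == i then y2 0 0 else 0).
  by rewrite mxE !eex_entry.
have hV : colA V.
  by move=> q; rewrite VE; apply: AD; case: eqP.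
have Vj' : V (rev_ord j) 0 = 0.
  have e1 : (rev_ord j == i) = false by idx.
  have e2 : (rev_ord j == rev_ord i) = false by idx.
  by rewrite VE e1 e2 addr0.
have Vj : V j 0 = 0 by rewrite VE (negPf ji) (negPf ji') addr0.
pose h4 := tv S (ee j) V 0.
exists (h4 *m (h3 *m (h2 *m h1))), W.
have hE : h4 *m (h3 *m (h2 *m h1)) *m u = h4 *m u3 by rewrite /u3 /u2 /u1 !mulmxA.
have cA1 z : colA z -> colA (h1 *m z).
  by move=> hz; apply: colA_trv => //; [exact: colA_ee|exact: A_tv_coef].
have cA2 z : colA z -> colA (h2 *m z).
  by move=> hz; apply: colA_trv => //; [exact: colA_ee|apply: colA_eex; rewrite scal11|rewrite mxE].
have cA3 z : colA z -> colA (h3 *m z).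
  by move=> hz; apply: colA_trv => //; [exact: colA_ee|apply: colA_eex; rewrite scal11|rewrite mxE].
have cA4 z : colA z -> colA (h4 *m z).
  by move=> hz; apply: colA_trv => //; [exact: colA_ee|exact: A_tv_coef].
pose D := (h4 *m u3) j 0.
have hhV : hh V u3 = W * d.
  by rewrite hhDl !hh_eex rev_ordK !scal11 !barK u3i u3i' -u1i !muK [RHS]mulrDr (mulrA W).
set kV := (- (li *: (ff S V V + 0)) : 'M_1) 0 0.
have hkV : A kV by exact: A_tv_coef.
have hD : rad (1 * D - 1).
  rewrite mul1r /D trv_coord ee_entry eqxx Vj !mul1r mul0r mulr0 subr0 hhV hh_ee -/kV u3j.
  set z := _ - _ * _ in hr; have hz : rad (kV * (mu j * z)).
    by rewrite mulrA; apply: (rad_l FO) => //; apply: AM => //; exact: A_mu.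
  have -> : u3 j 0 + W * d + kV * (mu j * z) - 1 = - ((1 - u3 j 0) * (1 - beta * d)) + kV * (mu j * z).
    by rewrite /W; clearbody z d; move: (u3 j 0) => w'; ncring.
  apply: (radD FO MI) => //; apply: (radN FO); apply: (rad_l FO) => //; exact: AB.
have [b [s [hb' hs ns e1 e2]]] := unit_of_rad FO MI (cA4 _ hu3 j) A1 hD.
exists b, s; rewrite hE; split=> //.
- apply: EUM; first exact: good_tv0.
  apply: EUM; first by apply: EU_short; idx.
  apply: EUM; first by apply: EU_short; idx.
  exact: good_tv0.
- have e_i : h1 *m ee i = ee i.
    by rewrite /h1 /tv trvE star_mul_ee vi' bar0 mul0r star_ee_ee ?neq_rev // raddf0 !mulmx0 scaler0 subr0 !addr0.
  have shortE p q x : i != rev_ord p -> i != rev_ord q -> trv S (ee p) (ee q *m x) 0 *m ee i = ee i.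
    move=> hp hq; rewrite trvE starM -mulmxA star_ee_ee // star_ee_ee //.
    by rewrite !mulmx0 scaler0 subr0 !addr0.
  rewrite !mx_mul_col e_i shortE; [|idx|idx].
  rewrite shortE; [|idx|idx].
  have ji'' : star S (ee j) *m ee i = 0 by apply: star_ee_ee; idx.
  rewrite /h4 /tv trvE ji'' !mulmx0 scaler0 subr0 addr0.
  by rewrite star_mul_ee VE eqxx rev_neq addr0 scal11 barK muK.
- by move=> z hz; rewrite !mx_mul_col; apply/cA4/cA3/cA2/cA1.
Qed.

End Local.

(** * Normality of the elementary group *)

(** Here n >= 3 enters: the at most four indices ±p, ±q do not exhaust Omega. *)
Lemma exists_index n (p q : 'I_(n + n)) : (3 <= n)%N ->
  exists l : 'I_(n + n), [/\ l != p, l != rev_ord p, l != q & l != rev_ord q].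
Proof.
move=> hn; apply: boolp.contrapT => h.
have : (#|'I_(n + n)| <= #|[set p; rev_ord p; q; rev_ord q]|)%N.
  apply: subset_leq_card; apply/subsetP => l _; apply: boolp.contrapT; rewrite !inE => /negP.
  by rewrite !negb_or => /andP [/andP [/andP [h1 h2] h3] h4]; apply: h; exists l.
rewrite card_ord; apply/negP; rewrite -ltnNge.
apply: leq_ltn_trans (_ : 4 < _)%N; last by lia.
rewrite -setUA; apply: leq_trans (leq_card_setU _ _).1 _.
by rewrite -[4%N]/(2 + 2)%N; apply: leq_add; rewrite cards2; case: eqP.
Qed.

Section Perp.
Variables (R : nzRingType) (S : form_ring R) (n : nat).
Local Notation bar := (fbar S).
Local Notation lam := (flam S).
Local Notation li := (fbar S (flam S)).
Local Notation N := (n + n)%N.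
Local Notation col := 'cV[R]_N.
Local Notation ee := (@ee R n).
Local Notation mu := (@mu R S n).
Local Notation EU := (@EU R bar lam n (fLam S)).
Local Notation hh := (hh S).
Local Notation trv := (trv S).
Local Notation tv := (tv S).
Local Notation star := (star S).
Local Notation adj := (adj S).
Implicit Types (u v w : col) (p q : 'I_N).

Definition perp_coef u (c : 'I_N) (b : R) (k : 'I_N) : R :=
  - (bar (mu c) * mu (rev_ord k) * bar b * bar (u (rev_ord k) 0)).

(* When [b u_c = s], these are isotropic vectors orthogonal to [u], each supported on two
   coordinates; together with [u] they generate the orthogonal of [u] after inverting [s]. *)
Definition perp u c b s k : col := ee k *m s%:M + ee (rev_ord c) *m (perp_coef u c b k)%:M.

Section Fixed.
Variables (u : col) (c : 'I_N) (b s : R).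
Hypotheses (bu : b * u c 0 = s) (ss : bar s = s).
Hypothesis su : forall p, s * bar (u p 0) = bar (u p 0) * s.
Local Notation w := (perp u c b s).
Local Notation al := (perp_coef u c b).

Lemma perp_entry k q : w k q 0 = (if q == k then s else 0) + (if q == rev_ord c then al k else 0).
Proof. by rewrite mxE !eex_entry !scal11. Qed.

Lemma perp0 k l : l != k -> l != rev_ord c -> w k l 0 = 0.
Proof. by move=> /negPf h1 /negPf h2; rewrite perp_entry h1 h2 addr0. Qed.

Lemma hh_perp k v : hh (w k) v = s * mu k * v (rev_ord k) 0 + bar (al k) * mu (rev_ord c) * v c 0.
Proof. by rewrite hhDl !hh_eex !scal11 ss rev_ordK. Qed.

Lemma bar_perp_coef k : bar (al k) = - (mu c * bar (mu (rev_ord k)) * u (rev_ord k) 0 * b).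
Proof.
rewrite barN !barM !barK; congr (- _); rewrite bar_muC; set z := mu c * _.
have zC : central z by move=> x; rewrite /z -mulrA bar_muC !mulrA muC.
by rewrite -(zC b) mulrA -(zC (u _ _)).
Qed.

Lemma perp_orth k : star u *m w k = 0.
Proof.
apply/hh0P; rewrite hhDr !hhMr !hh_mul_ee !scal11 rev_ordK /perp_coef.
rewrite mulrN !mulrA muKV -!(muC S (rev_ord k)) -!mulrA (mulrA (bar (u c 0))) -barM bu ss su.
by rewrite subrr.
Qed.

Lemma perp_iso k : k != c -> iso S (w k).
Proof.
move=> hk; rewrite /iso /perp ffDl !ffDr !ffM !ff_ee0 ?neq_rev //; try idx.
by rewrite !mulmx0 !mul0mx !addr0; exact: Lam1_0.
Qed.

Lemma perp_perp k k' : k != c -> k' != c -> k' != rev_ord k -> star (w k) *m w k' = 0.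
Proof.
move=> h1 h2 h3; apply/hh0P; rewrite hh_perp !perp_entry.
have -> : (rev_ord k == k') = false by idx.
have -> : (rev_ord k == rev_ord c) = false by idx.
have -> : (c == k') = false by idx.
have -> : (c == rev_ord c) = false by idx.
by rewrite !addr0 !mulr0 addr0.
Qed.

(** The vector is supported on [k] and [-c], so it vanishes on the plane of any third index. *)
Lemma good_perp k v : (3 <= n)%N -> k != c -> k != rev_ord c -> star (w k) *m v = 0 -> good S (w k) v.
Proof.
move=> hn h1 h2 h; have [l [l1 l2 l3 l4]] := exists_index k c hn.
apply: (good_zero_plane (l := l)) => //; first exact: perp_iso.
  exact: perp0.
by apply: perp0; idx.
Qed.

Section Orthogonal.
Hypotheses (hn : (3 <= n)%N) (hu : iso S u).

(** Swapping turns it into a transvection at [w k], to which [good_perp] applies. *)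
Lemma EU_perp k y : k != c -> k != rev_ord c -> EU (trv u (w k *m y) 0).
Proof.
move=> h1 h2; rewrite trv_swap; apply: good_trv.
  by apply: isoN; apply: iso_scale; [exact: lamC|exact: isoM].
apply: good_perp => //.
rewrite mulmxN mulmxZ; last exact: lamC.
by rewrite mulmxA (star_eq0_sym (perp_orth k)) mul0mx scaler0 oppr0.
Qed.

(** An elementary [T] sends [w k] to w k + u s^2. Conjugating the long transvection at [w k] by [T]
    and splitting along this sum leaves the one at u s^2 and a factor covered by [EU_perp]. *)
Lemma EU_long_sq al1 : c != rev_ord c -> Lam1 S al1 -> EU (trv (u *m (s * s)%:M) 0 (- (li *: al1))).
Proof.
move=> _ hal; have [k [k1 k2 _ _]] := exists_index c c hn.
have k1' : rev_ord k != c by idx.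
have k2' : rev_ord k != rev_ord c by idx.
pose T := trv u (w (rev_ord k) *m (mu (rev_ord k))%:M) 0.
have hT : EU T by exact: EU_perp.
have [T' hT' iT] := EU_inv hT.
have hwk : w (rev_ord k) (rev_ord k) 0 = s.
  by rewrite perp_entry eqxx (negPf k2') addr0.
have Tw : T *m w k = w k + u *m (s * s)%:M.
  rewrite /T trvE perp_orth !mulmx0 scaler0 subr0 addr0 starM adj_scalar -mulmxA.
  congr (_ + _ *m _); rewrite star_hh hh_perp rev_ordK perp_entry eqxx (negPf k2) addr0.
  rewrite perp_entry eq_sym (negPf k1) eq_sym rev_neq addr0 mulr0 addr0 -scalar_mxM; congr (_%:M).
  by rewrite !mulrA bar_muC -!mulrA (mulrA (bar _)) muVl mul1r.
set a := - _; pose x := u *m (s * s)%:M : col.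
have h0 : EU (trv (w k) 0 a).
  have [_ h] : good S (w k) 0 by apply: good_perp; rewrite ?mulmx0.
  by have := h al1 hal; rewrite /tv ff0l add0r.
have := EUM (EUM hT h0) hT'.
rewrite trv_conj ?mulmx0 ?Tw //; last exact: unitary_J (EU_unitary hT).
have ux : star (u *m (s * s)%:M) *m (u *m (s * s)%:M) = 0 by exact/iso_star/isoM.
rewrite trv_add //.
- move=> h; apply: (EU_cancel_l h0); apply: EU_cancel_r h.
  by rewrite trv_scale mulmx0 mul0mx -mulmxA; exact: EU_perp.
- exact/iso_star/perp_iso.
- by rewrite mulmxA (star_eq0_sym (perp_orth k)) mul0mx.
- by rewrite mulmx0.
- by rewrite mulmx0.
- by have := tv_cond (0 : col) hal; rewrite ff0l add0r.
Qed.

Lemma good_long_sq : good S (u *m (s * s)%:M) 0.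
Proof.
split=> [|al1 hal]; first by rewrite mulmx0.
by rewrite /tv ff0l add0r; apply: EU_long_sq => //; idx.
Qed.

Lemma good_perp_sq k y : k != c -> k != rev_ord c -> good S (u *m (s * s)%:M) (w k *m y).
Proof.
move=> h1 h2; apply: good_trv0.
- exact/iso_star/isoM.
- by rewrite starM -mulmxA (mulmxA (star u)) perp_orth mul0mx mulmx0.
- exact: good_long_sq.
- exact/isoM/perp_iso.
- by rewrite trv_scale mulmx0 mul0mx -mulmxA; exact: EU_perp.
Qed.

(** The column v s - u b v_c, called [d], vanishes at [c]. After multiplication by [s] it is a
    combination of the vectors [perp], so v s^3 is a combination of u s^2 and of these. *)
Lemma good_cube v y : star u *m v = 0 -> u c 0 * b = s -> (forall p, s * u p 0 = u p 0 * s) ->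
  (forall p, s * v p 0 = v p 0 * s) -> s * b = b * s -> s * y = y * s ->
  good S (u *m (s * s)%:M) (v *m (s * s * s * y)%:M).
Proof.
move=> uv ub su' sv sb sy.
pose d p := v p 0 * s - u p 0 * b * v c 0.
have dc : d c = 0 by rewrite /d ub sv subrr.
have sd p : s * d p = d p * s.
  by rewrite /d mulrBr mulrBl !mulrA sv su' -!mulrA (mulrA s b) sb -!mulrA sv.
(* The coordinate [-c] is not free: orthogonality of [d] to [u] expresses it by the others, and
   [perp_coef] has the matching coefficients. *)
have key : \sum_(k | (k != c) && (k != rev_ord c)) al k * d k = s * d (rev_ord c).
  have : \sum_p bar (u p 0) * mu p * d (rev_ord p) = 0.
    have h1 : \sum_p bar (u p 0) * mu p * v (rev_ord p) 0 = 0 by rewrite -hhE; apply/hh0P.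
    have h2 : \sum_p bar (u p 0) * mu p * u (rev_ord p) 0 = 0.
      by rewrite -hhE; apply/hh0P/iso_star.
    rewrite (eq_bigr (fun p => bar (u p 0) * mu p * v (rev_ord p) 0 * s -
      bar (u p 0) * mu p * u (rev_ord p) 0 * (b * v c 0))); last by move=> p _; rewrite /d; ncring.
    by rewrite sumrB -!mulr_suml h1 h2 !mul0r subrr.
  rewrite (bigD1 c) //= (bigD1 (rev_ord c)) /= ?rev_neq // rev_ordK dc mulr0 add0r.
  move=> /eqP; rewrite addr_eq0 => /eqP h.
  have h' : bar b * bar (mu c) * (bar (u c 0) * mu c * d (rev_ord c)) = s * d (rev_ord c).
    rewrite !mulrA; congr (_ * _); rewrite -(mulrA (bar b)) bar_muC mulrA.
    by rewrite -mulrA muVl mulr1 -barM ub.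
  rewrite -h' h mulrN mulr_sumr -sumrN (reindex_inj rev_ord_inj) /=.
  apply: eq_big => [p|p hp]; first by rewrite rev_eq (inj_eq rev_ord_inj) andbC.
  rewrite /perp_coef rev_ordK mulNr !mulrA; congr (- (_ * _)).
  by rewrite -[RHS](muC S p) -(bar_muC _ c (bar b)) !mulrA (bar_muC _ c (mu p)).
have -> : v *m (s * s * s * y)%:M = (u *m (s * s)%:M) *m (b * v c 0 * y)%:M +
    \sum_(k | (k != c) && (k != rev_ord c)) w k *m (d k * s * y)%:M.
  have gen q : v q 0 * (s * s * s * y) = u q 0 * (s * s) * (b * v c 0 * y) + s * d q * s * y.
    have -> : u q 0 * (s * s) * (b * v c 0 * y) = s * (u q 0 * b * v c 0) * s * y.
      rewrite !mulrA; congr (_ * _).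
      by rewrite su' -!mulrA; congr (_ * (_ * _)); rewrite mulrA sb -mulrA sv.
    by rewrite /d mulrBr mulrBl mulrBl addrCA subrr addr0 !mulrA sv -!mulrA.
  apply/matrixP => q i; rewrite ord1 [RHS]mxE !mulmx1_entry summxE !scal11 gen.
  congr (_ + _).
  have [->|hc] := eqVneq q c.
    rewrite dc mulr0 !mul0r big1 // => k /andP [k1 k2].
    by rewrite mulmx1_entry perp_entry eq_sym (negPf k1) neq_rev addr0 mul0r.
  have [->|hc'] := eqVneq q (rev_ord c).
    rewrite -key !mulr_suml; apply: eq_bigr => k /andP [k1 k2].
    by rewrite mulmx1_entry scal11 perp_entry eqxx eq_sym (negPf k2) add0r !mulrA.
  rewrite (bigD1 q) ?hc //= mulmx1_entry scal11 perp_entry eqxx (negPf hc') addr0 !mulrA.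
  rewrite big1 ?addr0 // => k /andP [_ hk].
  by rewrite mulmx1_entry perp_entry eq_sym (negPf hk) (negPf hc') addr0 mul0r.
have uu : star (u *m (s * s)%:M) *m (u *m (s * s)%:M) = 0 by exact/iso_star/isoM.
apply: good_add => //; first by apply: good_self; [exact: isoM|exact: good_long_sq].
apply: good_sum => //; first exact: good_long_sq.
by move=> k /andP [k1 k2]; exact: good_perp_sq.
Qed.

End Orthogonal.
End Fixed.
End Perp.

Section Normality.
Variables (R : nzRingType) (S : form_ring R) (n : nat).
Local Notation bar := (fbar S).
Local Notation lam := (flam S).
Local Notation li := (fbar S (flam S)).
Local Notation N := (n + n)%N.
Local Notation col := 'cV[R]_N.
Local Notation ee := (@ee R n).
Local Notation mu := (@mu R S n).
Local Notation EU := (@EU R bar lam n (fLam S)).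
Local Notation trv := (trv S).
Local Notation star := (star S).
Implicit Types (u v w : col) (p q : 'I_N).
Hypotheses (hn : (3 <= n)%N) (LF : locally_finite S).

Definition entries (s : 'M[R]_N) : seq R := [seq s p q | p <- enum 'I_N, q <- enum 'I_N].

Lemma entries_mem (s : 'M[R]_N) p q : s p q \in entries s.
Proof. by apply/allpairsP; exists (p, q); rewrite !mem_enum. Qed.

Lemma mul_ee_entry (s : 'M[R]_N) p q : (s *m ee p) q 0 = s q p.
Proof. exact: mul_ee. Qed.

Lemma inv2_unimodular (s s' : 'M[R]_N) i : inv2 s s' -> \sum_p s' i p * (s *m ee i) p 0 = 1.
Proof.
move=> [_ h]; transitivity ((s' *m s) i i); last by rewrite h mxE eqxx.
by rewrite mxE; apply: eq_bigr => p _; rewrite mul_ee_entry.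
Qed.

(** The [c] such that the conjugate is elementary for all coefficients in c A form an ideal of [C].
    Were it inside a maximal [m], an elementary [h] would make a coordinate of the column h s e_i
    locally invertible, and [good_cube] would put c^5 into it for some [c] outside [m]. *)
Lemma EU_conj_short s s' i j x : unitary S s -> inv2 s s' -> j != i -> j != rev_ord i ->
  EU (s *m trv (ee i) (ee j *m x) 0 *m s').
Proof.
move=> hs ss ji ji'.
have [C [A [r [g [LS hF]]]]] := LF (x 0 0 :: entries s ++ entries s').
have FO := ls_fin LS; have CA := fo_CA FO.
have [[C0 [CD CN]] [C1 CM]] := fo_C FO.
have [[A0 [AD AN]] [A1 AM]] := fo_A FO.
have AB a b : A a -> A b -> A (a - b) by move=> ha /AN; exact: AD.
have sA p q : A (s p q) by apply: hF; rewrite inE mem_cat entries_mem orbT.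
have s'A p q : A (s' p q) by apply: hF; rewrite inE mem_cat entries_mem !orbT.
have xA : A (x 0 0) by apply: hF; rewrite mem_head.
have Js := unitary_J hs.
pose Q c := C c /\ forall y, A y -> EU (s *m trv (ee i) (ee j *m (c * y)%:M) 0 *m s').
suff : Q 1 by move=> [_ /(_ _ xA)]; rewrite mul1r -mx11_scalar.
have jj : star (ee j) *m ee j = 0 by exact/iso_star/iso_ee.
have ij0 (y : 'M[R]_1) : star (ee i) *m (ee j *m y) = 0 by exact: star_ee_eex.
have shD (y z : R) : trv (ee i) (ee j *m (y + z)%:M) 0 =
    trv (ee i) (ee j *m y%:M) 0 *m trv (ee i) (ee j *m z%:M) 0.
  rewrite trv_mul ?ij0 //; last exact/iso_star/iso_ee.
  rewrite starM -mulmxA (mulmxA (star _)) jj mul0mx mulmx0 scaler0 subr0 addr0.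
  by rewrite raddfD mulmxDr.
have conjM a b : EU (s *m a *m s') -> EU (s *m b *m s') -> EU (s *m (a *m b) *m s').
  move=> h1 h2; have := EUM h1 h2; congr EU.
  by rewrite -!mulmxA; congr (_ *m (_ *m _)); rewrite !mulmxA (proj2 ss) mul1mx.
apply: boolp.contrapT => nQ1.
have [||x1 y1 [hx1 Hx] [hy1 Hy]|c x1 hc [hx1 Hx]|m MI Qm] := maximal_ideal_exists (S := Q) FO _ _ _ _ nQ1.
- by move=> y [].
- split=> // y _; rewrite mul0r raddf0 mulmx0 trv00 mulmx1 (proj1 ss); exact: EU1.
- by split=> [|y hy]; [exact: CD|rewrite mulrDl shD; apply: conjM; [exact: Hx|exact: Hy]].
- split=> [|y hy]; first exact: CM.
  rewrite (fo_comm FO hc (CA _ hx1)) -mulrA; apply: Hx.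
  by apply: AM => //; exact: CA.
have [j2 [j21 j22 _ _]] := exists_index i i hn.
have [l [l1 l2 l3 l4]] := exists_index i j2 hn.
have uA : colA A (s *m ee i) by move=> p; rewrite mul_ee_entry.
have [h [y0 [b [c [hh _ _ huA [bA cC nmc e1 e2]]]]]] :=
  unit_coordinate LS MI j21 j22 l1 l2 l3 l4 uA (s'A i) (inv2_unimodular i ss).
have [h' hh' ihh] := EU_inv hh.
have cA := CA _ cC.
have cc y : A y -> c * y = y * c by exact: (fo_comm FO).
have hU := EU_unitary hh.
pose s1 := h *m s; have hs1 : unitary S s1 by exact: unitaryM.
pose u := s1 *m ee i; pose v := s1 *m ee j.
have uE : h *m (s *m ee i) = u by rewrite /u /s1 mulmxA.
rewrite uE in huA e1 e2.
(* Three factors come from the direction in [good_cube]; the other two are c^2, moved from the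
   vector [u] into the direction. *)
suff : Q (c * c * c * c * c).
  move=> /Qm; rewrite -[c * c * c * c * c]mulr1 -!mulrA => hm.
  by have [] := max_exp FO MI 5 cC nmc; rewrite !exprS expr0 => /(_ hm).
have cccc : C (c * c * c * c * c) by do !apply: (CM) => //.
split=> // y hy; apply: (EU_cancel_l hh); apply: (EU_cancel_r hh').
set X := trv _ _ _.
have -> : h *m (s *m X *m s') *m h' = s1 *m X *m (s' *m h') by rewrite /s1 !mulmxA.
have is1 : inv2 s1 (s' *m h') by exact: inv2_mul.
rewrite /X trv_conj //; last exact: unitary_J.
rewrite mulmxA -/u -/v.
have uA' := huA _ uA; rewrite uE in uA'.
have vA : colA A v.
  by move=> p; rewrite /v /s1 mx_mul_col; apply: huA => q; rewrite mul_ee_entry.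
have ui : iso S u by apply: unitary_iso => //; exact: iso_ee.
have vi : iso S v by apply: unitary_iso => //; exact: iso_ee.
have uv : star u *m v = 0.
  by rewrite unitary_star // -[ee j]mulmx1; exact: star_ee_eex.
have [_ hg] := good_cube e1 (ls_sym LS cC) (fun p => cc _ (ls_bar LS (uA' p))) hn ui uv e2
  (fun p => cc _ (uA' p)) (fun p => cc _ (vA p)) (cc _ bA) (cc _ hy).
have := good_trv (isoM _ vi) (conj _ hg); rewrite trv_scale mulmx0 mul0mx adj_scalar.
rewrite barM !(ls_sym LS cC) -mulmxA -scalar_mxM.
have -> : c * c * c * y * (c * c) = c * c * c * c * c * y.
  by rewrite -!mulrA; do 3 congr (_ * _); rewrite mulrA -(cc y) // -mulrA -(cc y).
by apply; rewrite starM -mulmxA (mulmxA (star u)) uv mul0mx mulmx0.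
Qed.

(** [g] sends e_p to e_p + e_k. Splitting g L g' along this sum exhibits the long root element at
    [k] as a commutator times a short root element. *)
Lemma long_from_short p k (a : 'M[R]_1) al : a = - (li *: al) -> Lam1 S al ->
  k != p -> k != rev_ord p ->
  let g := trv (ee k) (ee (rev_ord p) *m (mu (rev_ord p))%:M) 0 in
  let L := trv (ee p) 0 a in forall g' L', inv2 g g' -> inv2 L L' ->
  trv (ee k) 0 a = L' *m g *m L *m g' *m trv (ee k) (ee p *m - adj S a) 0.
Proof.
move=> ea hal kp kp' g L g' L' ig iL.
have kk : star (ee k) *m ee k = 0 by exact/iso_star/iso_ee.
have pp : star (ee p) *m ee p = 0 by exact/iso_star/iso_ee.
have pk : star (ee p) *m ee k = 0 by apply: star_ee_ee; idx.
have kp0 : star (ee k) *m ee p = 0 by apply: star_ee_ee; idx.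
have gU : unitary S g by apply: EU_unitary; apply: EU_short; idx.
have gp : g *m ee p = ee p + ee k.
  rewrite /g trvE kp0 !mulmx0 scaler0 subr0 addr0 starM adj_scalar -mulmxA.
  have := star_ee_rev S (rev_ord p); rewrite rev_ordK => ->.
  by rewrite -scalar_mxM muVl mulmx1.
have h1 : g *m L *m g' = trv (ee p + ee k) 0 a.
  by rewrite /L trv_conj ?mulmx0 ?gp //; exact: unitary_J.
have h2 : trv (ee p + ee k) 0 a = L *m trv (ee k) 0 a *m trv (ee k) (ee p *m adj S a) 0.
  apply: trv_add; rewrite ?mulmx0 //.
  by have := tv_cond (0 : col) hal; rewrite ff0l add0r -ea ?mulmx0.
have h3 : p != rev_ord k by idx.
have -> : L' *m g *m L *m g' = L' *m (g *m L *m g') by rewrite !mulmxA.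
rewrite h1 h2 !mulmxA (proj2 iL) mul1mx -mulmxA mulmxN -mulmxN.
by rewrite (proj1 (short_inv S (adj S a) h3)) mulmx1.
Qed.

(** In the expression of [long_from_short] the product L' g L is a conjugate of a short root element
    by the unitary L', so every factor falls under the short case. *)
Lemma EU_conj_long s s' p al : unitary S s -> inv2 s s' -> Lam1 S al ->
  EU (s *m trv (ee p) 0 (- (li *: al)) *m s').
Proof.
move=> hs ss hal; have [q [q1 q2 _ _]] := exists_index p p hn.
have eL := EU_long q hal; have iL := long_inv S q al.
set g := trv (ee p) (ee (rev_ord q) *m (mu (rev_ord q))%:M) 0.
have [g1 g2] : rev_ord q != p /\ rev_ord q != rev_ord p by split; idx.
have [g' eg' ig] := EU_inv (EU_short (S := S) (mu (rev_ord q))%:M g1 g2).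
rewrite (long_from_short (erefl _) hal _ _ ig iL); try idx.
rewrite -/g; set L' := trv (ee q) 0 (- (li *: - al)); set L := trv (ee q) 0 (- (li *: al)).
have LL' : inv2 L L' := iL.
have L'U : unitary S L' by apply: (unitaryV _ LL'); exact: EU_unitary.
have sL : unitary S (s *m L') by exact: unitaryM.
have isL : inv2 (s *m L') (L *m s') by apply: inv2_mul => //; exact: inv2_sym.
have e1 := EU_conj_short (mu (rev_ord q))%:M sL isL g1 g2.
have e2 : EU (s *m g' *m s').
  by apply: EUV (inv2_conj ss ig); exact: EU_conj_short.
have q1' : q != p by [].
have e3 := EU_conj_short (- adj S (- (li *: al))) hs ss q1' q2.
have := EUM (EUM e1 e2) e3; congr EU.
by rewrite !mulmxA -!(mulmxA _ s' s) (proj2 ss) !mulmx1.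
Qed.

Theorem EU_normal s s' e : unitary S s -> inv2 s s' -> EU e -> EU (s *m e *m s').
Proof.
move=> hs ss he; pose P e := EU (s *m e *m s').
apply: (EU_min (P := P)) he.
- split; first by rewrite /P mulmx1 (proj1 ss); exact: EU1.
  split=> [a b ha hb|a ha].
    have := EUM ha hb; congr EU; rewrite -!mulmxA; congr (_ *m (_ *m _)).
    by rewrite !mulmxA (proj2 ss) mul1mx.
  have [b hb [h1 h2]] := EU_inv ha.
  have E1 : s' *m (s *m a *m s') *m s = a.
    by rewrite !mulmxA (proj2 ss) mul1mx -mulmxA (proj2 ss) mulmx1.
  exists (s' *m b *m s); split.
    by rewrite /P !mulmxA (proj1 ss) mul1mx -mulmxA (proj1 ss) mulmx1.
  by rewrite -E1; exact: (inv2_conj (inv2_sym ss) (conj h1 h2)).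
- by move=> p q x h1 h2; exact: EU_conj_short.
- by move=> p al h; exact: EU_conj_long.
Qed.

End Normality.

(** * Quasi-finite rings are locally finite over symmetric central elements *)

Lemma finite_over_fin (R : nzRingType) (C A : R -> Prop) (T : finType) (g : T -> R) :
  subring C -> subring A -> (forall c, C c -> A c) ->
  (forall c a, C c -> A a -> c * a = a * c) -> (forall t, A (g t)) ->
  (forall a, A a -> exists2 c : T -> R, (forall t, C (c t)) & a = \sum_t c t * g t) ->
  finite_over C A (fun i : 'I_#|T| => g (enum_val i)).
Proof.
move=> h1 h2 h3 h4 h5 h6; split=> // a /h6 [c hc ->].
exists (fun i => c (enum_val i)) => //.
by rewrite (reindex_onto enum_val enum_rank) => [|t _]; rewrite ?enum_rankK //;
   apply: eq_bigl => i; rewrite enum_valK eqxx.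
Qed.

Section QuasiFinite.
Variables (R : nzRingType) (S : form_ring R).
Local Notation bar := (fbar S).
Local Notation lam := (flam S).

Section Stage.
Variables (B : R -> Prop) (m : nat) (g : 'I_m -> R).
Hypotheses (hB : subring B) (hbar : forall x, B x -> B (bar x)) (hlam : B lam).
Hypothesis (hg : forall k, B (g k)).
Hypothesis hspan : forall x, B x -> exists c : 'I_m -> R,
  (forall k, B (c k) /\ forall y, B y -> c k * y = y * c k) /\ x = \sum_(k < m) c k * g k.

Let B0 : B 0. Proof. by case: hB => [[]]. Qed.
Let B1 : B 1. Proof. by case: hB => _ []. Qed.
Let BD x y : B x -> B y -> B (x + y). Proof. by case: hB => [[_ [h _]] _]; exact: h. Qed.
Let BN x : B x -> B (- x). Proof. by case: hB => [[_ [_ h]] _]; exact: h. Qed.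
Let BM x y : B x -> B y -> B (x * y). Proof. by case: hB => _ [_ h]; exact: h. Qed.

Definition center c := B c /\ forall y, B y -> c * y = y * c.
Definition sym_center c := center c /\ bar c = c.

Lemma center_D x y : center x -> center y -> center (x + y).
Proof.
by move=> [hx cx] [hy cy]; split=> [|z hz]; [exact: BD|rewrite mulrDl mulrDr cx ?cy].
Qed.
Lemma center_N x : center x -> center (- x).
Proof. by move=> [hx cx]; split=> [|z hz]; [exact: BN|rewrite mulNr mulrN cx]. Qed.
Lemma center_M x y : center x -> center y -> center (x * y).
Proof.
move=> [hx cx] [hy cy]; split=> [|z hz]; [exact: BM|].
by rewrite -mulrA cy // !mulrA cx // .
Qed.
Lemma center_1 : center 1. Proof. by split=> // y _; rewrite mul1r mulr1. Qed.
Lemma center_0 : center 0. Proof. by split=> // y _; rewrite mul0r mulr0. Qed.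
Lemma center_bar x : center x -> center (bar x).
Proof.
move=> [hx cx]; split=> [|z hz]; first exact: hbar.
by rewrite -[z](barK S) -!barM cx //; exact: hbar.
Qed.

Lemma subring_sym_center : subring sym_center.
Proof.
split; first split; [|split|].
- by split; [exact: center_0|exact: bar0].
- by move=> x y [hx ex] [hy ey]; split; [exact: center_D|rewrite barD ex ey].
- by move=> x [hx ex]; split; [exact: center_N|rewrite barN ex].
split; first by split; [exact: center_1|exact: bar1].
move=> x y [hx ex] [hy ey]; split; first exact: center_M.
by rewrite barM ex ey; case: hy => yB cy; rewrite cy //; case: hx.
Qed.

(** The coefficients given by almost commutativity are central but not symmetric. They are adjoined
    to the symmetric ones, over which each is quadratic, so that the extension stays finite and
    stable under [bar]. *)
Record central_ext (K : R -> Prop) : Prop := CentralExt {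
  ce_ring : subring K;
  ce_center : forall x, K x -> center x;
  ce_bar : forall x, K x -> K (bar x);
  ce_sym : forall x, sym_center x -> K x;
  ce_fin : exists (T : finType) (s : T -> R), (forall t, K (s t)) /\
     forall x, K x -> exists2 f : T -> R, (forall t, sym_center (f t)) & x = \sum_t f t * s t }.

Lemma central_ext_sym : central_ext sym_center.
Proof.
split=> //; first exact: subring_sym_center.
- by move=> x [].
- by move=> x [h e]; rewrite e.
- exists unit, (fun=> 1); split=> [_|x hx]; first by split; [exact: center_1|exact: bar1].
  exists (fun=> x) => //; rewrite (big_pred1 tt) ?mulr1 //; by case.
Qed.

(* Adjoining a central [c]: it satisfies [c^2 = (c + bar c) c - c (bar c)]. *)
Lemma central_ext_adjoin K c : central_ext K -> center c ->
  exists2 K', central_ext K' & K' c /\ forall x, K x -> K' x.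
Proof.
move=> hK hc; have [[K0 [KD KN]] [K1 KM]] := ce_ring hK.
pose K' x := exists x1 x2, [/\ K x1, K x2 & x = x1 + c * x2].
have cb := center_bar hc.
have tr : sym_center (c + bar c).
  by split; [exact: center_D|rewrite barD barK addrC].
have nm : sym_center (c * bar c).
  by split; [exact: center_M|rewrite barM barK].
have Ktr := ce_sym hK tr; have Knm := ce_sym hK nm.
have cK x : K x -> c * x = x * c by move=> /(ce_center hK) [xB _]; apply: hc.2.
have c2 : c * c = (c + bar c) * c - c * bar c.
  by rewrite mulrDl (proj2 cb) ?addrK //; case: hc.
have KK' x : K x -> K' x by move=> hx; exists x, 0; rewrite mulr0 addr0.
exists K'; last by split=> //; exists 0, 1; rewrite mulr1 add0r.
split.
- split; first split; [exact: KK'|split|].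
  + move=> x y [x1 [x2 [h1 h2 ->]]] [y1 [y2 [h3 h4 ->]]].
    by exists (x1 + y1), (x2 + y2); split; [exact: KD|exact: KD|rewrite mulrDr addrACA].
  + move=> x [x1 [x2 [h1 h2 ->]]].
    by exists (- x1), (- x2); split; [exact: KN|exact: KN|rewrite mulrN opprD].
  split; first exact: KK'.
  move=> x y [x1 [x2 [h1 h2 ->]]] [y1 [y2 [h3 h4 ->]]].
  exists (x1 * y1 - c * bar c * (x2 * y2)), (x1 * y2 + x2 * y1 + (c + bar c) * (x2 * y2)).
  split; first by apply: (KD); [exact: KM|apply: (KN); apply: (KM) => //; exact: KM].
    by apply: (KD); [apply: (KD); exact: KM|apply: (KM) => //; exact: KM].
  have E : c * x2 * (c * y2) = (c + bar c) * c * (x2 * y2) - c * bar c * (x2 * y2).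
    by rewrite -mulrBl -c2 -!mulrA; congr (_ * _); rewrite !mulrA cK.
  have E2 : x1 * (c * y2) = c * (x1 * y2) by rewrite !mulrA cK.
  have E3 : c * ((c + bar c) * (x2 * y2)) = (c + bar c) * c * (x2 * y2).
    by rewrite mulrA cK.
  move: (c + bar c) (c * bar c) E E3 => t d E E3.
  by rewrite mulrDr !mulrDl E E2 2!(mulrDr c) E3 !mulrA; abel.
- move=> x [x1 [x2 [/(ce_center hK) h1 /(ce_center hK) h2 ->]]].
  by apply: center_D => //; exact: center_M.
- move=> x [x1 [x2 [h1 h2 ->]]].
  exists (bar x1 + (c + bar c) * bar x2), (- bar x2); split.
  + by apply: (KD); [exact: (ce_bar hK)|apply: (KM) => //; exact: (ce_bar hK)].
  + by apply: (KN); exact: (ce_bar hK).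
  + rewrite barD barM; have [/hbar h _] := ce_center hK h2.
    by rewrite -(proj2 cb) // mulrN mulrDl; abel.
- by move=> x /(ce_sym hK); exact: KK'.
- have [T [s [hs Hs]]] := ce_fin hK.
  exists (T + T)%type, (fun t => match t with inl t => s t | inr t => c * s t end); split.
    by case=> t; [exact/KK'/hs|exists 0, (s t); rewrite add0r].
  move=> x [x1 [x2 [/Hs [f1 hf1 ->] /Hs [f2 hf2 ->] ->]]].
  exists (fun t => match t with inl t => f1 t | inr t => f2 t end); first by case.
  rewrite big_sumType /=; congr (_ + _); rewrite mulr_sumr; apply: eq_bigr => t _.
  by rewrite !mulrA (cK _ (ce_sym hK (hf2 t))).
Qed.

Lemma central_ext_seq (cs : seq R) : (forall c, c \in cs -> center c) ->
  exists2 K, central_ext K & forall c, c \in cs -> K c.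
Proof.
elim: cs => [|c cs IH] h; first by exists sym_center => //; exact: central_ext_sym.
have [|K hK HK] := IH; first by move=> d hd; apply: h; rewrite inE hd orbT.
have [K' hK' [h1 h2]] := central_ext_adjoin hK (h c (mem_head _ _)).
by exists K' => // d; rewrite inE => /orP [/eqP ->|/HK /h2].
Qed.

(** [A] is the span of the [g k] over a finite central extension [K] containing the coefficients of
    1, [lam], the members of [F], the [bar (g k)] and the products [g k * g l]; these structure
    constants make [A] a ring stable under [bar]. *)
Lemma local_subring_stage (F : seq R) : (forall x, x \in F -> B x) ->
  exists (C A : R -> Prop) (r : nat) (h : 'I_r -> R),
    local_subring S C A h /\ forall x, x \in F -> A x.
Proof.
move=> hF.
have [cf hcf] : {cf : R -> 'I_m -> R & forall x, B x ->
    (forall k, center (cf x k)) /\ x = \sum_(k < m) cf x k * g k}.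
  apply: (@boolp.choice _ _ (fun x c => B x -> (forall k, center (c k)) /\
    x = \sum_(k < m) c k * g k)) => x.
  case: (boolp.pselect (B x)) => [/hspan [c [h1 h2]]|h]; first by exists c.
  by exists (fun=> 0).
pose E := 1 :: lam :: F ++ [seq bar (g k) | k <- enum 'I_m] ++
  [seq g k * g l | k <- enum 'I_m, l <- enum 'I_m].
have EB x : x \in E -> B x.
  rewrite !inE !mem_cat => /orP [/eqP -> //|/orP [/eqP -> //|/orP [/hF //|/orP [|]]]].
    by move=> /mapP [k _ ->]; exact: hbar.
  by move=> /allpairsP [[k l] [_ _ ->]]; exact: BM.
have [|K hK HK] := @central_ext_seq [seq cf x k | x <- E, k <- enum 'I_m].
  by move=> c /allpairsP [[x k] /= [hx _ ->]]; case: (hcf x (EB x hx)).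
have [[K0 [KD KN]] [K1 KM]] := ce_ring hK.
have Kcf x k : x \in E -> K (cf x k).
  by move=> hx; apply: HK; apply/allpairsP; exists (x, k); rewrite mem_enum.
pose A x := exists2 f : 'I_m -> R, (forall k, K (f k)) & x = \sum_k f k * g k.
have EA x : x \in E -> A x.
  by move=> hx; exists (cf x) => [k|]; [exact: Kcf|case: (hcf x (EB x hx))].
have AD x y : A x -> A y -> A (x + y).
  move=> [f hf ->] [f' hf' ->]; exists (fun k => f k + f' k) => [k|]; first exact: KD.
  by rewrite -big_split; apply: eq_bigr => k _; rewrite mulrDl.
have AK c x : K c -> A x -> A (c * x).
  move=> hc [f hf ->]; exists (fun k => c * f k) => [k|]; first exact: KM.
  by rewrite mulr_sumr; apply: eq_bigr => k _; rewrite mulrA.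
have A0 : A 0 by exists (fun=> 0) => //; rewrite big1 // => k _; rewrite mul0r.
have A_sum (I : finType) (G : I -> R) : (forall i, A (G i)) -> A (\sum_i G i).
  by move=> h; apply: big_ind.
have A1 : A 1 by apply: EA; rewrite inE eqxx.
have KA c : K c -> A c by move=> hc; rewrite -[c]mulr1; exact: AK.
have AB x : A x -> B x.
  move=> [f hf ->]; apply: big_ind => // k _; apply: BM => //.
  by case: (ce_center hK (hf k)).
have KB c y : K c -> B y -> c * y = y * c by move=> /(ce_center hK) [_ h] /h.
have rA : subring A.
  split; first split => //; first split => //.
    move=> x [f hf ->]; rewrite -mulN1r; apply: (AK); [exact: KN|by exists f].
  split=> // x y [f hf ->] [f' hf' ->]; rewrite mulr_suml; apply: (A_sum) => k.
  rewrite mulr_sumr; apply: (A_sum) => l.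
  have -> : f k * g k * (f' l * g l) = f k * f' l * (g k * g l).
    by rewrite -!mulrA; congr (_ * _); rewrite !mulrA (KB _ _ (hf' l) (hg k)).
  apply: (AK); first exact: KM.
  apply: EA; rewrite !inE !mem_cat; do !(apply/orP; right).
  by apply/allpairsP; exists (k, l); rewrite !mem_enum.
have [T [s [hs Hs]]] := ce_fin hK.
exists sym_center, A, _, (fun i : 'I_#|{: T * 'I_m}| => s (enum_val i).1 * g (enum_val i).2).
split; last by move=> x hx; apply: EA; rewrite !inE mem_cat hx !orbT.
split.
- apply: (@finite_over_fin _ _ _ _ (fun t : T * 'I_m => s t.1 * g t.2)) => //.
  + exact: subring_sym_center.
  + by move=> c /(ce_sym hK) /KA.
  + by move=> c a /(ce_sym hK) hc /AB; exact: KB.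
  + move=> [t k] /=; apply: (AK) => //; exists (fun l => (l == k)%:R).
      by move=> l; case: eqP.
    by rewrite (bigD1 k) //= eqxx mul1r big1 ?addr0 // => l /negPf ->; rewrite mul0r.
  + move=> a [f hf ->].
    have [c hc] : {c : 'I_m -> T -> R & forall k,
        (forall t, sym_center (c k t)) /\ f k = \sum_t c k t * s t}.
      apply: (@boolp.choice _ _ (fun k c => (forall t, sym_center (c t)) /\ f k = \sum_t c t * s t)) => k.
      by have [c h1 h2] := Hs _ (hf k); exists c.
    exists (fun t : T * 'I_m => c t.2 t.1) => [[t k]|]; first by case: (hc k).
    rewrite -(pair_bigA _ (fun t k => c k t * (s t * g k))) exchange_big /=.
    apply: eq_bigr => k _; rewrite {1}(proj2 (hc k)) mulr_suml.
    by apply: eq_bigr => t _; rewrite mulrA.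
- by move=> c [].
- move=> a [f hf ->]; rewrite bar_sum; apply: (A_sum) => k; rewrite barM.
  rewrite -(KB _ _ (ce_bar hK (hf k))); last exact: hbar.
  apply: (AK); first exact: (ce_bar hK).
  apply: EA; rewrite !inE !mem_cat; apply/orP; right; apply/orP; right.
  by apply/orP; right; apply/orP; left; apply/mapP; exists k; rewrite ?mem_enum.
- by apply: EA; rewrite !inE eqxx orbT.
Qed.

End Stage.

Lemma quasi_finite_locally_finite : quasi_finite bar lam -> locally_finite S.
Proof.
move=> [J [Ri [h1 [h2 h3]]]] F.
have [j hj] : exists j, forall x, x \in F -> Ri j x.
  elim: F => [|x F [j hj]]; first by have [j _] := h3 0; exists j.
  have [j1 hj1] := h3 x; have [j2 [h4 h5]] := h2 j j1; exists j2 => y.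
  by rewrite inE => /orP [/eqP ->|/hj]; [exact: h5|exact: h4].
have [hr [[m [g [hg hs]]] [hb hl]]] := h1 j.
exact: (local_subring_stage hr hb hl hg hs hj).
Qed.
End QuasiFinite.

(** * Local finiteness of homomorphic images *)

Section Image.
Variables (R Q : nzRingType) (S : form_ring R) (T : form_ring Q) (f : {rmorphism R -> Q}).
Hypotheses (fb : forall x, f (fbar S x) = fbar T (f x)) (fl : f (flam S) = flam T).
Hypothesis surj : forall y, exists x, f x = y.

Lemma locally_finite_image : locally_finite S -> locally_finite T.
Proof.
move=> LF F.
have [F' hF'] : exists F', F = [seq f x | x <- F'].
  elim: F => [|y F [F' ->]]; first by exists [::].
  by have [x <-] := surj y; exists (x :: F').
have [C [A [r [g [LS hF]]]]] := LF F'.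
have FO := ls_fin LS; pose im (P : R -> Prop) y := exists2 x, P x & f x = y.
have imr P : subring P -> subring (im P).
  move=> [[P0 [PD PN]] [P1 PM]]; split; first split; [|split|].
  - by exists 0; rewrite ?raddf0.
  - by move=> x y [x' hx <-] [y' hy <-]; exists (x' + y'); [exact: PD|rewrite raddfD].
  - by move=> x [x' hx <-]; exists (- x'); [exact: PN|rewrite raddfN].
  split; first by exists 1; rewrite ?rmorph1.
  by move=> x y [x' hx <-] [y' hy <-]; exists (x' * y'); [exact: PM|rewrite rmorphM].
exists (im C), (im A), r, (f \o g); split; last first.
  by move=> y; rewrite hF' => /mapP [x hx ->]; exists x => //; exact: hF.
split; first split.
- exact/imr/(fo_C FO).
- exact/imr/(fo_A FO).
- by move=> y [x hx <-]; exists x => //; exact: (fo_CA FO).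
- by move=> c a [c' hc <-] [a' ha <-]; rewrite -!rmorphM (fo_comm FO).
- by move=> k; exists (g k) => //; exact: (fo_gen FO).
- move=> a [a' /(fo_span FO) [c hc ->] <-]; exists (fun k => f (c k)) => [k|]; first by exists (c k).
  by rewrite rmorph_sum; apply: eq_bigr => k _; exact: rmorphM.
- by move=> c [c' hc <-]; rewrite -fb (ls_sym LS).
- by move=> a [a' ha <-]; exists (fbar S a') => //; exact: (ls_bar LS).
- by exists (flam S) => //; exact: (ls_lam LS).
Qed.
End Image.

(** * Relative commutators *)

Section FormIdeal.
Variables (R : nzRingType) (S : form_ring R) (I G : R -> Prop).
Local Notation bar := (fbar S).
Local Notation lam := (flam S).
Hypothesis hI : form_ideal bar lam (fLam S) I G.

Lemma fi_0 : I 0. Proof. by case: hI => [[[]]]. Qed.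
Lemma fi_D x y : I x -> I y -> I (x + y).
Proof. by case: hI => [[[_ [h _]] _] _]; exact: h. Qed.
Lemma fi_N x : I x -> I (- x).
Proof. by case: hI => [[[_ [_ h]] _] _]; exact: h. Qed.
Lemma fi_B x y : I x -> I y -> I (x - y).
Proof. by move=> hx /fi_N; exact: fi_D. Qed.
Lemma fi_l r x : I x -> I (r * x).
Proof. by case: hI => [[_ [h _]] _]; exact: h. Qed.
Lemma fi_r r x : I x -> I (x * r).
Proof. by case: hI => [[_ [_ h]] _]; exact: h. Qed.
Lemma fi_bar x : I x -> I (bar x).
Proof. by case: hI => _ [h _] hx; apply/h; exists x. Qed.
Lemma fi_sum (J : finType) (P : pred J) (F : J -> R) :
  (forall j, P j -> I (F j)) -> I (\sum_(j | P j) F j).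
Proof. by move=> h; apply: big_ind => //; [exact: fi_0|exact: fi_D]. Qed.

Lemma fg_0 : G 0. Proof. by case: hI => _ [_ [[]]]. Qed.
Lemma fg_D x y : G x -> G y -> G (x + y).
Proof. by case: hI => _ [_ [[_ [h _]] _]]; exact: h. Qed.
Lemma fg_N x : G x -> G (- x).
Proof. by case: hI => _ [_ [[_ [_ h]] _]]; exact: h. Qed.
Lemma fg_Lam x : G x -> fLam S x.
Proof. by case: hI => _ [_ [_ [_ [_ [h _]]]]] /h []. Qed.
Lemma fg_conj r x : G x -> G (r * x * bar r).
Proof. by case: hI => _ [_ [_ [_ [_ [_ h]]]]]; exact: h. Qed.
Lemma fg_min x : I x -> G (x - lam * bar x).
Proof.
case: hI => _ [_ [_ [_ [h _]]]] hx; apply: h; exists x, 0; split=> //.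
by rewrite addr0; split=> //; exact: gen_add0.
Qed.
Lemma fg_conj_Lam z a : I z -> fLam S a -> G (z * a * bar z).
Proof.
case: hI => _ [_ [_ [_ [h _]]]] hz ha; apply: h; exists 0, (z * a * bar z).
rewrite bar0 mulr0 subr0 add0r; split; first exact: fi_0.
by split=> //; apply: gen_addS; exists z, a.
Qed.

(* [dbl] is the fibre product of two copies of [R] over [R / I]; membership of a pair of matrices
   in its elementary group encodes that they agree modulo [EU(I, G)]. *)
Definition dbl_pred (h : form_ideal bar lam (fLam S) I G) : pred (R * R) :=
  fun x => boolp.asbool (I (x.1 - x.2)).

Lemma dbl_predP x : reflect (I (x.1 - x.2)) (x \in dbl_pred hI).
Proof. exact: boolp.asboolP. Qed.

Fact dbl_subring : subring_closed (dbl_pred hI).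
Proof.
split=> [|x y /dbl_predP hx /dbl_predP hy|x y /dbl_predP hx /dbl_predP hy]; apply/dbl_predP => /=.
- by rewrite subrr; exact: fi_0.
- have -> : x.1 - y.1 - (x.2 - y.2) = (x.1 - x.2) - (y.1 - y.2) by abel.
  exact: fi_B.
- have -> : x.1 * y.1 - x.2 * y.2 = (x.1 - x.2) * y.1 + x.2 * (y.1 - y.2) by ncring.
  by apply: fi_D; [exact: fi_r|exact: fi_l].
Qed.

HB.instance Definition _ := GRing.isSubringClosed.Build (R * R)%type (dbl_pred hI) dbl_subring.

Record dbl := Dbl { dval :> R * R; _ : dval \in dbl_pred hI }.
HB.instance Definition _ := [isSub for dval].
HB.instance Definition _ := [Choice of dbl by <:].
HB.instance Definition _ := [SubChoice_isSubNzRing of dbl by <:].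

Definition dp1 : {rmorphism dbl -> R} := fst \o \val.
Definition dp2 : {rmorphism dbl -> R} := snd \o \val.

Definition dbl_mk x y (h : I (x - y)) : dbl := Dbl (introT (dbl_predP (x, y)) h).

Lemma dp1_mk x y (h : I (x - y)) : dp1 (dbl_mk h) = x. Proof. by []. Qed.
Lemma dp2_mk x y (h : I (x - y)) : dp2 (dbl_mk h) = y. Proof. by []. Qed.
Lemma dpI d : I (dp1 d - dp2 d). Proof. by case: d => x hx; exact: (dbl_predP x hx). Qed.
Lemma dbl_eq d d' : dp1 d = dp1 d' -> dp2 d = dp2 d' -> d = d'.
Proof.
case: d d' => [[x y] h] [[x' y'] h'] e1 e2; apply: val_inj => /=.
by move: e1 e2; rewrite /dp1 /dp2 /= => -> ->.
Qed.

Lemma dbl_bar_subproof d : I (bar (dp1 d) - bar (dp2 d)).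
Proof. by rewrite -barB; exact/fi_bar/dpI. Qed.
Definition dbl_bar d := dbl_mk (dbl_bar_subproof d).
Lemma dp1_bar d : dp1 (dbl_bar d) = bar (dp1 d). Proof. by []. Qed.
Lemma dp2_bar d : dp2 (dbl_bar d) = bar (dp2 d). Proof. by []. Qed.
Lemma dbl_lam_subproof : I (lam - lam). Proof. by rewrite subrr; exact: fi_0. Qed.
Definition dbl_lam := dbl_mk dbl_lam_subproof.
(** Pairs agreeing modulo Gamma, not merely modulo [I]: the two projections of a long root element
    then differ by a generator of EU(I, Gamma). *)
Definition dbl_Lam d : Prop := [/\ fLam S (dp1 d), fLam S (dp2 d) & G (dp1 d - dp2 d)].

Lemma dbl_barP : is_involution dbl_bar.
Proof.
split=> [x y|].
  by apply: dbl_eq; rewrite rmorphD ?dp1_bar ?dp2_bar rmorphD barD.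
split=> [x y|x]; last by apply: dbl_eq; rewrite ?dp1_bar ?dp2_bar barK.
by apply: dbl_eq; rewrite rmorphM ?dp1_bar ?dp2_bar rmorphM barM.
Qed.
Lemma dbl_lam_central : central dbl_lam.
Proof. by move=> x; apply: dbl_eq; rewrite !rmorphM; exact: lamC. Qed.
Lemma dbl_lamU : dbl_lam * dbl_bar dbl_lam = 1.
Proof. by apply: dbl_eq; rewrite !(rmorphM, rmorph1); exact: lam_li. Qed.

(** With r1 = z + r2 the cross terms are x - lam bar x for x = z a bar r2, because a = - lam bar a;
    the remaining term is z a bar z. Both lie in Gamma. *)
Lemma conj_diff r1 r2 a : I (r1 - r2) -> fLam S a -> G (r1 * a * bar r1 - r2 * a * bar r2).
Proof.
set z := r1 - r2 => hz ha; have e : r1 = z + r2 by rewrite subrK.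
have := fg_D (fg_min (fi_r (bar r2) (fi_r a hz))) (fg_conj_Lam hz ha); congr G.
clearbody z; rewrite e barD !barM barK.
have -> : lam * (r2 * (bar a * bar z)) = r2 * (lam * bar a) * bar z.
  by rewrite !mulrA lamC.
rewrite -[lam * bar a]opprK -(Lam_skew ha).
ncring.
Qed.

Lemma dbl_LamP : form_parameter dbl_bar dbl_lam dbl_Lam.
Proof.
split; last split; last split.
- split; first by split; rewrite ?rmorph0 ?subrr; [exact: Lam0|exact: Lam0|exact: fg_0].
  split=> [x y [h1 h2 h3] [h4 h5 h6]|x [h1 h2 h3]].
    split; rewrite ?rmorphD; [exact: LamD|exact: LamD|].
    by rewrite opprD addrACA; exact: fg_D.
  split; rewrite ?rmorphN; [exact: LamN|exact: LamN|].
  by rewrite -opprD; exact: fg_N.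
- move=> x; split; rewrite !rmorphB !rmorphM; [exact: Lam_min|exact: Lam_min|].
  rewrite (_ : dp1 dbl_lam = lam) // (_ : dp2 dbl_lam = lam) // dp1_bar dp2_bar.
  have E (a b : R) : a - b - lam * bar (a - b) = a - lam * bar a - (b - lam * bar b).
    by rewrite barB; ncring.
  by have := fg_min (dpI x); rewrite E.
- move=> x [h1 h2 _]; apply: dbl_eq; rewrite rmorphN rmorphM ?dp1_bar ?dp2_bar; exact: Lam_skew.
- move=> r a [h1 h2 h3]; split; rewrite !rmorphM ?dp1_bar ?dp2_bar; [exact: Lam_conj|exact: Lam_conj|].
  have E (x x' b b' c : R) : x * (b - b') * x' + (x * b' * x' - c) = x * b * x' - c by ncring.
  by have := fg_D (fg_conj (dp1 r) h3) (conj_diff (dpI r) h2); rewrite E.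
Qed.

Definition dbl_form : form_ring dbl := FormRing dbl_barP dbl_lam_central dbl_lamU dbl_LamP.

(** [C] is embedded diagonally. The subring consists of the pairs with second component in [A] and
    difference in [J], the ideal of [A] generated by the finitely many given differences and their
    conjugates; [J] is spanned over [C] by the products [gJ]. *)
Lemma dbl_locally_finite : locally_finite S -> locally_finite dbl_form.
Proof.
move=> LF F.
pose zs : seq R := [seq dp1 d - dp2 d | d <- F].
have [C [A [r [g [LS hF]]]]] := LF ([seq dp2 d | d <- F] ++ zs ++ [seq bar z | z <- zs]).
have FO := ls_fin LS.
have [[C0 [CD CN]] [C1 CM]] := fo_C FO.
have [[A0 [AD AN]] [A1 AM]] := fo_A FO.
have CA := fo_CA FO.
pose Z := zs ++ [seq bar z | z <- zs].
have ZA z : z \in Z -> A z by move=> hz; apply: hF; rewrite mem_cat hz orbT.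
have ZI z : z \in Z -> I z.
  have h w : w \in zs -> I w by move=> /mapP [d _ ->]; exact: dpI.
  by rewrite mem_cat => /orP [/h|/mapP [w /h hw ->]] //; exact: fi_bar.
have Zb z : z \in Z -> bar z \in Z.
  rewrite !mem_cat => /orP [hz|/mapP [w hw ->]]; last by rewrite barK hw.
  by rewrite map_f ?orbT.
pose zt (t : 'I_(size Z)) := Z`_t.
have ztZ t : zt t \in Z by exact: mem_nth.
(* the ideal of [A] generated by [Z], with its finite set of [C]-generators *)
pose gJ (t : 'I_r * 'I_(size Z) * 'I_r) := g t.1.1 * zt t.1.2 * g t.2.
pose J x := exists2 c : 'I_r * 'I_(size Z) * 'I_r -> R, (forall t, C (c t)) & x = \sum_t c t * gJ t.
have J0 : J 0 by exists (fun=> 0) => //; rewrite big1 // => t _; rewrite mul0r.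
have JD x y : J x -> J y -> J (x + y).
  move=> [c hc ->] [d hd ->]; exists (fun t => c t + d t) => [t|]; first exact: CD.
  by rewrite -big_split; apply: eq_bigr => t _; rewrite mulrDl.
have JC e x : C e -> J x -> J (e * x).
  move=> he [c hc ->]; exists (fun t => e * c t) => [t|]; first exact: CM.
  by rewrite mulr_sumr; apply: eq_bigr => t _; rewrite mulrA.
have Jsum (T : finType) (f : T -> R) : (forall t, J (f t)) -> J (\sum_t f t).
  by move=> h; apply: big_ind.
have Jgen t : J (gJ t).
  exists (fun t' => (t' == t)%:R) => [t'|]; first by case: eqP.
  by rewrite (bigD1 t) //= eqxx mul1r big1 ?addr0 // => t' /negPf ->; rewrite mul0r.
have JA x : J x -> A x.
  move=> [c hc ->]; apply: big_ind => // t _; apply: (AM); first exact: CA.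
  by apply: (AM); [apply: (AM); [exact: (fo_gen FO)|exact: ZA]|exact: (fo_gen FO)].
have JI x : J x -> I x.
  by move=> [c hc ->]; apply: fi_sum => t _; apply/fi_l/fi_r/fi_l/ZI.
have cC c a : C c -> A a -> c * a = a * c by exact: (fo_comm FO).
have Jaza a b t : A a -> A b -> J (a * zt t * b).
  move=> /(fo_span FO) [c hc ->] /(fo_span FO) [d hd ->].
  rewrite !mulr_suml; apply: (Jsum) => k; rewrite mulr_sumr; apply: (Jsum) => l.
  have -> : c k * g k * zt t * (d l * g l) = c k * d l * gJ (k, t, l).
    rewrite /gJ /= -!mulrA; congr (_ * _).
    have e1 := cC _ _ (hd l) (ZA _ (ztZ t)); have e2 := cC _ _ (hd l) (fo_gen FO k).
    by rewrite (mulrA (zt t)) -e1 -mulrA (mulrA (g k)) -e2 -mulrA.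
  by apply: (JC) => //; exact: CM.
have Jl a x : A a -> J x -> J (a * x).
  move=> ha [c hc ->]; rewrite mulr_sumr; apply: (Jsum) => t.
  rewrite mulrA -(cC _ _ (hc t) ha) -mulrA; apply: (JC) => //.
  rewrite /gJ !mulrA; apply: (Jaza); [apply: (AM) => //|]; exact: (fo_gen FO).
have Jr a x : A a -> J x -> J (x * a).
  move=> ha [c hc ->]; rewrite mulr_suml; apply: (Jsum) => t.
  rewrite -mulrA; apply: (JC) => //.
  rewrite /gJ -!mulrA (mulrA (g t.1.1)); apply: (Jaza); [|apply: (AM) => //]; exact: (fo_gen FO).
have JN x : J x -> J (- x) by move=> h; rewrite -mulN1r; apply: (Jl) => //; exact: AN.
have Jz z : z \in Z -> J z.
  move=> hz; have hi : (index z Z < size Z)%N by rewrite index_mem.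
  by have := Jaza 1 1 (Ordinal hi) A1 A1; rewrite mul1r mulr1 /zt /= nth_index.
have Jbar x : J x -> J (bar x).
  move=> [c hc ->]; rewrite bar_sum; apply: (Jsum) => t.
  rewrite barM (ls_sym LS (hc t)); apply: (Jr); first exact: CA.
  rewrite /gJ !barM; have ht := Zb _ (ztZ t.1.2).
  apply: (Jl); first by apply: (ls_bar LS); exact: (fo_gen FO).
  by apply: (Jr); [apply: (ls_bar LS); exact: (fo_gen FO)|exact: Jz].
have diagI c : I (c - c) by rewrite subrr; exact: fi_0.
pose diag c : dbl := dbl_mk (diagI c).
have gJI t : I (gJ t - 0) by rewrite subr0; exact/JI/Jgen.
pose CC d := dp1 d = dp2 d /\ C (dp2 d).
pose AA d := A (dp2 d) /\ J (dp1 d - dp2 d).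
have AA1 d : AA d -> A (dp1 d).
  by move=> [h1 h2]; rewrite -[dp1 d](subrK (dp2 d)); apply: (AD) => //; exact: JA.
pose gg (t : 'I_r + 'I_r * 'I_(size Z) * 'I_r) : dbl :=
  match t with inl k => diag (g k) | inr t => dbl_mk (gJI t) end.
exists CC, AA, _, (fun i : 'I_#|{: 'I_r + 'I_r * 'I_(size Z) * 'I_r}| => gg (enum_val i)).
split; last first.
  move=> d hd; split; first by apply: hF; rewrite mem_cat map_f.
  by apply: Jz; rewrite mem_cat /zs (map_f (fun d => dp1 d - dp2 d)).
split.
- apply: finite_over_fin.
  + split; first split; [by split; rewrite ?rmorph0|split|split; first by split; rewrite ?rmorph1].
    * by move=> x y [e1 h1] [e2 h2]; split; rewrite !rmorphD ?e1 ?e2 //; exact: CD.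
    * by move=> x [e1 h1]; split; rewrite !rmorphN ?e1 //; exact: CN.
    * by move=> x y [e1 h1] [e2 h2]; split; rewrite !rmorphM ?e1 ?e2 //; exact: CM.
  + split; first split; [by split; rewrite ?rmorph0 ?subrr|split|split; first by split; rewrite ?rmorph1 ?subrr].
    * move=> x y [h1 h2] [h3 h4]; split; rewrite !rmorphD; first exact: AD.
      by rewrite opprD addrACA; exact: JD.
    * by move=> x [h1 h2]; split; rewrite !rmorphN; [exact: AN|rewrite -opprD; exact: JN].
    * move=> x y [h1 h2] [h3 h4]; split; rewrite !rmorphM; first exact: AM.
      have -> : dp1 x * dp1 y - dp2 x * dp2 y =
        (dp1 x - dp2 x) * dp1 y + dp2 x * (dp1 y - dp2 y) by ncring.
      by apply: (JD); [apply: (Jr) => //; exact: AA1|exact: Jl].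
  + by move=> c [e h]; split; [exact: CA|rewrite e subrr].
  + move=> c a [e h] ha; apply: dbl_eq; rewrite !rmorphM ?e; apply: cC => //; first exact: AA1.
    by case: ha.
  + case=> [k|t]; split; rewrite ?dp1_mk ?dp2_mk ?subrr //; first exact: (fo_gen FO).
    by rewrite subr0; exact: Jgen.
  + move=> a [/(fo_span FO) [c hc ec] [d hd ed]].
    exists (fun t => match t with inl k => diag (c k) | inr t => diag (d t) end).
      by case=> t; split; rewrite ?dp1_mk ?dp2_mk.
    rewrite big_sumType /=.
    have E1 k : dp1 (diag (c k) * diag (g k)) = c k * g k by rewrite rmorphM.
    have E2 k : dp2 (diag (c k) * diag (g k)) = c k * g k by rewrite rmorphM.
    have E3 t : dp1 (diag (d t) * dbl_mk (gJI t)) = d t * gJ t by rewrite rmorphM.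
    have E4 t : dp2 (diag (d t) * dbl_mk (gJI t)) = 0 by rewrite rmorphM mulr0.
    apply: dbl_eq; rewrite rmorphD !rmorph_sum.
      rewrite (eq_bigr _ (fun k _ => E1 k)) (eq_bigr _ (fun t _ => E3 t)).
      by rewrite -[LHS](subrK (dp2 a)) ed ec addrC.
    by rewrite (eq_bigr _ (fun k _ => E2 k)) (eq_bigr _ (fun t _ => E4 t)) big1_eq addr0.
- by move=> c [e h]; apply: dbl_eq; rewrite ?dp1_mk ?dp2_mk ?e (ls_sym LS).
- move=> a [h1 h2]; split; rewrite ?dp1_mk ?dp2_mk; first exact: (ls_bar LS).
  by rewrite -barB; exact: Jbar.
- by split; rewrite ?dp1_mk ?dp2_mk ?subrr //; exact: (ls_lam LS).
Qed.

End FormIdeal.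

(** * Morphisms of form rings and lifting of elementary matrices *)

Section FormMorphism.
Variables (T R : nzRingType) (D : form_ring T) (S : form_ring R) (n : nat).

Definition form_morphism (f : {rmorphism T -> R}) : Prop :=
  [/\ forall x, f (fbar D x) = fbar S (f x), f (flam D) = flam S &
      forall a, fLam D a -> fLam S (f a)].

Section One.
Variable f : {rmorphism T -> R}.
Hypothesis hf : form_morphism f.
Local Notation mf := (map_mx f).

Lemma map_adj a b (A : 'M_(a, b)) : mf (adj D A) = adj S (mf A).
Proof. by case: hf => h _ _; apply/matrixP => i j; rewrite !mxE h. Qed.
Lemma map_Fmx : mf (Fmx T n) = Fmx R n.
Proof. by apply/matrixP => i j; rewrite !mxE rmorph_nat. Qed.
Lemma map_Jmx : mf (Jmx D n) = Jmx S n.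
Proof. by case: hf => _ h _; rewrite /Jmx map_mxD map_mxZ map_adj map_Fmx h. Qed.
Lemma map_ff (u v : 'cV_(n + n)) : mf (ff D u v) = ff S (mf u) (mf v).
Proof. by rewrite !ffdef !map_mxM map_adj map_Fmx. Qed.
Lemma map_star (u : 'cV_(n + n)) : mf (star D u) = star S (mf u).
Proof. by rewrite !stardef map_mxM map_adj map_Jmx. Qed.
Lemma map_ee p : mf (@ee T n p) = ee R p.
Proof. exact: map_delta_mx. Qed.
Lemma map_li : f (fbar D (flam D)) = fbar S (flam S).
Proof. by case: hf => h1 h2 _; rewrite h1 h2. Qed.
Lemma map_trv (u v : 'cV_(n + n)) a : mf (trv D u v a) = trv S (mf u) (mf v) (mf a).
Proof.
by rewrite !trvdef map_mxD map_mxB map_mxD map_mx1 map_mxZ !map_mxM !map_star map_li.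
Qed.
Lemma map_long p al : mf (trv D (ee T p) 0 (- (fbar D (flam D) *: al))) =
  trv S (@ee R n p) 0 (- (fbar S (flam S) *: mf al)).
Proof. by rewrite map_trv map_ee map_mx0 map_mxN map_mxZ map_li. Qed.
Lemma map_short p q x : mf (trv D (ee T p) (ee T q *m x) 0) =
  trv S (@ee R n p) (ee R q *m mf x) 0.
Proof. by rewrite map_trv map_mxM !map_ee map_mx0. Qed.
Lemma map_inv2 m (a b : 'M_m) : inv2 a b -> inv2 (mf a) (mf b).
Proof. by move=> [h1 h2]; split; rewrite -map_mxM ?h1 ?h2 map_mx1. Qed.
Lemma map_Lam1 a : Lam1 D a -> Lam1 S (mf a).
Proof. by case: hf => _ _ h; rewrite /Lam1 mxE; exact: h. Qed.
Lemma map_phi s (u : 'cV_(n + n)) : mf (phi D s u) = phi S (mf s) (mf u).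
Proof. by rewrite /phi map_mxB !map_ff !map_mxM. Qed.

Lemma map_unitary s : (forall x, exists t, f t = x) -> unitary D (n := n) s -> unitary S (mf s).
Proof.
move=> surj /unitaryP [[t ht] Js Ps]; apply/unitaryP; split.
- by exists (mf t); exact: map_inv2.
- by rewrite -map_adj -map_Jmx -!map_mxM Js.
- move=> u; have [v hv] := boolp.choice (fun p => surj (u p 0)).
  have -> : u = mf (\col_p v p) by apply/matrixP => i j; rewrite ord1 !mxE hv.
  by rewrite -map_phi; exact: map_Lam1.
Qed.
End One.

(* With [f1 = f2] this lifts along a quotient map, with the two projections of a fibre
   product it lifts to the diagonal. *)
Lemma EU_lift (f1 f2 : {rmorphism T -> R}) e : form_morphism f1 -> form_morphism f2 ->
  (forall x, exists t, f1 t = x /\ f2 t = x) ->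
  (forall a, fLam S a -> exists t, [/\ fLam D t, f1 t = a & f2 t = a]) ->
  EU (fbar S) (flam S) (fLam S) (n := n) e ->
  exists e1, [/\ EU (fbar D) (flam D) (fLam D) e1, map_mx f1 e1 = e & map_mx f2 e1 = e].
Proof.
move=> m1 m2 h1 h2.
have lift1 (x : 'M[R]_1) y : x 0 0 = y -> x = y%:M by move=> <-; rewrite -mx11_scalar.
apply: (EU_min (P := fun e => exists e1, [/\ EU (fbar D) (flam D) (fLam D) e1,
  map_mx f1 e1 = e & map_mx f2 e1 = e])).
- split; first by exists 1%:M; rewrite !map_mx1; split=> //; exact: EU1.
  split=> [a b [a1 [ha ea ea']] [b1 [hb eb eb']]|a [a1 [ha ea ea']]].
    by exists (a1 *m b1); rewrite !map_mxM ea ea' eb eb'; split=> //; exact: EUM.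
  have [b hb hab] := EU_inv ha; exists (map_mx f1 b).
  have i1 := map_inv2 f1 hab; have i2 := map_inv2 f2 hab; rewrite ea in i1; rewrite ea' in i2.
  split; last by case: i1.
  by exists b; rewrite (inv2_uniq i1 i2).
- move=> p q x hp hq; have [t [e1 e2]] := h1 (x 0 0).
  exists (trv D (ee T p) (ee T q *m t%:M) 0).
  rewrite !(map_short m1, map_short m2) !map_scalar_mx e1 e2 -mx11_scalar; split=> //.
  exact: EU_short.
- move=> p al hal; have [t [ht e1 e2]] := h2 _ hal.
  exists (trv D (ee T p) 0 (- (fbar D (flam D) *: t%:M))).
  rewrite !(map_long m1, map_long m2) !map_scalar_mx e1 e2 -mx11_scalar; split=> //.
  by apply: EU_long; rewrite /Lam1 scal11.
Qed.
End FormMorphism.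

(** * Commutators of short root elements *)

Section Commutators.
Variables (R : nzRingType) (S : form_ring R) (n : nat).
Local Notation bar := (fbar S).
Local Notation ee := (@ee R n).
Local Notation mu := (@mu R S n).
Local Notation EU := (@EU R bar (flam S) n (fLam S)).
Local Notation trv := (trv S).
Local Notation star := (star S).
Implicit Types (p q l : 'I_(n + n)) (x r : 'M[R]_1).

Lemma trv_comm (t t' : 'M[R]_(n + n)) u v : unitary S t -> inv2 t t' -> t *m u = u ->
  star u *m u = 0 -> star u *m v = 0 -> star (t *m v) *m v = 0 ->
  t *m trv u v 0 *m t' *m trv u (- v) 0 = trv u (t *m v - v) 0.
Proof.
move=> ht tt tu uu uv tv; rewrite trv_conj //; last exact: unitary_J.
rewrite tu trv_mul ?mulmxN ?uv ?oppr0 //; last by rewrite -{1}tu unitary_star.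
by rewrite tv oppr0 scaler0 subr0 addr0.
Qed.

(** [t] fixes e_p and sends e_l to e_l + e_q r, so only the direction e_q r x survives: the
    Chevalley commutator relation for short roots. *)
Lemma short_commutator p l q r x : l != p -> l != rev_ord p -> q != p -> q != rev_ord p ->
  l != q -> l != rev_ord q -> exists y : 'M_1, let t := trv (ee q) (ee (rev_ord l) *m y) 0 in
  let t' := trv (ee q) (ee (rev_ord l) *m - y) 0 in [/\ EU t, inv2 t t' &
  t *m trv (ee p) (ee l *m x) 0 *m t' *m trv (ee p) (ee l *m - x) 0 =
  trv (ee p) (ee q *m (r *m x)) 0].
Proof.
move=> lp lp' qp qp' lq lq'.
set y := adj S (r *m (bar (mu (rev_ord l)))%:M); exists y.
set t := trv (ee q) (ee (rev_ord l) *m y) 0; set t' := trv _ _ _.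
have ht : EU t by apply: EU_short; idx.
have it : inv2 t t' by apply: short_inv; idx.
split=> //.
have tl : t *m ee l = ee l + ee q *m r.
  rewrite /t trvE star_ee_ee ?mulmx0 ?scaler0 ?subr0 ?addr0; last by idx.
  rewrite starM -(mulmxA (adj S y)).
  have := star_ee_rev S (rev_ord l); rewrite rev_ordK => ->; rewrite /y adjK.
  by rewrite -mulmxA -scalar_mxM muVl mulmx1.
have tp : t *m ee p = ee p.
  rewrite /t trvE star_ee_ee ?mulmx0 ?scaler0 ?subr0 ?addr0; last by idx.
  rewrite starM -(mulmxA (adj S y)) star_ee_ee ?mulmx0 ?addr0 //; by idx.
have ll : star (ee l) *m ee l = 0 by exact/iso_star/iso_ee.
have ql : star (ee q) *m ee l = 0 by apply: star_ee_ee; idx.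
rewrite mulmxN trv_comm //; first last.
- rewrite (mulmxA t) tl mulmxDl starD !starM mulmxDl -!mulmxA (mulmxA (star _)) ll.
  by rewrite (mulmxA (star (ee q))) ql !mul0mx !mulmx0 addr0.
- exact: star_ee_eex.
- exact/iso_star/iso_ee.
- exact: EU_unitary.
by rewrite (mulmxA t) tl mulmxDl addrAC subrr add0r mulmxA.
Qed.
End Commutators.

(** * Congruence subgroups and the relative commutator formula *)

Section Relative.
Variables (R : nzRingType) (S : form_ring R) (n : nat) (I G : R -> Prop).
Local Notation bar := (fbar S).
Local Notation lam := (flam S).
Local Notation li := (fbar S (flam S)).
Local Notation N := (n + n)%N.
Local Notation eD := (@ee _ n).
Local Notation trvD D' := (@trv _ D' n).
Local Notation ee := (@ee R n).
Local Notation mu := (@mu R S n).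
Local Notation EU := (@EU R bar lam n (fLam S)).
Local Notation ER := (@EU_rel R bar lam n (fLam S) I G).
Local Notation UR := (@U_rel R bar lam n (fLam S) I G).
Local Notation trv := (trv S).
Local Notation star := (star S).
Implicit Types (s t e : 'M[R]_N) (p q : 'I_N).
Hypothesis hI : form_ideal bar lam (fLam S) I G.

Lemma EU_normalized : normalized_by EU EU.
Proof. by move=> e e' g he h1 h2 hg; apply: EUM; [exact: EUM|exact: EUV he (conj h1 h2)]. Qed.

Lemma ER1 : ER 1%:M. Proof. by move=> M []. Qed.
Lemma ERM s t : ER s -> ER t -> ER (s *m t).
Proof.
move=> hs ht M hM h1 h2 h3; case: (hM) => _ [h _].
by apply: h; [exact: hs|exact: ht].
Qed.
Lemma ERV s t : ER s -> inv2 s t -> ER t.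
Proof.
move=> hs st M hM h1 h2 h3; case: (hM) => _ [_ h].
have [b [hb [e1 e2]]] := h _ (hs _ hM h1 h2 h3).
by rewrite (inv2_uniq st (conj e1 e2)).
Qed.
Lemma ER_conj e e' s : EU e -> inv2 e e' -> ER s -> ER (e *m s *m e').
Proof.
move=> he [e1 e2] hs M hM h1 h2 h3; apply: (h2) => //.
exact: hs.
Qed.

Lemma ER_short p q (x : 'M_1) : q != p -> q != rev_ord p -> I (x 0 0) ->
  ER (trv (ee p) (ee q *m x) 0).
Proof.
move=> h1 h2 hx M _ _ _; apply; apply/rel_gensP; left; exists p, q, x; split=> //.
by apply: (fi_r hI); exact: (fi_bar hI).
Qed.
Lemma ER_long p (al : 'M_1) : G (al 0 0) -> ER (trv (ee p) 0 (- (li *: al))).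
Proof.
move=> h M _ _ _; apply; apply/rel_gensP; right; exists p, al; split=> //.
exact: (fg_N hI).
Qed.

Definition mem_mx a b (A : 'M[R]_(a, b)) : Prop := forall i j, I (A i j).

Lemma mem_mxD a b (A B : 'M_(a, b)) : mem_mx A -> mem_mx B -> mem_mx (A + B).
Proof. by move=> hA hB i j; rewrite mxE; exact: (fi_D hI). Qed.
Lemma mem_mxN a b (A : 'M_(a, b)) : mem_mx A -> mem_mx (- A).
Proof. by move=> hA i j; rewrite mxE; exact: (fi_N hI). Qed.
Lemma mem_mxMl a b c (A : 'M_(a, b)) (B : 'M_(b, c)) : mem_mx A -> mem_mx (A *m B).
Proof. by move=> hA i j; rewrite mxE; apply: (fi_sum hI) => k _; exact: (fi_r hI). Qed.
Lemma mem_mxMr a b c (A : 'M_(a, b)) (B : 'M_(b, c)) : mem_mx B -> mem_mx (A *m B).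
Proof. by move=> hA i j; rewrite mxE; apply: (fi_sum hI) => k _; exact: (fi_l hI). Qed.
Lemma mem_adj a b (A : 'M_(a, b)) : mem_mx A -> mem_mx (adj S A).
Proof. by move=> hA i j; rewrite mxE; exact: (fi_bar hI). Qed.

Definition G1 (a : 'M[R]_1) := G (a 0 0).
Lemma G1_0 : G1 0. Proof. by rewrite /G1 mxE; exact: (fg_0 hI). Qed.
Lemma G1D a b : G1 a -> G1 b -> G1 (a + b).
Proof. by rewrite /G1 mxE; exact: (fg_D hI). Qed.
Lemma G1N a : G1 a -> G1 (- a).
Proof. by rewrite /G1 mxE; exact: (fg_N hI). Qed.
Lemma G1B a b : G1 a -> G1 b -> G1 (a - b).
Proof. by move=> ha /G1N; exact: G1D. Qed.
Lemma G1_min a : mem_mx a -> G1 (a - lam *: adj S a).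
Proof. by rewrite /G1 !mxE => h; exact: (fg_min hI). Qed.
Lemma G1_conj r a : G1 a -> G1 (adj S r *m a *m r).
Proof.
move=> /(fg_conj hI (bar (r 0 0))); rewrite /G1 !mxE big_ord1 !mxE big_ord1 !mxE barK; exact.
Qed.
Lemma G1_conj_Lam r a : mem_mx r -> Lam1 S a -> G1 (adj S r *m a *m r).
Proof.
move=> hr /(fg_conj_Lam hI (fi_bar hI (hr 0 0))).
by rewrite /G1 !mxE big_ord1 !mxE big_ord1 !mxE barK; exact.
Qed.

(** Polarisation of the defect. Since [s] preserves h, f(su, sv) - f(u, v) is determined by f(sv,
    su) - f(v, u), and the cross term has the shape x - lam bar x. *)
Lemma phiD s u v : unitary S s ->
  phi S s (u + v) = phi S s u + phi S s v +
    (ff S (s *m v) (s *m u) - ff S v u - lam *: adj S (ff S (s *m v) (s *m u) - ff S v u)).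
Proof.
move=> hs; have := unitary_star u v hs.
rewrite !star_ff => /(congr1 (fun x => x - lam *: adj S (ff S (s *m v) (s *m u)) - ff S u v)).
rewrite addrK addrAC [ff S u v + _]addrC addrK => h.
rewrite /phi mulmxDr !ffDl !ffDr adjB scalerBr.
move: h; set A := ff S (s *m u) (s *m v); set A' := ff S (s *m v) (s *m u).
move=> /eqP; rewrite subr_eq => /eqP ->.
abel.
Qed.

(** On a column over [I] the defect is a sum of terms z a bar z with z in [I], a in Lambda, and of
    terms x - lam bar x with x in [I]. *)
Lemma phi_mem s (u : 'cV_N) : unitary S s -> mem_mx u -> G1 (phi S s u).
Proof.
move=> hs hu; suff : mem_mx u /\ G1 (phi S s u) by case.
have one p (x : 'M_1) : mem_mx x -> G1 (phi S s (ee p *m x)).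
  move=> hx; have -> : phi S s (ee p *m x) = adj S x *m phi S s (ee p) *m x.
    by rewrite /phi mulmxA !ffM mulmxBr mulmxBl.
  by apply: G1_conj_Lam => //; exact: unitary_phi.
rewrite (col_sum u); apply: (big_ind (fun u => mem_mx u /\ G1 (phi S s u))) => [|v w [hv gv] [hw gw]|p _].
- by rewrite /phi mulmx0 ff0l subrr; split=> [i j|]; [rewrite mxE; exact: (fi_0 hI)|exact: G1_0].
- split; first exact: mem_mxD.
  rewrite phiD //; apply: G1D; first exact: G1D.
  apply: G1_min; apply: mem_mxD; last apply: mem_mxN; rewrite !ffdef; apply: mem_mxMl;
  by apply: mem_mxMl; apply: mem_adj => //; exact: mem_mxMr.
- have hx : mem_mx ((u p 0)%:M : 'M_1) by move=> i j; rewrite !ord1 scal11.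
  by split; [exact: mem_mxMr|exact: one].
Qed.

Lemma phi_congr s (u v : 'cV_N) : unitary S s -> mem_mx (u - v) -> G1 (phi S s u - phi S s v).
Proof.
move=> hs; set d := u - v => hd; have -> : u = v + d by rewrite addrC subrK.
have h := phi_mem hs hd; rewrite phiD //; clearbody d.
set X := _ - _ *: _; have -> : phi S s v + phi S s d + X - phi S s v = phi S s d + X by abel.
apply: G1D => //; apply: G1_min; apply: mem_mxD; last apply: mem_mxN;
rewrite !ffdef; apply: mem_mxMl; apply: mem_mxMl; apply: mem_adj => //; exact: mem_mxMr.
Qed.

Lemma U_relP s : UR s <->
  [/\ unitary S s, mem_mx (s - 1%:M) & forall u, G1 (phi S s u)].
Proof.
have E u : G1 (phi S s u) = G (fform bar (s *m u) (s *m u) - fform bar u u).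
  by rewrite !fform_ff /G1 /phi !mxE.
split=> [[h1 [h2 h3]]|[h1 h2 h3]]; first by split=> // u; rewrite E.
by split=> //; split=> // u; rewrite -E.
Qed.

Lemma mem_inv s s' : inv2 s s' -> mem_mx (s - 1%:M) -> mem_mx (s' - 1%:M).
Proof.
move=> [h1 h2] h; have -> : s' - 1%:M = - (s' *m (s - 1%:M)) by rewrite mulmxBr h2 mulmx1 opprB.
by apply/mem_mxN/mem_mxMr.
Qed.

Lemma UR_subgroup : is_subgroup UR.
Proof.
split; last split.
- apply/U_relP; split; first exact: unitary1.
    by move=> i j; rewrite subrr mxE; exact: (fi_0 hI).
  by move=> u; rewrite phi1; exact: G1_0.
- move=> a b /U_relP [h1 h2 h3] /U_relP [h4 h5 h6]; apply/U_relP; split.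
  + exact: unitaryM.
  + have -> : a *m b - 1%:M = (a - 1%:M) *m b + (b - 1%:M) by rewrite mulmxBl mul1mx addrA subrK.
    by apply: mem_mxD => //; exact: mem_mxMl.
  + by move=> u; rewrite phiM; exact: G1D.
- move=> a /U_relP [h1 h2 h3]; have [b ab] := unitary_inv2 h1; exists b; split; last by case: ab.
  apply/U_relP; split; [exact: unitaryV ab|exact: mem_inv ab h2|].
  move=> u; have := phiM S a b u; rewrite (proj1 ab) phi1 => /eqP; rewrite eq_sym addr_eq0 => /eqP h.
  by have := G1N (h3 (b *m u)); rewrite h opprK.
Qed.

(** The defects of [t] and [t'] are opposite up to evaluation at congruent columns, where
    [phi_congr] applies. *)
Lemma UR_normal s t t' : unitary S t -> inv2 t t' -> UR s -> UR (t *m s *m t').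
Proof.
move=> ht tt /U_relP [h1 h2 h3]; apply/U_relP; split.
- by apply: unitaryM; [exact: unitaryM|exact: unitaryV tt].
- have -> : t *m s *m t' - 1%:M = t *m (s - 1%:M) *m t'.
    by rewrite mulmxBr mulmx1 mulmxBl (proj1 tt).
  exact/mem_mxMl/mem_mxMr.
- move=> u; rewrite -mulmxA phiM phiM; set w := t' *m u.
  have hw : phi S t' u = - phi S t w.
    have := phiM S t t' u; rewrite (proj1 tt) phi1 => /eqP; rewrite eq_sym addr_eq0 => /eqP ->.
    by rewrite opprK.
  rewrite hw -mulmxA -/w addrCA; apply: G1D => //; apply: phi_congr => //.
  have -> : s *m w - w = (s - 1%:M) *m w by rewrite mulmxBl mul1mx.
  exact: mem_mxMl.
Qed.

Local Notation D := (dbl_form hI).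
Local Notation d1 := (dp1 hI).
Local Notation d2 := (dp2 hI).

Lemma dp1_morph : form_morphism D S d1.
Proof. by split=> // a []. Qed.
Lemma dp2_morph : form_morphism D S d2.
Proof. by split=> // a []. Qed.

Lemma dbl_diag x : I (x - x). Proof. by rewrite subrr; exact: (fi_0 hI). Qed.

Lemma EU_diag e : EU e ->
  exists e1 : 'M_N, [/\ Defs.EU (fbar D) (flam D) (fLam D) e1, map_mx d1 e1 = e & map_mx d2 e1 = e].
Proof.
move=> he; apply: (EU_lift dp1_morph dp2_morph _ _ he) => [x|a ha].
  by exists (dbl_mk hI (dbl_diag x)).
exists (dbl_mk hI (dbl_diag a)); split=> //; split=> //.
by rewrite subrr; exact: (fg_0 hI).
Qed.

Lemma dbl_mx_eq a b (A B : 'M_(a, b)) :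
  map_mx d1 A = map_mx d1 B -> map_mx d2 A = map_mx d2 B -> A = B.
Proof.
move=> /matrixP h1 /matrixP h2; apply/matrixP => i j.
by have := h1 i j; have := h2 i j; rewrite !mxE => e2 e1; exact: dbl_eq.
Qed.

(** The projections of a generator differ by an element of EU(I, Gamma), and this property passes to
    products because EU(I, Gamma) is normalised by EU. *)
Lemma dbl_EU_rel (e f : 'M_N) : Defs.EU (fbar D) (flam D) (fLam D) e -> inv2 e f ->
  ER (map_mx d1 e *m map_mx d2 f).
Proof.
move=> he hf; pose P (e : 'M[dbl hI]_N) := exists f : 'M_N, [/\ inv2 e f, EU (map_mx d1 e) & ER (map_mx d1 e *m map_mx d2 f)].
suff [f' [hf' _ h]] : P e by rewrite (inv2_uniq hf hf').
apply: EU_min he.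
- split; first by exists 1%:M; rewrite !map_mx1 mulmx1; split; [split; rewrite mulmx1|exact: EU1|exact: ER1].
  split=> [a b [a' [ha ea ra]] [b' [hb eb rb]]|a [a' [ha ea ra]]].
    exists (b' *m a'); split; [exact: inv2_mul|rewrite map_mxM; exact: EUM|].
    have := ERM (ER_conj ea (map_inv2 d1 ha) rb) ra; congr ER.
    rewrite !map_mxM -!mulmxA; do 3 congr (_ *m _).
    by rewrite (mulmxA (map_mx d1 a')) (proj2 (map_inv2 d1 ha)) mul1mx.
  have ea' : EU (map_mx d1 a') by exact: EUV (map_inv2 d1 ha).
  exists a'; split; last by case: ha.
  exists a; split=> //; first exact: inv2_sym.
  have i2 : inv2 (map_mx d1 a *m map_mx d2 a') (map_mx d2 a *m map_mx d1 a').
    by apply: inv2_mul; [exact: map_inv2|exact/inv2_sym/map_inv2].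
  have := ER_conj ea' (map_inv2 d1 (inv2_sym ha)) (ERV ra i2); congr ER.
  by rewrite -!mulmxA (proj2 (map_inv2 d1 ha)) mulmx1.
- move=> p q x hp hq; exists (trvD D (eD p) (eD q *m - x) 0); split.
  + exact: short_inv.
  + by rewrite (map_short dp1_morph); exact: EU_short.
  + rewrite (map_short dp1_morph) (map_short dp2_morph) trv_mul; try exact: star_ee_eex; last exact/iso_star/iso_ee.
    rewrite starM -mulmxA (mulmxA (star _)) (iso_star (iso_ee _ _)) mul0mx mulmx0 scaler0 subr0 addr0.
    rewrite -mulmxDr map_mxN; apply: ER_short => //.
    by rewrite !mxE; exact: dpI.
- move=> p al hal; exists (trvD D (eD p) 0 (- (fbar D (flam D) *: - al))); split.
  + exact: long_inv.
  + by rewrite (map_long dp1_morph); apply: EU_long; exact: (map_Lam1 dp1_morph).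
  + rewrite (map_long dp1_morph) (map_long dp2_morph) trv_mul ?mulmx0 //; last exact/iso_star/iso_ee.
    rewrite scaler0 subr0 addr0 -opprD -scalerDr map_mxN; apply: ER_long.
    by rewrite !mxE; case: hal.
Qed.

Hypotheses (hn : (3 <= n)%N) (LF : locally_finite S).

(** The pair (s, 1) is unitary over the fibre product. By normality there, it conjugates the
    diagonal lift of [e] to an elementary matrix, with projections s e s' and [e]. *)
Lemma UR_EU_comm s s' e e' : UR s -> EU e -> inv2 s s' -> inv2 e e' ->
  ER (s *m e *m s' *m e').
Proof.
move=> /U_relP [hs ms ps] he ss ee'.
have ms' := mem_inv ss ms.
have hm i j : I (s i j - (1%:M : 'M[R]_N) i j) by have := ms i j; rewrite !mxE.
have hm' i j : I (s' i j - (1%:M : 'M[R]_N) i j) by have := ms' i j; rewrite !mxE.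
pose t : 'M_N := \matrix_(i, j) dbl_mk hI (hm i j).
pose t' : 'M_N := \matrix_(i, j) dbl_mk hI (hm' i j).
have t1 : map_mx d1 t = s by apply/matrixP => i j; rewrite 2!mxE.
have t2 : map_mx d2 t = 1%:M by apply/matrixP => i j; rewrite 2!mxE.
have t'1 : map_mx d1 t' = s' by apply/matrixP => i j; rewrite 2!mxE.
have t'2 : map_mx d2 t' = 1%:M by apply/matrixP => i j; rewrite 2!mxE.
have tt : inv2 t t'.
  by split; apply: dbl_mx_eq; rewrite map_mxM ?t1 ?t2 ?t'1 ?t'2 map_mx1 ?mulmx1 //; case: ss.
have tU : unitary D t.
  apply/unitaryP; split; first by exists t'.
    apply: dbl_mx_eq; rewrite !map_mxM (map_adj dp1_morph, map_adj dp2_morph).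
      by rewrite t1 (map_Jmx _ dp1_morph); exact: unitary_J.
    by rewrite t2 adj_scalar bar1 mul1mx mulmx1.
  move=> u; split.
  - have := unitary_phi (map_mx d1 u) hs; rewrite -t1 -(map_phi dp1_morph).
    by rewrite /Lam1 mxE.
  - have := phi1 S (map_mx d2 u); rewrite -t2 -(map_phi dp2_morph) => /matrixP /(_ 0 0).
    by rewrite !mxE => ->; exact: Lam0.
  - have := ps (map_mx d1 u); rewrite -t1 -(map_phi dp1_morph) /G1 mxE.
    have := phi1 S (map_mx d2 u); rewrite -t2 -(map_phi dp2_morph) => /matrixP /(_ 0 0).
    by rewrite !mxE => ->; rewrite subr0.
have [f [hf f1 f2]] := EU_diag he; have [f' _ ff'] := EU_inv hf.
have := dbl_EU_rel (EU_normal hn (dbl_locally_finite (hI := hI) LF) tU tt hf) (inv2_conj tt ff').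
rewrite !map_mxM t1 t'1 t2 t'2 f1 mul1mx mulmx1.
by have := map_inv2 d2 ff'; rewrite f2 => /inv2_uniq /(_ ee') ->.
Qed.

Local Notation CU := (@CU_rel R bar lam n (fLam S) I G).

Lemma CU_comm s s' t t' : CU s -> unitary S t -> inv2 s s' -> inv2 t t' ->
  UR (s *m t *m s' *m t').
Proof.
move=> [hs h] ht ss tt; have [x [hx e]] := h _ ht.
have -> : s *m t *m s' *m t' = (t *m s) *m x *m (s' *m t') by rewrite e !mulmxA.
by apply: UR_normal => //; [exact: unitaryM|exact: inv2_mul].
Qed.

(** Conjugation by [s] replaces [a] and [b] by x a and y b with x, y in U(I, Gamma). These commute
    with EU modulo EU(I, Gamma), so the commutator does not change. *)
Lemma CU_EU_commutator s s' a a' b b' : CU s -> EU a -> EU b -> inv2 s s' -> inv2 a a' -> inv2 b b' ->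
  ER (s *m (a *m b *m a' *m b') *m s' *m (b *m a *m b' *m a')).
Proof.
move=> hs ha hb ss aa bb.
have ha1 : EU (s *m a *m s') by apply: (EU_normal hn LF) => //; exact: (proj1 hs).
have hb1 : EU (s *m b *m s') by apply: (EU_normal hn LF) => //; exact: (proj1 hs).
have iA := inv2_conj ss aa; have iB := inv2_conj ss bb.
have e : s *m (a *m b *m a' *m b') *m s' =
  (s *m a *m s') *m (s *m b *m s') *m (s *m a' *m s') *m (s *m b' *m s').
  by rewrite !mulmxA -!(mulmxA _ s' s) (proj2 ss) !mulmx1.
have hx := CU_comm hs (EU_unitary ha) ss aa; have hy := CU_comm hs (EU_unitary hb) ss bb.
have ix : inv2 (s *m a *m s' *m a') (a *m (s *m a' *m s')) by apply: inv2_mul => //; exact: inv2_sym.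
have iy : inv2 (s *m b *m s' *m b') (b *m (s *m b' *m s')) by apply: inv2_mul => //; exact: inv2_sym.
rewrite e; move: ha1 hb1 iA iB hx hy ix iy {e}.
move: (s *m a *m s') (s *m b *m s') (s *m a' *m s') (s *m b' *m s') => A B A' B'.
move=> hA hB iA iB hx hy ix iy.
(* [A, B] [b, a] factors as [x, X] followed by the conjugate by [a] of [y, Y], where x = A a', X = a
   B a', y = B b' and Y = b a' b'. *)
have hX : EU (a *m B *m a') by apply: EUM; [exact: EUM|exact: EUV aa].
have iX : inv2 (a *m B *m a') (a *m B' *m a') by exact: inv2_conj.
have hY : EU (b *m a' *m b').
  by apply: EUM; [apply: EUM => //; exact: EUV aa|exact: EUV bb].
have iY : inv2 (b *m a' *m b') (b *m a *m b') by apply: inv2_conj => //; exact: inv2_sym.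
have h1 := UR_EU_comm hx hX ix iX; have h2 := ER_conj ha aa (UR_EU_comm hy hY iy iY).
have := ERM h1 h2; congr ER; move: iA iB aa bb => [Aa aA] [Bb bB] [aa1 aa2] [bb1 bb2].
have K (u v w : 'M[R]_N) : v *m w = 1%:M -> u *m v *m w = u by move=> h; rewrite -mulmxA h mulmx1.
by rewrite !mulmxA !(K _ _ _ aa1, K _ _ _ aa2, K _ _ _ bb2, K _ _ _ bB).
Qed.

(** A short root element is a commutator of elementary matrices, and a long one is such a commutator
    times a short one; so [CU_EU_commutator] suffices. *)
Lemma CU_EU_comm s s' e e' : CU s -> EU e -> inv2 s s' -> inv2 e e' ->
  ER (s *m e *m s' *m e').
Proof.
move=> hs he ss ee'; pose P e := EU e /\ forall e', inv2 e e' -> ER (s *m e *m s' *m e').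
have PM : is_subgroup P.
  split; last split.
  - split; first exact: EU1.
    by move=> t [+ _]; rewrite mul1mx => ->; rewrite !mulmx1 (proj1 ss); exact: ER1.
  - move=> a b [ha pa] [hb pb]; split; first exact: EUM.
    move=> c hc; have [a' _ aa] := EU_inv ha; have [b' _ bb] := EU_inv hb.
    rewrite (inv2_uniq hc (inv2_mul aa bb)).
    have := ERM (pa _ aa) (ER_conj ha aa (pb _ bb)); congr ER.
    by rewrite !mulmxA -(mulmxA _ a' a) (proj2 aa) mulmx1 -(mulmxA _ s' s) (proj2 ss) mulmx1.
  - move=> a [ha pa]; have [a' ha' aa] := EU_inv ha; exists a'; split; last by case: aa.
    split=> // c hc; rewrite (inv2_uniq hc (inv2_sym aa)).
    have i : inv2 (s *m a *m s' *m a') (a *m (s *m a' *m s')).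
      by apply: inv2_mul; [exact: inv2_conj|exact: inv2_sym].
    have := ER_conj ha' (inv2_sym aa) (ERV (pa _ aa) i); congr ER.
    by rewrite !mulmxA (proj2 aa) mul1mx.
have PC a a' b b' : EU a -> EU b -> inv2 a a' -> inv2 b b' -> P (a *m b *m a' *m b').
  move=> ha hb aa bb; have ha' := EUV ha aa; have hb' := EUV hb bb.
  split; first by do 3 apply: (EUM) => //.
  move=> c hc; have i : inv2 (a *m b *m a' *m b') (b *m a *m b' *m a').
    rewrite -(mulmxA _ b') -(mulmxA (a *m b)); apply: inv2_mul; first exact: inv2_mul.
    by apply: inv2_sym; exact: inv2_mul.
  by rewrite (inv2_uniq hc i); exact: CU_EU_commutator.
have PS p q x : q != p -> q != rev_ord p -> P (trv (ee p) (ee q *m x) 0).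
  move=> h1 h2; have [l [l1 l2 l3 l4]] := exists_index p q hn.
  rewrite -[x]mulmx1; have [y [hT iT <-]] := @short_commutator _ S n p l q x 1%:M l1 l2 h1 h2 l3 l4.
  by apply: PC => //; [exact: EU_short|exact: short_inv].
suff [_ h] : P e by exact: h.
apply: EU_min he => // p al hal.
have [q [q1 q2 _ _]] := exists_index p p hn.
have [g1 g2] : rev_ord q != p /\ rev_ord q != rev_ord p by split; idx.
set g := trv (ee p) (ee (rev_ord q) *m (mu (rev_ord q))%:M) 0.
have [g' eg' ig] := EU_inv (EU_short (S := S) (mu (rev_ord q))%:M g1 g2).
have q3 : p != q by idx.
have q4 : p != rev_ord q by idx.
rewrite (long_from_short (erefl _) hal q3 q4 ig (long_inv S q al)).
apply: (proj1 (proj2 PM)); last exact: PS.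
have i := inv2_sym (long_inv S q al).
by apply: PC => //; [apply: EU_long; exact: Lam1N|exact: EU_short].
Qed.

End Relative.

(** * Quotient form rings *)

Section QuotientRing.
Variables (R : nzRingType) (I : R -> Prop).
Hypothesis hI : two_sided_ideal I /\ ~ I 1.

Let I0 : I 0. Proof. by case: hI => [[[]]]. Qed.
Let ID x y : I x -> I y -> I (x + y). Proof. by case: hI => [[[_ [h _]] _] _]; exact: h. Qed.
Let IN x : I x -> I (- x). Proof. by case: hI => [[[_ [_ h]] _] _]; exact: h. Qed.
Let Il r x : I x -> I (r * x). Proof. by case: hI => [[_ [h _]] _]; exact: h. Qed.
Let Ir r x : I x -> I (x * r). Proof. by case: hI => [[_ [_ h]] _]; exact: h. Qed.

(** A chosen representative of the class of [x]; the quotient is the type of elements equal to their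
    representative. *)
Definition quo_repr (h : two_sided_ideal I /\ ~ I 1) (x : R) : R :=
  choose (fun y => boolp.asbool (I (x - y))) x.

Local Notation rep := (quo_repr hI).

Let rep_mem x : I (x - rep x).
Proof.
have h : boolp.asbool (I (x - x)) by apply/boolp.asboolP; rewrite subrr.
exact: (elimT (boolp.asboolP _) (@chooseP _ (fun y => boolp.asbool (I (x - y))) x h)).
Qed.

Let rep_eq x y : I (x - y) -> rep x = rep y.
Proof.
move=> hxy; rewrite /quo_repr; pose Q z := boolp.asbool (I (y - z)).
have e : choose Q x = choose Q y.
  by apply: choose_id; apply/boolp.asboolP; [rewrite -opprB; exact: (IN)|rewrite subrr].
rewrite -/Q -e; apply: eq_choose => z; apply/boolp.asboolP/boolp.asboolP => h.
  have -> : y - z = - (x - y) + (x - z) by abel.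
  by apply: (ID) => //; exact: (IN).
have -> : x - z = (x - y) + (y - z) by abel.
exact: (ID).
Qed.

Record quo := Quo { qval :> R; _ : rep qval == qval }.
HB.instance Definition _ := [isSub for qval].
HB.instance Definition _ := [Choice of quo by <:].

Fact pi_subproof x : rep (rep x) == rep x.
Proof. by apply/eqP/rep_eq; rewrite -opprB; exact/IN/rep_mem. Qed.
Definition qpi x : quo := Quo (pi_subproof x).

Lemma qpi_eq x y : qpi x = qpi y <-> I (x - y).
Proof.
split=> [/(congr1 qval) /= h|h]; last by apply: val_inj; exact: rep_eq.
have -> : x - y = (x - rep x) - (y - rep y) by rewrite h; abel.
by apply: (ID) => //; exact: (IN).
Qed.

Lemma qpi_val a : qpi (qval a) = a.
Proof. by case: a => x hx; apply: val_inj; exact/eqP. Qed.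

Let qadd a b := qpi (qval a + qval b).
Let qopp a := qpi (- qval a).
Let qmul a b := qpi (qval a * qval b).

Let rep_mem' x : I (qval (qpi x) - x).
Proof. by rewrite -opprB; exact/IN/rep_mem. Qed.

Let qaddE x y : qadd (qpi x) (qpi y) = qpi (x + y).
Proof. by apply/qpi_eq; rewrite opprD addrACA; apply: (ID). Qed.
Let qoppE x : qopp (qpi x) = qpi (- x).
Proof. by apply/qpi_eq; rewrite opprK addrC. Qed.
Let qmulE x y : qmul (qpi x) (qpi y) = qpi (x * y).
Proof.
apply/qpi_eq; move: (rep_mem' x) (rep_mem' y).
move: (qval (qpi x)) (qval (qpi y)) => x' y' h1 h2.
have -> : x' * y' - x * y = (x' - x) * y' + x * (y' - y) by ncring.
by apply: (ID); [exact: (Ir)|exact: (Il)].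
Qed.

Let qaddA : associative qadd.
Proof. by move=> a b c; rewrite -(qpi_val a) -(qpi_val b) -(qpi_val c) !qaddE addrA. Qed.
Let qaddC : commutative qadd.
Proof. by move=> a b; rewrite -(qpi_val a) -(qpi_val b) !qaddE addrC. Qed.
Let qadd0 : left_id (qpi 0) qadd.
Proof. by move=> a; rewrite -(qpi_val a) !qaddE add0r. Qed.
Let qaddN : left_inverse (qpi 0) qopp qadd.
Proof. by move=> a; rewrite -(qpi_val a) qoppE !qaddE addNr. Qed.

HB.instance Definition _ := GRing.isZmodule.Build quo qaddA qaddC qadd0 qaddN.

Let qmulA : associative qmul.
Proof. by move=> a b c; rewrite -(qpi_val a) -(qpi_val b) -(qpi_val c) !qmulE mulrA. Qed.
Let qmul1 : left_id (qpi 1) qmul.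
Proof. by move=> a; rewrite -(qpi_val a) !qmulE mul1r. Qed.
Let qmulr1 : right_id (qpi 1) qmul.
Proof. by move=> a; rewrite -(qpi_val a) !qmulE mulr1. Qed.
Let qmulDl : left_distributive qmul qadd.
Proof.
by move=> a b c; rewrite -(qpi_val a) -(qpi_val b) -(qpi_val c) !(qmulE, qaddE) mulrDl.
Qed.
Let qmulDr : right_distributive qmul qadd.
Proof.
by move=> a b c; rewrite -(qpi_val a) -(qpi_val b) -(qpi_val c) !(qmulE, qaddE) mulrDr.
Qed.
Let q1neq0 : qpi 1 != qpi 0.
Proof. by apply/eqP => /qpi_eq; rewrite subr0; case: hI. Qed.

HB.instance Definition _ := GRing.Zmodule_isNzRing.Build quo qmulA qmul1 qmulr1 qmulDl qmulDr q1neq0.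

Fact qpi_additive : zmod_morphism qpi.
Proof. by move=> x y; rewrite -[qpi x - _]/(qadd (qpi x) (qopp (qpi y))) qoppE qaddE. Qed.
HB.instance Definition _ := GRing.isZmodMorphism.Build R quo qpi qpi_additive.
Fact qpi_multiplicative : monoid_morphism qpi.
Proof. by split=> // x y; rewrite -[RHS]/(qmul (qpi x) (qpi y)) qmulE. Qed.
HB.instance Definition _ := GRing.isMonoidMorphism.Build R quo qpi qpi_multiplicative.

End QuotientRing.

(** Lambda of the quotient is the image of Lambda. The equation [f x = a] is doubled to match
    [EU_lift] with both morphisms equal to [f]. *)
Lemma quotient_form_ring (R : nzRingType) (S : form_ring R) (I G : R -> Prop) :
  form_ideal (fbar S) (flam S) (fLam S) I G -> ~ I 1 ->
  exists (Q : nzRingType) (T : form_ring Q) (f : {rmorphism R -> Q}),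
  [/\ form_morphism S T f, forall y, exists x, f x = y,
      forall a, fLam T a -> exists x, [/\ fLam S x, f x = a & f x = a] &
      forall x, f x = 0 <-> I x].
Proof.
move=> hI h1; have h : two_sided_ideal I /\ ~ I 1 by case: hI.
pose f : {rmorphism R -> quo h} := qpi h.
have surj y : exists x, f x = y by exists (qval y); exact: qpi_val.
have ker x : f x = 0 <-> I x.
  by rewrite -(rmorph0 f) -[I x]/(I x); split=> [/qpi_eq|hx]; last apply/qpi_eq; rewrite subr0.
have feq x y : f x = f y <-> I (x - y) by exact: qpi_eq.
pose qb (y : quo h) : quo h := f (fbar S (qval y)).
have fb x : qb (f x) = f (fbar S x).
  by apply/feq; rewrite -barB; apply: (fi_bar hI); apply/feq; exact: qpi_val.
pose Lq y := exists2 x, fLam S x & f x = y.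
have qbP : is_involution qb.
  split=> [y z|].
    have [x <-] := surj y; have [x' <-] := surj z.
    by rewrite -rmorphD !fb barD rmorphD.
  split=> [y z|y].
    have [x <-] := surj y; have [x' <-] := surj z.
    by rewrite -rmorphM !fb barM rmorphM.
  by have [x <-] := surj y; rewrite !fb barK.
have lc : central (f (flam S)).
  by move=> y; have [x <-] := surj y; rewrite -!rmorphM lamC.
have lu : f (flam S) * qb (f (flam S)) = 1 by rewrite fb -rmorphM lam_li rmorph1.
have lp : form_parameter qb (f (flam S)) Lq.
  split; last split; last split.
  - split; first by exists 0; [exact: Lam0|rewrite rmorph0].
    split=> [y z [x hx <-] [x' hx' <-]|y [x hx <-]].
      by exists (x + x'); [exact: LamD|rewrite rmorphD].
    by exists (- x); [exact: LamN|rewrite rmorphN].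
  - move=> y; have [x <-] := surj y; exists (x - flam S * fbar S x); first exact: Lam_min.
    by rewrite rmorphB rmorphM fb.
  - by move=> y [x hx <-]; rewrite fb {1}(Lam_skew hx) rmorphN rmorphM.
  - move=> y z [x hx <-]; have [x' <-] := surj y; exists (x' * x * fbar S x'); first exact: Lam_conj.
    by rewrite !rmorphM fb.
exists (quo h), (FormRing qbP lc lu lp), f; split=> //.
- by split=> // a ha; exists a.
- by move=> a [x hx <-]; exists x.
Qed.

(** * Subgroups without short root elements *)

Section NoShort.
Variables (R : nzRingType) (S : form_ring R) (n : nat).
Local Notation bar := (fbar S).
Local Notation lam := (flam S).
Local Notation li := (fbar S (flam S)).
Local Notation N := (n + n)%N.
Local Notation col := 'cV[R]_N.
Local Notation ee := (@ee R n).
Local Notation mu := (@mu R S n).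
Local Notation EU := (@EU R bar lam n (fLam S)).
Local Notation trv := (trv S).
Local Notation star := (star S).
Implicit Types (u v w : col) (p q i j k l : 'I_N) (x y z : 'M[R]_1).

Lemma mul_mu_eq0 p (x : R) : mu p * x = 0 -> x = 0.
Proof. by move=> h; rewrite -[x]mul1r -(muVl S p) -mulrA h mulr0. Qed.
Lemma mul_barmu_eq0 p (x : R) : bar (mu p) * x = 0 -> x = 0.
Proof. by move=> h; rewrite -[x]mul1r -(muV S p) -mulrA h mulr0. Qed.

Lemma colDE v w p : (v + w) p 0 = v p 0 + w p 0.
Proof. by rewrite mxE. Qed.
Lemma colBZE v w c p : (v - c *: w) p 0 = v p 0 - c * w p 0.
Proof. by rewrite !mxE. Qed.

Lemma trv0E u v w : trv u v 0 *m w = w + u *m (star v *m w) - li *: (v *m (star u *m w)).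
Proof. by rewrite trvE mulmx0 mul0mx addr0. Qed.

Lemma short_fix p q x i : i != rev_ord p -> i != rev_ord q -> trv (ee p) (ee q *m x) 0 *m ee i = ee i.
Proof.
move=> h1 h2; rewrite trv0E starM -mulmxA !star_ee_ee ?mulmx0 ?scaler0 ?subr0 ?addr0 //; idx.
Qed.

Lemma short_diff p q v : trv (ee p) (ee q *m 1%:M) 0 *m v - v =
  ee p *m (mu q * v (rev_ord q) 0)%:M - li *: (ee q *m (mu p * v (rev_ord p) 0)%:M).
Proof. by rewrite trv0E mulmx1 !star_ee; abel. Qed.

Lemma trv_comm_gen (t t' : 'M[R]_N) u v a : unitary S t -> inv2 t t' -> t *m u = u ->
  star u *m u = 0 -> star u *m v = 0 ->
  t *m trv u v a *m t' *m trv u (- v) (- a - li *: (star v *m v)) =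
  trv u (t *m v - v) (li *: (star (t *m v) *m v - star v *m v)).
Proof.
move=> ht tt tu uu uv; rewrite trv_conj //; last exact: unitary_J.
rewrite tu trv_mul ?mulmxN ?uv ?oppr0 //; last by rewrite -{1}tu unitary_star.
by congr trv; rewrite scalerBr scalerN; abel.
Qed.

Variable H : 'M[R]_N -> Prop.
Hypotheses (HH : is_subgroup H) (HU : forall s, H s -> unitary S s) (HN : normalized_by EU H).
Implicit Types (s t e : 'M[R]_N).

Lemma sub1 : H 1%:M. Proof. by case: HH. Qed.
Lemma subM s t : H s -> H t -> H (s *m t). Proof. by case: HH => _ [h _]; exact: h. Qed.
Lemma subV s t : H s -> inv2 s t -> H t.
Proof.
case: HH => _ [_ h] hs st; have [b [hb [e1 e2]]] := h _ hs.
by rewrite (inv2_uniq st (conj e1 e2)).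
Qed.
Lemma sub_cancel_l s t : H s -> H (s *m t) -> H t.
Proof.
move=> hs h; have [s' ss] := unitary_inv2 (HU hs).
by have := subM (subV hs ss) h; rewrite mulmxA (proj2 ss) mul1mx.
Qed.
Lemma sub_cancel_r s t : H t -> H (s *m t) -> H s.
Proof.
move=> ht h; have [t' tt] := unitary_inv2 (HU ht).
by have := subM h (subV ht tt); rewrite -mulmxA (proj1 tt) mulmx1.
Qed.
Lemma sub_conj e e' s : EU e -> inv2 e e' -> H s -> H (e *m s *m e').
Proof. by move=> he [h1 h2] hs; exact: HN. Qed.
Lemma sub_comm_l e e' s s' : EU e -> inv2 e e' -> H s -> inv2 s s' -> H (e *m s *m e' *m s').
Proof. by move=> he ee' hs ss; apply: subM; [exact: sub_conj|exact: subV ss]. Qed.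
Lemma sub_comm_r e e' s s' : EU e -> inv2 e e' -> H s -> inv2 s s' -> H (s *m e *m s' *m e').
Proof.
move=> he ee' hs ss; rewrite -!mulmxA; apply: subM => //; rewrite mulmxA.
by apply: sub_conj => //; exact: subV ss.
Qed.

(** An elementary [t] fixing the column s e_i yields a commutator in [H] that acts on e_i as t'
    alone, so that its [i]-th column is explicit. *)
Lemma sub_fix t t' s s' i : H s -> EU t -> inv2 t t' -> inv2 s s' ->
  t *m (s *m ee i) = s *m ee i ->
  H (t' *m s' *m t *m s) /\ t' *m s' *m t *m s *m ee i = t' *m ee i.
Proof.
move=> hs ht tt ss e; split.
  by apply: sub_comm_l; [exact: EUV tt|exact: inv2_sym|exact: subV ss|exact: inv2_sym].
by rewrite -!mulmxA e (mulmxA s') (proj2 ss) mul1mx.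
Qed.

(** Commuting with an elementary [t] that fixes e_i replaces the direction [v] by t v - v. *)
Lemma sub_heis_step i v a t : EU t -> t *m ee i = ee i -> v (rev_ord i) 0 = 0 ->
  H (trv (ee i) v a) ->
  H (trv (ee i) (t *m v - v) (li *: (star (t *m v) *m v - star v *m v))).
Proof.
move=> ht te vi hv; have [t' _ tt] := EU_inv ht.
have uu : star (ee i) *m ee i = 0 by exact/iso_star/iso_ee.
have uv : star (ee i) *m v = 0 by rewrite star_ee vi mulr0 raddf0.
rewrite -(trv_comm_gen a (EU_unitary ht) tt te uu uv).
by apply: sub_comm_l => //; exact: trv_ring_inv.
Qed.

Hypothesis hn : (3 <= n)%N.

(* Three commutators with short root elements isolate a single coordinate of [v]. *)
Lemma heis_short i v a k : v (rev_ord i) 0 = 0 -> H (trv (ee i) v a) -> k != i -> k != rev_ord i ->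
  exists m c, [/\ m != i, m != rev_ord i, H (trv (ee i) (ee m *m (c * v k 0)%:M) 0) &
    exists c' : R, c' * c = 1].
Proof.
move=> vi hv ki ki'; have [m [m1 m2 m3 m4]] := exists_index i k hn.
exists m, (mu k * mu (rev_ord m) * mu (rev_ord k)); split=> //; last first.
  exists (bar (mu (rev_ord k)) * bar (mu (rev_ord m)) * bar (mu k)).
  by rewrite -!mulrA (mulrA (bar (mu k))) muVl mul1r (mulrA (bar (mu (rev_ord m)))) muVl mul1r muVl.
have h1 : EU (trv (ee m) (ee (rev_ord k) *m 1%:M) 0) by apply: EU_short; idx.
have f1 : trv (ee m) (ee (rev_ord k) *m 1%:M) 0 *m ee i = ee i by apply: short_fix; idx.
have := sub_heis_step h1 f1 vi hv; rewrite short_diff rev_ordK.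
set v1 := _ - _; move: (li *: _) => a1 hv1.
have h2 : EU (trv (ee (rev_ord k)) (ee (rev_ord m) *m 1%:M) 0) by apply: EU_short; idx.
have f2 : trv (ee (rev_ord k)) (ee (rev_ord m) *m 1%:M) 0 *m ee i = ee i by apply: short_fix; idx.
have v1E q : v1 q 0 = (if q == m then mu (rev_ord k) * v k 0 else 0)
    - li * (if q == rev_ord k then mu m * v (rev_ord m) 0 else 0).
  by rewrite /v1 colBZE !eex_entry !scal11.
have v1i : v1 (rev_ord i) 0 = 0.
  have e1 : (rev_ord i == m) = false by idx.
  have e2 : (rev_ord i == rev_ord k) = false by idx.
  by rewrite v1E e1 e2 mulr0 subrr.
have := sub_heis_step h2 f2 v1i hv1; rewrite short_diff !rev_ordK.
have -> : v1 m 0 = mu (rev_ord k) * v k 0.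
  by rewrite v1E eqxx (negPf m4) mulr0 subr0.
have -> : v1 k 0 = 0.
  have e1 : (k == m) = false by idx.
  by rewrite v1E e1 neq_rev mulr0 subr0.
rewrite mulr0 raddf0 mulmx0 scaler0 subr0.
set x := (_ * _); set v2 := ee _ *m _; move: (li *: _) => a2 hv2.
have h3 : EU (trv (ee m) (ee k *m 1%:M) 0) by apply: EU_short; idx.
have f3 : trv (ee m) (ee k *m 1%:M) 0 *m ee i = ee i by apply: short_fix; idx.
have v2i : v2 (rev_ord i) 0 = 0.
  have e1 : (rev_ord i == rev_ord k) = false by idx.
  by rewrite /v2 eex_entry e1.
have := sub_heis_step h3 f3 v2i hv2.
have d : trv (ee m) (ee k *m 1%:M) 0 *m v2 - v2 = ee m *m (mu k * x)%:M.
  have e1 : (rev_ord m == rev_ord k) = false by idx.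
  by rewrite short_diff /v2 !eex_entry eqxx e1 scal11 mulr0 raddf0 mulmx0 scaler0 subr0.
rewrite d; have -> : trv (ee m) (ee k *m 1%:M) 0 *m v2 = v2 + ee m *m (mu k * x)%:M.
  by rewrite -d addrC subrK.
have e0 : star (ee m) *m ee (rev_ord k) = 0 by apply: star_ee_ee; idx.
rewrite starD mulmxDl addrAC subrr add0r /v2 starM mulmxA (mul_eq0 _ e0) mul0mx scaler0.
by rewrite /x !mulrA.
Qed.

Hypothesis NS : forall p q x, q != p -> q != rev_ord p -> H (trv (ee p) (ee q *m x) 0) -> x = 0.

Lemma heis0 i v a k : v (rev_ord i) 0 = 0 -> H (trv (ee i) v a) -> k != i -> k != rev_ord i ->
  v k 0 = 0.
Proof.
move=> vi hv ki ki'; have [m [c [m1 m2 hm [c' hc]]]] := heis_short vi hv ki ki'.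
have := NS m1 m2 hm => /matrixP /(_ 0 0); rewrite scal11 [RHS]mxE => h.
by rewrite -[v k 0]mul1r -hc -mulrA h mulr0.
Qed.

(** The commutator of [t] with the short root element at e_i in direction e_j is a transvection at
    e_i in direction t e_j - e_j, whose coordinates away from ±i vanish by [heis0]. *)
Lemma fix_entry i t r j : H t -> t *m ee i = ee i -> r != i -> r != rev_ord i ->
  j != i -> j != rev_ord i -> t r j = (r == j)%:R.
Proof.
move=> ht ti ri ri' ji ji'; have [t' tt] := unitary_inv2 (HU ht).
have uu : star (ee i) *m ee i = 0 by exact/iso_star/iso_ee.
have uv : star (ee i) *m ee j = 0 by exact: star_ee_ee.
have := sub_comm_r (EU_short 1%:M ji ji') (trv_ring_inv 0 uu _) ht tt; rewrite mulmx1.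
move=> /(_ uv); rewrite trv_comm_gen //; last exact: HU.
have vi : (t *m ee j - ee j) (rev_ord i) 0 = 0.
  have : star (ee i) *m (t *m ee j - ee j) = 0.
    by rewrite mulmxBr uv subr0 -{1}ti unitary_star //; exact: HU.
  by rewrite star_ee => /matrixP /(_ 0 0); rewrite scal11 [RHS]mxE => /mul_mu_eq0.
move=> /(heis0 vi) /(_ ri ri') h; apply/eqP; rewrite -subr_eq0; apply/eqP.
by have E (v w : col) p : (v - w) p 0 = v p 0 - w p 0 by [rewrite !mxE]; rewrite E mul_ee ee_entry in h.
Qed.

(** A double commutator [Y] of [s] with two short root elements at e_i fixes e_m. Its entry at (i,
    -k), which [fix_entry] annihilates, is essentially h(s e_j, e_i). So the inverse of [s] maps e_i
    to a multiple of e_i, which forces z = 0. *)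
Lemma one_coord0 s i m z : H s -> m != i -> m != rev_ord i -> s *m ee i = ee i + ee m *m z -> z = 0.
Proof.
move=> hs mi mi'; have [u ue] : exists u, u = ee i + ee m *m z by eexists.
rewrite -ue => su.
have [s' ss] := unitary_inv2 (HU hs).
have uU : unitary S s by exact: HU.
have u0 r : r != rev_ord i -> r != rev_ord m -> star u *m ee r = 0.
  by move=> h1 h2; rewrite ue starD starM mulmxDl -mulmxA !star_ee_ee // mulmx0 addr0.
have key j : j != i -> j != rev_ord i -> star (s *m ee j) *m ee i = 0.
  move=> ji ji'; have [k [k1 k2 k3 k4 k5]] :
      exists k, [/\ k != i, k != rev_ord i, k != m, k != rev_ord m & k != rev_ord j].
    have [k [k1 k2 k3 k4]] := exists_index i m hn.
    have [e|ne] := eqVneq k (rev_ord j); last by exists k.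
    exists (rev_ord k); split; try idx.
    by rewrite e rev_ordK neq_rev.
  set v := s *m ee j.
  have uv : star u *m v = 0 by rewrite -su unitary_star //; exact: star_ee_ee.
  have ui : u *m 1%:M = u by rewrite mulmx1.
  set h := star v *m ee i; set h' := star v *m ee k.
  have ui0 : star u *m ee i = 0 by apply: u0; idx.
  have uk0 : star u *m ee k = 0 by apply: u0; idx.
  have um0 : star u *m ee m = 0 by apply: u0; idx.
  have uk'0 : star u *m ee (rev_ord k) = 0 by apply: u0; idx.
  have ii : star (ee i) *m ee i = 0 by apply: star_ee_ee; idx.
  have ij : star (ee i) *m ee j = 0 by apply: star_ee_ee; idx.
  have ik : star (ee i) *m ee k = 0 by apply: star_ee_ee; idx.
  have ki : star (ee k) *m ee i = 0 by apply: star_ee_ee; idx.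
  have jk : star (ee j) *m ee k = 0 by apply: star_ee_ee; idx.
  have ji0 : star (ee j) *m ee i = 0 by apply: star_ee_ee; idx.
  have im : star (ee i) *m ee m = 0 by apply: star_ee_ee; idx.
  have km : star (ee k) *m ee m = 0 by apply: star_ee_ee; idx.
  have ik' : star (ee i) *m ee (rev_ord k) = 0 by apply: star_ee_ee; idx.
  have EE := trv_ring_inv 0 ii ij; have KK := trv_ring_inv 0 ii ik.
  have hE : EU (trv (ee i) (ee j) 0) by rewrite -[ee j]mulmx1; exact: EU_short.
  have hK : EU (trv (ee i) (ee k) 0) by rewrite -[ee k]mulmx1; exact: EU_short.
  have jj : star (ee j) *m ee j = 0 by exact/iso_star/iso_ee.
  have kk : star (ee k) *m ee k = 0 by exact/iso_star/iso_ee.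
  rewrite jj scaler0 subr0 oppr0 in EE; rewrite kk scaler0 subr0 oppr0 in KK.
  have hX := sub_comm_r hE EE hs ss; set X := (_ *m _) in hX.
  have XE : X = trv u v 0 *m trv (ee i) (- ee j) 0.
    by rewrite /X trv_conj; [rewrite su|exact: unitary_J|].
  have Xi : X *m ee i = ee i + u *m h.
    rewrite XE -mulmxA [trv (ee i) _ _ *m _]trv0E starN mulNmx ji0 ii oppr0 !mulmx0 scaler0 subr0 addr0.
    by rewrite trv0E ui0 mulmx0 scaler0 subr0.
  have Xk : X *m ee k = ee k + u *m h'.
    rewrite XE -mulmxA [trv (ee i) _ _ *m _]trv0E starN mulNmx jk ik oppr0 !mulmx0 scaler0 subr0 addr0.
    by rewrite trv0E uk0 mulmx0 scaler0 subr0.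
  have [X' XX] := unitary_inv2 (HU hX).
  have hY := sub_comm_r hK KK hX XX.
  rewrite trv_conj // in hY; last by apply: unitary_J; exact: HU.
  set Y := (_ *m _) in hY; rewrite Xi Xk in Y hY.
  have Ym : Y *m ee m = ee m.
    rewrite /Y -mulmxA [trv (ee i) _ _ *m _]trv0E starN mulNmx km im oppr0 !mulmx0 scaler0 subr0 addr0.
    rewrite trv0E !starD !mulmxDl !starM -!mulmxA um0 km im.
    by rewrite !(mulmx0, addr0, scaler0, subr0).
  have Yk : Y *m ee (rev_ord k) = ee (rev_ord k) + u *m h *m (mu k)%:M.
    rewrite /Y -mulmxA [trv (ee i) _ _ *m _]trv0E starN mulNmx ik' star_ee_rev !mulmx0 scaler0 subr0 mulmxN.
    set w := _ - _; have kw : star (ee k) *m w = (mu k)%:M.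
      by rewrite /w mulmxBr star_ee_rev mulmxA ki mul0mx subr0.
    have iw : star (ee i) *m w = 0 by rewrite /w mulmxBr ik' mulmxA ii mul0mx subr0.
    have uw : star u *m w = 0 by rewrite /w mulmxBr uk'0 mulmxA ui0 mul0mx subr0.
    rewrite trv0E !starD !mulmxDl !starM -!mulmxA uw kw iw.
    by rewrite !(mulmx0, addr0, scaler0, subr0) /w addrA subrK mulmxA.
  have e : Y i (rev_ord k) = 0.
    have -> : Y i (rev_ord k) = (i == rev_ord k)%:R by apply: (fix_entry (i := m)) => //; idx.
    by have -> : (i == rev_ord k) = false by idx.
  move: e; rewrite -mul_ee Yk -mulmxA colDE mulmx1_entry ue colDE !ee_entry eqxx eex_entry.
  have -> : (i == rev_ord k) = false by idx.
  have -> : (i == m) = false by idx.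
  rewrite addr0 add0r mul1r mxE big_ord1 scal11 -(muC S k) => /mul_mu_eq0 e.
  by rewrite [LHS]mx11_scalar e raddf0.
have [_ s's] := ss; set w := s' *m ee i.
have sw : s *m w = ee i by rewrite /w mulmxA (proj1 ss) mul1mx.
have w0 r : r != i -> w r 0 = 0.
  move=> ri; have [e|ri'] := eqVneq r (rev_ord i).
    have : star (ee i) *m w = 0 by rewrite -(unitary_star _ _ uU) sw su; apply: u0; idx.
    by rewrite star_ee -e => /matrixP /(_ 0 0); rewrite scal11 [RHS]mxE => /mul_mu_eq0.
  have : star (ee (rev_ord r)) *m w = 0.
    by rewrite -(unitary_star _ _ uU) sw; apply: key; idx.
  by rewrite star_ee rev_ordK => /matrixP /(_ 0 0); rewrite scal11 [RHS]mxE => /mul_mu_eq0.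
have wE : w = ee i *m (w i 0)%:M.
  rewrite {1}[w]col_sum (bigD1 i) //= big1 ?addr0 // => r hr.
  by rewrite w0 // raddf0 mulmx0.
have e p : (ee i + ee m *m z) p 0 * w i 0 = ee i p 0.
  by rewrite -ue -su -[w i 0]scal11 -mulmx1_entry -mulmxA -wE sw.
have e1 : w i 0 = 1.
  have := e i; rewrite colDE ee_entry eex_entry eqxx.
  have -> : (i == m) = false by idx.
  by rewrite addr0 mul1r.
have := e m; rewrite e1 mulr1 colDE !ee_entry eex_entry eqxx (negPf mi) add0r => h.
by rewrite [LHS]mx11_scalar h raddf0.
Qed.
End NoShort.

(** * Reduction to central scalar matrices *)

Section Scalar.
Variables (R : nzRingType) (S : form_ring R) (n : nat).
Local Notation bar := (fbar S).
Local Notation lam := (flam S).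
Local Notation li := (fbar S (flam S)).
Local Notation N := (n + n)%N.
Local Notation col := 'cV[R]_N.
Local Notation ee := (@ee R n).
Local Notation mu := (@mu R S n).
Local Notation EU := (@EU R bar lam n (fLam S)).
Local Notation trv := (trv S).
Local Notation star := (star S).
Local Notation perp := (perp S).
Local Notation perp_coef := (perp_coef S).
Implicit Types (u v w : col) (p q i j k l : 'I_N).
Variable H : 'M[R]_N -> Prop.
Hypotheses (HH : is_subgroup H) (HU : forall s, H s -> unitary S s) (HN : normalized_by EU H).
Hypothesis hn : (3 <= n)%N.
Hypothesis NS : forall p q x, q != p -> q != rev_ord p -> H (trv (ee p) (ee q *m x) 0) -> x = 0.
Implicit Types (s t e : 'M[R]_N).

Lemma perp_coef_eq0 u q b d k : d * bar (perp_coef u q b k) = 0 -> d * (u (rev_ord k) 0 * b) = 0.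
Proof.
rewrite bar_perp_coef mulrN => /eqP; rewrite oppr_eq0 => /eqP h.
apply: (@mul_barmu_eq0 _ S n (rev_ord k)); apply: (@mul_mu_eq0 _ S n q).
by rewrite -h !mulrA -(mulrA (mu q) _ d) (bar_muC _ _ d) mulrA (muC _ q d).
Qed.

Lemma star_perp_ee u c b (d : R) k : k != rev_ord c -> k != c ->
  star (perp u c b d k) *m ee c = (bar (perp_coef u c b k) * mu (rev_ord c))%:M.
Proof.
move=> h h'; rewrite star_mul_ee perp_entry eqxx.
have -> : (rev_ord c == k) = false by idx.
by rewrite add0r.
Qed.

(** Both vectors [perp] are orthogonal to the column s e_i, so their transvection fixes it and
    [sub_fix] applies. *)
Lemma perp_commutator s i b c k l : H s -> b * s i i = c -> bar c = c ->
  (forall p, c * bar (s p i) = bar (s p i) * c) ->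
  k != i -> k != rev_ord i -> l != i -> l != rev_ord i -> l != rev_ord k ->
  let w := perp (s *m ee i) i b c in let al q := bar (perp_coef (s *m ee i) i b q) * mu (rev_ord i) in
  exists2 t, H t & t *m ee i = ee i - w k *m (al l)%:M + li *: (w l *m (al k)%:M).
Proof.
move=> hs bs cc sc ki ki' li1 li2 lk w al.
have bu : b * (s *m ee i) i 0 = c by rewrite mul_ee.
have su p : c * bar ((s *m ee i) p 0) = bar ((s *m ee i) p 0) * c by rewrite mul_ee sc.
have [s' ss] := unitary_inv2 (HU hs).
have kl : star (w k) *m w l = 0 by exact: perp_perp.
have iw : iso S (w l) by exact: perp_iso.
have ht : EU (trv (w k) (w l) 0) by apply: good_trv => //; exact: good_perp.
have kk : star (w k) *m w k = 0 by apply/iso_star/perp_iso.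
have := trv_ring_inv 0 kk kl; rewrite (iso_star iw) scaler0 subr0 oppr0 => tt.
have fx : trv (w k) (w l) 0 *m (s *m ee i) = s *m ee i.
  have o q : star (w q) *m (s *m ee i) = 0 by apply/star_eq0_sym/perp_orth.
  by rewrite trv0E !o !mulmx0 scaler0 subr0 addr0.
have [hp e] := sub_fix HH HN hs ht tt ss fx.
exists (trv (w k) (- w l) 0 *m s' *m trv (w k) (w l) 0 *m s) => //.
by rewrite e trv0E starN mulNmx !star_perp_ee // mulmxN mulNmx scalerN opprK.
Qed.

(** A first commutator gives [t] with entry 1 at (i, i) and 0 at (j, i). In the second one a vector
    [perp] then degenerates to the basis vector e_{-j}, and the column is e_i plus a single
    coordinate; [one_coord0] kills it, and tracing back gives s j i = 0. *)
Lemma unit_coord_zero s i j : H s -> s i i = 1 -> j != i -> j != rev_ord i -> s j i = 0.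
Proof.
move=> hs s1 ji ji'; have [k [k1 k2 k3 k4]] := exists_index i j hn.
set l := rev_ord j; have [l1 l2] : l != i /\ l != rev_ord i by rewrite /l; split; idx.
have lk : l != rev_ord k by rewrite /l; idx.
have one c : 1 * c = c * 1 :> R by rewrite mul1r mulr1.
have b1 : 1 * s i i = 1 by rewrite s1 mulr1.
have [t ht te] := perp_commutator hs b1 (bar1 S) (fun p => one _) k1 k2 l1 l2 lk.
set al := perp_coef (s *m ee i) i 1 in te.
have tE p : t p i = (p == i)%:R - ((p == k)%:R + (if p == rev_ord i then al k else 0)) * (bar (al l) * mu (rev_ord i))
    + li * (((p == l)%:R + (if p == rev_ord i then al l else 0)) * (bar (al k) * mu (rev_ord i))).
  have E v w w' c : (v - w + c *: w') p 0 = v p 0 - w p 0 + c * w' p 0 by rewrite !mxE.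
  rewrite -mul_ee te E !mulmx1_entry !perp_entry !scal11 ee_entry -/al.
  have F (x : bool) : (if x then 1 else 0) = x%:R :> R by case: x.
  by rewrite !F.
have e_ii' : (i == rev_ord i) = false by exact: neq_rev.
have e_ik : (i == k) = false by idx.
have e_il : (i == l) = false by rewrite /l; idx.
have t1 : 1 * t i i = 1.
  by rewrite mul1r tE eqxx e_ik e_il e_ii' !addr0 !mul0r mulr0 subr0 addr0.
have lk' : rev_ord k != rev_ord l by rewrite /l; idx.
have k1' : rev_ord k != i by idx.
have k2' : rev_ord k != rev_ord i by idx.
have [t2 ht2 te2] := perp_commutator ht t1 (bar1 S) (fun p => one _) l1 l2 k1' k2' lk'.
set al2 := perp_coef (t *m ee i) i 1 in te2.
have al2l : al2 l = 0.
  rewrite /al2 /perp_coef /l rev_ordK mul_ee tE (negPf ji) (negPf ji').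
  have -> : (j == k) = false by idx.
  by rewrite neq_rev !addr0 !mul0r mulr0 subr0 addr0 bar0 mulr0 oppr0.
have wl : perp (t *m ee i) i 1 1 l = ee l by rewrite /perp -/al2 al2l raddf0 mulmx0 addr0 mulmx1.
rewrite wl al2l bar0 mul0r raddf0 mulmx0 scaler0 addr0 -mulmxN in te2.
have := one_coord0 HH HU HN hn NS ht2 l1 l2 te2 => /matrixP /(_ 0 0).
rewrite mxE scal11 [RHS]mxE => /eqP; rewrite oppr_eq0 -muC => /eqP /mul_mu_eq0.
rewrite -[bar _]mul1r => /perp_coef_eq0; rewrite mul1r.
rewrite rev_ordK mulr1 mul_ee tE (negPf k1) (negPf k2) eqxx addr0 mul1r.
have -> : (k == l) = false by idx.
rewrite addr0 mul0r mulr0 addr0 sub0r => /eqP; rewrite oppr_eq0 -muC => /eqP /mul_mu_eq0.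
rewrite -[bar _]mul1r => /perp_coef_eq0; rewrite mul1r.
by rewrite mulr1 /l rev_ordK mul_ee.
Qed.

(** The commutator from [perp_commutator] has entry 1 at (i, i), so [unit_coord_zero] makes c s_{pi}
    b vanish, and multiplying by s_{ii} gives the claim for p other than ±i. Then the transvection
    at e_k in direction u c^2 fixes the column [u], and its commutator moves e_i only along e_k,
    which settles [-i]. *)
Lemma dead_coords s i b c j : H s -> b * s i i = c -> bar c = c ->
  (forall p, c * s p i = s p i * c) -> j != i -> c * c * s j i = 0.
Proof.
move=> hs bs cc sc ji.
have scb p : c * bar (s p i) = bar (s p i) * c by rewrite -{1}cc -barM -sc barM cc.
have A1 p : p != i -> p != rev_ord i -> c * c * s p i = 0.
  move=> pi pi'; have [k [k1 k2 k3 k4]] := exists_index i p hn.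
  have l1 : rev_ord p != i by idx.
  have l2 : rev_ord p != rev_ord i by idx.
  have lk : rev_ord p != rev_ord k by idx.
  have [t ht te] := perp_commutator hs bs cc scb k1 k2 l1 l2 lk.
  have tE q : t q i = (ee i - perp (s *m ee i) i b c k *m (bar (perp_coef (s *m ee i) i b (rev_ord p)) * mu (rev_ord i))%:M
     + li *: (perp (s *m ee i) i b c (rev_ord p) *m (bar (perp_coef (s *m ee i) i b k) * mu (rev_ord i))%:M)) q 0.
    by rewrite -te mul_ee.
  have E v w w' x q : (v - w + x *: w') q 0 = v q 0 - w q 0 + x * w' q 0 by rewrite !mxE.
  have t1 : t i i = 1.
    rewrite tE E !mulmx1_entry !perp_entry ee_entry neq_rev.
    have -> : (i == k) = false by idx.
    have -> : (i == rev_ord p) = false by idx.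
    by rewrite eqxx !addr0 !mul0r mulr0 subr0 addr0.
  have := unit_coord_zero ht t1 k1 k2.
  rewrite tE E !mulmx1_entry !perp_entry ee_entry (negPf k1) (negPf k2) eqxx !scal11.
  have -> : (k == rev_ord p) = false by idx.
  rewrite !addr0 mul0r mulr0 addr0 sub0r => /eqP; rewrite oppr_eq0 mulrA -muC => /eqP /mul_mu_eq0.
  move=> /perp_coef_eq0; rewrite rev_ordK mul_ee => h'.
  have : c * (s p i * b) * s i i = 0 by rewrite h' mul0r.
  by rewrite -!mulrA bs -sc mulrA.
have [e|ji'] := eqVneq j (rev_ord i); last exact: A1.
have [k [k1 k2 _ _]] := exists_index i i hn.
set u := s *m ee i.
have uE p : u p 0 = s p i by rewrite mul_ee.
have iu : iso S u by apply: unitary_iso; [exact: HU|exact: iso_ee].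
set v := u *m (c * c)%:M.
have iv : iso S v by exact: isoM.
have vk : v (rev_ord k) 0 = 0.
  by rewrite mulmx1_entry scal11 uE mulrA -sc -mulrA -sc mulrA A1 //; idx.
have ht : EU (trv (ee k) v 0) by apply: good_trv => //; exact: good_ee.
have kk : star (ee k) *m ee k = 0 by exact/iso_star/iso_ee.
have kv : star (ee k) *m v = 0 by rewrite star_ee vk mulr0 raddf0.
have := trv_ring_inv 0 kk kv; rewrite (iso_star iv) scaler0 subr0 oppr0 => tt.
have fx : trv (ee k) v 0 *m u = u.
  rewrite trv0E /v starM -mulmxA (iso_star iu) !mulmx0 addr0 star_ee -mulmxA -scalar_mxM.
  rewrite uE mulrA -(muC _ k) -!mulrA (mulrA c) A1; try idx.
  by rewrite mulr0 raddf0 mulmx0 scaler0 subr0.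
have [s' ss] := unitary_inv2 (HU hs).
have [hp] := sub_fix HH HN hs ht tt ss fx.
have ki0 : star (ee k) *m ee i = 0 by apply: star_ee_ee; idx.
rewrite [trv (ee k) _ _ *m ee i]trv0E ki0 !mulmx0 scaler0 subr0 => /(one_coord0 HH HU HN hn NS hp k1 k2).
rewrite starN mulNmx /v starM adj_scalar -mulmxA star_mul_ee -scalar_mxM => /matrixP /(_ 0 0).
rewrite mxE scal11 [RHS]mxE => /eqP; rewrite oppr_eq0 mulrA -muC => /eqP /mul_mu_eq0.
rewrite uE -e barM cc => h; have := congr1 bar h; rewrite bar0 barM barK barM cc => <-.
by rewrite mulrA -sc -!mulrA -sc.
Qed.

Lemma exists_shift i j (x : R) : j != i -> j != rev_ord i ->
  exists y : R, let t := trv (ee j) (ee (rev_ord i) *m y%:M) 0 in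
  let t' := trv (ee j) (ee (rev_ord i) *m - y%:M) 0 in
  [/\ EU t, inv2 t t', y = bar (x * bar (mu (rev_ord i))) & t *m ee i = ee i + ee j *m x%:M].
Proof.
move=> ji ji'; exists (bar (x * bar (mu (rev_ord i)))); split=> //.
- by apply: EU_short; idx.
- by apply: short_inv; idx.
rewrite trv0E star_ee_ee; last by idx.
rewrite !mulmx0 scaler0 subr0 starM adj_scalar barK -mulmxA.
have := star_ee_rev S (rev_ord i); rewrite rev_ordK => ->.
by rewrite -scalar_mxM -mulrA muVl mulr1.
Qed.

Section LocalUnit.
Variables (C A m : R -> Prop) (r : nat) (g : 'I_r -> R).
Hypotheses (LS : local_subring S C A g) (MI : maximal_in C m).
Let FO := ls_fin LS.
Let AM x y : A x -> A y -> A (x * y).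
Proof. by case: (fo_A FO) => _ [_ h]; exact: h. Qed.
Let AD x y : A x -> A y -> A (x + y).
Proof. by case: (fo_A FO) => [[_ [h _]] _]; exact: h. Qed.

(** The [j]-th coordinate of t s e_i is locally invertible. A transvection along vectors orthogonal
    to that column, pulled back by [t], fixes s e_i and gives an element of [H] with entry 1 at (i,
    i). Its vanishing off-diagonal entry is a relation making s i i right invertible up to d^2. *)
Lemma unit_coord_of_shift s i j x b d : H s -> (forall p, A (s p i)) -> A x -> A b -> C d -> ~ m d ->
  j != i -> j != rev_ord i -> b * (s j i + x * s i i) = d ->
  exists b' d', [/\ C d', ~ m d' & b' * s i i = d'].
Proof.
move=> hs sA xA bA dC nd ji ji' bd.
have dA := fo_CA FO dC.
have dc y : A y -> d * y = y * d by exact: (fo_comm FO).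
have [y [ht tt ey tfi]] := exists_shift x ji ji'.
set t := trv (ee j) _ _ in ht tt tfi; set t' := trv (ee j) _ _ in tt.
have yA : A y by rewrite ey; apply: (ls_bar LS); apply: AM => //; exact: (ls_bar LS (A_mu LS _)).
set u := s *m ee i; set v := t *m u.
have uA : colA A u by move=> p; rewrite mul_ee.
have vA : colA A v.
  apply: (colA_trv LS) => //; [exact: (colA_ee LS)|by apply: (colA_eex LS); rewrite scal11|].
  by rewrite mxE; case: (fo_A FO) => [[]].
have e1 : (j == rev_ord i) = false by idx.
have e2 : (i == j) = false by idx.
have vj : b * v j 0 = d.
  by rewrite /v short_coord e1 eqxx scal11 mulr0 subr0 rev_ordK !mul_ee ey barK muK.
have vi : v i 0 = s i i by rewrite /v short_coord e2 neq_rev mulr0 subr0 addr0 mul_ee.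
have iv : iso S v.
  apply: unitary_iso; first exact: EU_unitary.
  by apply: unitary_iso; [exact: HU|exact: iso_ee].
have dv p : d * bar (v p 0) = bar (v p 0) * d by apply: dc; exact: (ls_bar LS).
have dd := ls_sym LS dC.
have [l [l1 l2 l3 l4]] := exists_index i j hn.
set wl := perp v j b d l; set wi := perp v j b d (rev_ord i).
have il' : rev_ord i != j by idx.
have il'' : rev_ord i != rev_ord j by idx.
have li0 : star wl *m wi = 0 by apply: perp_perp => //; idx.
have iwi : iso S wi by exact: perp_iso.
have iwl : star wl *m wl = 0 by exact/iso_star/perp_iso.
have hz : EU (trv wl wi 0) by apply: good_trv => //; exact: good_perp.
have := trv_ring_inv 0 iwl li0; rewrite (iso_star iwi) scaler0 subr0 oppr0 => zz.
have hZ : EU (t' *m trv wl wi 0 *m t).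
  by apply: EUM => //; apply: EUM => //; exact: EUV tt.
have ZZ := inv2_conj (inv2_sym tt) zz.
have fx : t' *m trv wl wi 0 *m t *m u = u.
  have o q : star (perp v j b d q) *m v = 0 by apply/star_eq0_sym/perp_orth.
  rewrite -!mulmxA -/v trv0E !o !mulmx0 scaler0 subr0 addr0 /v mulmxA (proj2 tt) mul1mx //.
have [s' ss] := unitary_inv2 (HU hs).
have [P hp] : exists2 P, H P & P *m ee i = t' *m trv wl (- wi) 0 *m t *m ee i.
  by have [h1 h2] := sub_fix HH HN hs hZ ZZ ss fx; eexists; [exact: h1|exact: h2].
rewrite -!mulmxA tfi; set f := ee i + _ => Pe.
have fE q : f q 0 = (if q == i then 1 else 0) + (if q == j then x else 0).
  by rewrite colDE ee_entry eex_entry scal11; case: (q == i).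
set cl := hh S wl f; set ci := hh S wi f.
have PE q : q != j -> q != rev_ord i -> P q i = f q 0 - wl q 0 * ci + li * (wi q 0 * cl).
  move=> q1 q2; rewrite -mul_ee Pe /t' short_coord (negPf q1) (negPf q2) mulr0 subr0 addr0.
  rewrite trv0E starN mulNmx !star_hh -/cl -/ci mulNmx scalerN opprK mulmxN.
  have E (v1 v2 v3 : col) c : (v1 - v2 + c *: v3) q 0 = v1 q 0 - v2 q 0 + c * v3 q 0 by rewrite !mxE.
  by rewrite E !mulmx1_entry !scal11.
have nij : i != rev_ord i by rewrite neq_rev.
have e3 : (i == rev_ord j) = false by idx.
have e4 : (i == l) = false by idx.
have Pi : P i i = 1.
  rewrite PE ?e2 // fE eqxx e2 /wl /wi !perp_entry e4 e3 neq_rev.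
  by rewrite !addr0 !mul0r mulr0 subr0 addr0.
have := unit_coord_zero hp Pi l1 l2.
rewrite PE // fE (negPf l1) (negPf l3) /wl /wi !perp_entry eqxx (negPf l2) (negPf l4).
rewrite !addr0 mul0r mulr0 addr0 sub0r => /eqP; rewrite oppr_eq0 => /eqP.
rewrite /ci hh_perp // rev_ordK !fE eqxx e2 addr0 (negPf ji) eqxx add0r mulr1 bar_perp_coef rev_ordK.
rewrite vi => h.
have E : s i i * (b * (mu j * bar (mu i) * mu (rev_ord j)) * x * bar (mu (rev_ord i)) * d) = d * d.
  set z := mu j * bar (mu i) in h *; have zC y' : z * y' = y' * z.
    by rewrite /z -mulrA bar_muC !mulrA muC.
  have dE : d * d * mu (rev_ord i) = d * (s i i * b * (z * mu (rev_ord j)) * x).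
    apply/eqP; rewrite -subr_eq0 -[X in X - _]mulrA -mulrBr -h; apply/eqP; congr (_ * _); rewrite !mulNr; congr (_ - _).
    by rewrite [in LHS]mulrA -(zC (s i i * b)) !mulrA.
  have aA : A (s i i * b * (z * mu (rev_ord j)) * x * bar (mu (rev_ord i))).
    have mA' := A_mu LS; have mbA p := ls_bar LS (mA' n p).
    by rewrite /z; do ![apply: AM => //].
  by rewrite !mulrA in aA *; rewrite -dc // !mulrA -(muKV S (rev_ord i) (d * d)) dE !mulrA.
have ZA : A (b * (mu j * bar (mu i) * mu (rev_ord j)) * x * bar (mu (rev_ord i)) * d).
  have mA' := A_mu LS; have mbA p := ls_bar LS (mA' n p).
  by do ![apply: AM => //].
have dd' : C (d * d) by case: (fo_C FO) => _ [_]; exact.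
have ndd : ~ m (d * d) by exact: (max_prime FO MI).
have [b' [d' [_ h1 h2 h3 _]]] := unit_of_right FO MI (sA i) ZA dd' ndd E.
by exists b', d'.
Qed.
End LocalUnit.

Hypothesis LF : locally_finite S.

(** The elements of [C] killing the off-diagonal entries of column [i] form an ideal. At a maximal
    ideal containing it, stable range makes a shifted coordinate a local unit, then s i i up to
    conjugation, and [dead_coords] gives an element outside. *)
Lemma offdiag0 s i j : H s -> j != i -> s j i = 0.
Proof.
move=> hs; have [s' ss] := unitary_inv2 (HU hs).
have [C [A [r [g [LS hF]]]]] := LF (entries s ++ entries s').
have FO := ls_fin LS; have CA := fo_CA FO.
have [[C0 [CD CN]] [C1 CM]] := fo_C FO.
have sA p q : A (s p q) by apply: hF; rewrite mem_cat entries_mem.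
have s'A p q : A (s' p q) by apply: hF; rewrite mem_cat entries_mem orbT.
pose K d := C d /\ forall p, p != i -> d * s p i = 0.
suff : K 1 by move=> [_ h] ji; have := h _ ji; rewrite mul1r.
apply: boolp.contrapT => nK1.
have [||x1 y1 [hx1 Hx] [hy1 Hy]|c x1 hc [hx1 Hx]|m MI Km] := maximal_ideal_exists (S := K) FO _ _ _ _ nK1.
- by move=> y [].
- by split=> // p _; rewrite mul0r.
- by split=> [|p hp]; [exact: CD|rewrite mulrDl Hx // Hy // addr0].
- by split=> [|p hp]; [exact: CM|rewrite -mulrA Hx // mulr0].
have [j0 [j1 j2 _ _]] := exists_index i i hn.
have [l [l1 l2 l3 l4]] := exists_index i j0 hn.
set u := s *m ee i.
have uA : colA A u by move=> p; rewrite mul_ee.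
have [h [x [b [d [hh hi xA cA [bA dC nd e1 e2]]]]]] :=
  unit_coordinate LS MI j1 j2 l1 l2 l3 l4 uA (s'A i) (inv2_unimodular i ss).
have [y [ht tt ey tfi]] := exists_shift x j1 j2.
set t := trv (ee j0) _ _ in ht tt tfi; set t' := trv (ee j0) _ _ in tt.
have yA : A y.
  rewrite ey; apply: (ls_bar LS); case: (fo_A FO) => _ [_ AM]; apply: AM => //.
  exact: (ls_bar LS (A_mu LS _)).
have hG : EU (t' *m h) by apply: EUM => //; exact: EUV tt.
have [G' hG' GG] := EU_inv hG.
have Gi : t' *m h *m ee i = ee i by rewrite -mulmxA hi -tfi mulmxA (proj2 tt) mul1mx.
have G'i : G' *m ee i = ee i by rewrite -{1}Gi mulmxA (proj2 GG) mul1mx.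
pose s1 := t' *m h *m s *m G'; have hs1 : H s1 by exact: (sub_conj HN).
have s1i : s1 *m ee i = t' *m (h *m u) by rewrite /s1 -!mulmxA G'i.
have ts1 : t *m (s1 *m ee i) = h *m u by rewrite s1i mulmxA (proj1 tt) mul1mx.
have s1A p : A (s1 p i).
  rewrite -mul_ee s1i; apply: (colA_trv LS); [exact: (colA_ee LS)| | |exact: cA].
    by apply: (colA_eex LS); rewrite mxE scal11; case: (fo_A FO) => [[_ [_ AN]] _]; exact: AN.
  by rewrite mxE; case: (fo_A FO) => [[]].
have bd : b * (s1 j0 i + x * s1 i i) = d.
  rewrite -e1 -ts1 short_coord.
  have -> : (j0 == rev_ord i) = false by idx.
  by rewrite eqxx scal11 mulr0 subr0 rev_ordK !mul_ee ey barK muK.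
have [b' [d' [dC' nd' bd']]] := unit_coord_of_shift LS MI hs1 s1A xA bA dC nd j1 j2 bd.
have dc a : A a -> d' * a = a * d' by exact: (fo_comm FO).
have D0 p : p != i -> d' * d' * s1 p i = 0.
  by apply: (dead_coords hs1 bd' (ls_sym LS dC')) => q; exact: dc.
have us : u = G' *m (s1 *m ee i) by rewrite s1i (mulmxA t') (mulmxA G') (proj2 GG) mul1mx.
have ud : u *m (d' * d')%:M = ee i *m (s1 i i * (d' * d'))%:M.
  rewrite us -mulmxA -{2}G'i -[RHS]mulmxA; congr (_ *m _).
  apply/matrixP => p q; rewrite ord1 mulmx1_entry mul_ee eex_entry !scal11.
  case: eqP => [->//|/eqP hp].
  by rewrite mulrA -(dc (s1 p i)) // -mulrA -(dc (s1 p i)) // mulrA D0.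
apply: (max_prime FO MI dC' dC' nd' nd'); apply: Km; split; first exact: CM.
move=> p hp; have := congr1 (fun v : col => v p 0) ud.
rewrite mulmx1_entry eex_entry (negPf hp) mul_ee scal11 => <-.
by rewrite -mulrA (dc (s p i)) // mulrA (dc (s p i)) // mulrA.
Qed.

Lemma diag_column s i : H s -> s *m ee i = ee i *m (s i i)%:M.
Proof.
move=> hs; apply/matrixP => p q; rewrite ord1 mul_ee eex_entry scal11.
by case: eqP => [->//|/eqP hp]; exact: offdiag0.
Qed.

(** The relation is the vanishing of the (i, j) entry of a conjugate of [s] by a short root
    element. *)
Lemma diag_intertwine s i j x : H s -> i != j -> i != rev_ord j -> s i i * x = x * s j j.
Proof.
move=> hs ij ij'; have [y [ht tt _ tj]] := exists_shift x ij ij'.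
set t := trv (ee i) _ _ in ht tt tj; set t' := trv (ee i) _ _ in tt.
have ht' : EU t' by exact: EUV tt.
have h1 : H (t' *m s *m t) by apply: (sub_conj HN) => //; exact: inv2_sym.
have t'i : t' *m ee i = ee i by apply: short_fix; idx.
have t'j : t' *m ee j = ee j - ee i *m x%:M.
  have := congr1 (mulmx t') tj; rewrite mulmxA (proj2 tt) mul1mx mulmxDr (mulmxA t') t'i => {2}->.
  by rewrite addrK.
have := offdiag0 h1 ij.
rewrite -mul_ee -!mulmxA tj mulmxDr (mulmxA s) !diag_column // mulmxDr !(mulmxA t') t'i t'j.
rewrite mulmxBl -!mulmxA -!scalar_mxM colDE -[X in X + _]/((ee j *m _ - ee i *m _) i 0).
have E (v1 v2 : col) q : (v1 - v2) q 0 = v1 q 0 - v2 q 0 by rewrite !mxE.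
by rewrite E !eex_entry eqxx (negPf ij) !scal11 sub0r addrC => /eqP; rewrite subr_eq0 => /eqP.
Qed.

Lemma scalar_of_no_short s : H s -> exists2 c, central c & s = c%:M.
Proof.
move=> hs; have eq i j : i != j -> i != rev_ord j -> s i i = s j j.
  by move=> h1 h2; have := diag_intertwine 1 hs h1 h2; rewrite mulr1 mul1r.
have all i j : s i i = s j j.
  have [l [l1 l2 l3 l4]] := exists_index i j hn.
  by transitivity (s l l); [symmetry|]; apply: eq.
have i0 : 'I_N by exists 0%N; lia.
have [l [l1 l2 _ _]] := exists_index i0 i0 hn.
exists (s i0 i0) => [x|].
  by have := diag_intertwine x hs l1 l2; rewrite (all l i0).
apply/matrixP => p q; rewrite [RHS]mxE; case: eqP => [->|/eqP hpq]; first by rewrite (all q i0).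
by rewrite offdiag0.
Qed.

End Scalar.

(** * The level *)

Section Level.
Variables (R : nzRingType) (S : form_ring R) (n : nat).
Local Notation bar := (fbar S).
Local Notation lam := (flam S).
Local Notation li := (fbar S (flam S)).
Local Notation N := (n + n)%N.
Local Notation col := 'cV[R]_N.
Local Notation ee := (@ee R n).
Local Notation mu := (@mu R S n).
Local Notation EU := (@EU R bar lam n (fLam S)).
Local Notation trv := (trv S).
Local Notation star := (star S).
Implicit Types (u v w : col) (p q i j k l : 'I_N) (x y r a : R).
Variable H : 'M[R]_N -> Prop.
Hypotheses (HH : is_subgroup H) (HU : forall s, H s -> unitary S s) (HN : normalized_by EU H).
Hypothesis hn : (3 <= n)%N.
Implicit Types (s t e : 'M[R]_N).

Definition Hs i j x := H (trv (ee i) (ee j *m x%:M) 0).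
Definition Hl i a := H (trv (ee i) 0 (- (li *: a%:M))).
(** Membership is required at all positions; by [Hs_level], and by [Hl_flevel] for elements of
    Lambda, a single position suffices. *)
Definition level x : Prop := forall i j, j != i -> j != rev_ord i -> Hs i j x.
Definition flevel a : Prop := fLam S a /\ forall i, Hl i a.

Lemma Hs_step i j k r x : j != i -> j != rev_ord i -> k != i -> k != rev_ord i ->
  j != k -> j != rev_ord k -> Hs i j x -> Hs i k (r * x).
Proof.
move=> h1 h2 h3 h4 h5 h6 h.
have [y [ht tt]] := short_commutator S r%:M x%:M h1 h2 h3 h4 h5 h6.
rewrite /Hs scalar_mxM => <-; apply: (sub_comm_l HH HN) => //.
exact: short_inv.
Qed.

Lemma Hs_flip i j x : Hs i j x -> Hs j i (- (lam * bar x)).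
Proof.
rewrite /Hs trv_swap adj_scalar; congr (H (trv _ _ _)).
by rewrite raddfN /= mulmxN -scale_scalar_mx mulmxZ //; exact: lamC.
Qed.

(** The targets k = j and k = -j are not reached by one commutator and go through a third index. *)
Lemma Hs_row i j k r x : j != i -> j != rev_ord i -> k != i -> k != rev_ord i ->
  Hs i j x -> Hs i k (r * x).
Proof.
move=> h1 h2 h3 h4 h.
have [l [l1 l2 l3 l4]] := exists_index i j hn.
have hl r' : Hs i l (r' * x) by apply: Hs_step h => //; idx.
have [e|ne] := eqVneq j k; first by rewrite -e -[x]mul1r; apply: (Hs_step (j := l)) => //; idx.
have [e|ne'] := eqVneq j (rev_ord k); last exact: Hs_step h.
rewrite -[x]mul1r; apply: (Hs_step (j := l)) => //.
  by apply/eqP => e'; move: l4; rewrite e e' rev_ordK eqxx.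
by rewrite -e.
Qed.

(** Row moves multiply on the left; a row move between two flips multiplies on the right, and the
    factors [lam] and [bar] of the flips cancel. *)
Lemma Hs_move i j k l r r' x : j != i -> j != rev_ord i -> l != k -> l != rev_ord k ->
  Hs i j x -> Hs k l (r * x * r').
Proof.
move=> h1 h2 h3 h4.
suff one i' j' r0 y : j' != i' -> j' != rev_ord i' -> l != i' -> l != rev_ord i' ->
    Hs i' j' y -> Hs k l (r0 * y * r').
  move=> h; have [d [d1 d2 _ _]] := exists_index i i hn.
  have [c [c1 c2 c3 c4]] := exists_index l d hn.
  have hd : Hs i d (1 * x) by apply: Hs_row h.
  have hdc : Hs c d x.
    have h' : Hs d c (1 * - (lam * bar x)).
      apply: (Hs_row (j := i)); rewrite 1?mul1r; try idx.
      by apply: Hs_flip; rewrite mul1r in hd.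
    have := Hs_flip h'; rewrite mul1r barN barM barK mulrN opprK.
    by rewrite -liC mulrA lam_li mul1r.
  by apply: (one c d r x) => //; idx.
move=> h5 h6 h7 h8 h.
have e1 : Hs l i' (1 * - (lam * bar (r0 * y))).
  by rewrite mul1r; apply: Hs_flip; exact: Hs_row h.
have e2 : Hs l k (bar r' * (1 * - (lam * bar (r0 * y)))).
  by apply: (Hs_row (j := i')) e1; idx.
have := Hs_flip e2; rewrite mul1r mulrN barN mulrN opprK !barM !barK.
by rewrite -(liC S (r0 * y)) !mulrA lam_li mul1r.
Qed.

Lemma Hs0 i j : Hs i j 0.
Proof. by rewrite /Hs raddf0 mulmx0 trv00; exact: sub1. Qed.
Lemma short_mul i j (x y : 'M[R]_1) : j != i -> j != rev_ord i ->
  trv (ee i) (ee j *m x) 0 *m trv (ee i) (ee j *m y) 0 = trv (ee i) (ee j *m (x + y)) 0.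
Proof.
move=> h1 h2; have jj : star (ee j) *m ee j = 0 by exact/iso_star/iso_ee.
rewrite trv_mul ?star_ee_eex //; last exact/iso_star/iso_ee.
by rewrite starM -mulmxA (mulmxA (star _)) jj mul0mx mulmx0 scaler0 subr0 addr0 mulmxDr.
Qed.
Lemma HsD i j x y : j != i -> j != rev_ord i -> Hs i j x -> Hs i j y -> Hs i j (x + y).
Proof. by move=> h1 h2 hx hy; rewrite /Hs raddfD /= -short_mul //; exact: subM. Qed.
Lemma HsN i j x : j != i -> j != rev_ord i -> Hs i j x -> Hs i j (- x).
Proof.
by move=> h1 h2 hx; apply: (subV HH hx); rewrite raddfN; exact: short_inv.
Qed.

Lemma Hs_level i j x : j != i -> j != rev_ord i -> Hs i j x -> level x.
Proof.
by move=> h1 h2 h k l h3 h4; rewrite -[x]mul1r -[1 * x]mulr1; exact: Hs_move h.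
Qed.

Lemma level_indices : exists i j : 'I_N, j != i /\ j != rev_ord i.
Proof.
have i0 : 'I_N by exists 0%N; lia.
by have [l [l1 l2 _ _]] := exists_index i0 i0 hn; exists i0, l.
Qed.

Lemma level0 : level 0. Proof. by move=> i j _ _; exact: Hs0. Qed.
Lemma levelD x y : level x -> level y -> level (x + y).
Proof. by move=> hx hy i j h1 h2; apply: HsD; [| |exact: hx|exact: hy]. Qed.
Lemma levelN x : level x -> level (- x).
Proof. by move=> hx i j h1 h2; apply: HsN; last exact: hx. Qed.
Lemma level_mul r r' x : level x -> level (r * x * r').
Proof. by move=> hx i j h1 h2; apply: (Hs_move r r' h1 h2); last exact: hx. Qed.
Lemma levelMl r x : level x -> level (r * x).
Proof. by move=> hx; rewrite -[r * x]mulr1; exact: level_mul. Qed.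
Lemma levelMr r x : level x -> level (x * r).
Proof. by move=> hx; rewrite -[x]mul1r; exact: level_mul. Qed.
Lemma level_bar x : level x -> level (bar x).
Proof.
move=> hx; have [i [j [h1 h2]]] := level_indices.
have h : level (- (lam * bar x)).
  by apply: (@Hs_level j i); [idx|idx|apply: Hs_flip; exact: hx].
have := levelMl li (levelN h); rewrite opprK mulrA li_lam mul1r; exact.
Qed.

(** Splitting at e_i + e_k r returns the long root element itself times a transvection at e_k that
    carries a short part and a long part. *)
Lemma long_conj t t' i k r al : unitary S t -> inv2 t t' -> t *m ee i = ee i + ee k *m r%:M ->
  k != i -> k != rev_ord i -> fLam S al ->
  t *m trv (ee i) 0 (- (li *: al%:M)) *m t' =
  trv (ee i) 0 (- (li *: al%:M)) *m trv (ee k) (ee i *m (al * bar r)%:M) (- (li *: (r * al * bar r)%:M)).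
Proof.
move=> ht tt te ki ki' hal; set a := - _.
have hal1 : Lam1 S (al%:M) by rewrite /Lam1 scal11.
have aE : adj S a = al%:M.
  by rewrite /a adjN adjZ ?barK; [rewrite [RHS](Lam1_skew hal1)|exact: liC].
have ii : star (ee i) *m ee i = 0 by exact/iso_star/iso_ee.
have kk : star (ee k) *m ee k = 0 by exact/iso_star/iso_ee.
have ik : star (ee i) *m (ee k *m r%:M) = 0 by exact: star_ee_eex.
have ki0 : star (ee k) *m ee i = 0 by apply: star_ee_ee; idx.
rewrite trv_conj ?mulmx0 ?te //; last exact: unitary_J.
rewrite trv_add ?mulmx0 //; first last.
- by have := tv_cond (0 : col) hal1; rewrite ff0l add0r -/a mulmx0.
- by apply/iso_star/isoM/iso_ee.
rewrite -mulmxA !trv_scale mul0mx mulmx0 mul0mx trv_mul ?mulmx0 //; last first.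
  by rewrite aE -mulmxA mulmxA ki0 mul0mx.
congr (_ *m trv _ _ _).
  by rewrite add0r aE adj_scalar -mulmxA scalar_mxM.
rewrite star0 mul0mx scaler0 subr0 addr0 /a adj_scalar mulmxN mulNmx; congr (- _).
by rewrite mulmxZ; [rewrite -scalemxAl -!scalar_mxM|exact: liC].
Qed.

(** [heis_short] puts the short coefficient into the level, so the short factor lies in [H] and can
    be divided out. *)
Lemma heis_split k i x (a : 'M_1) : i != k -> i != rev_ord k ->
  H (trv (ee k) (ee i *m x%:M) a) -> level x /\ H (trv (ee k) 0 a).
Proof.
move=> h1 h2 h; have vk : (ee i *m x%:M) (rev_ord k) 0 = 0.
  by rewrite eex_entry; have -> : (rev_ord k == i) = false by idx.
have [m [c [m1 m2 hm [c' hc]]]] := heis_short HH HN hn vk h h1 h2.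
have hx : level x.
  rewrite eex_entry eqxx scal11 in hm.
  by have := levelMl c' (Hs_level m1 m2 hm); rewrite mulrA hc mul1r.
split=> //; apply: (sub_cancel_r HH HU (hx _ _ h1 h2)); rewrite trv_mul ?mulmx0 //.
- by rewrite star0 mul0mx scaler0 subr0 add0r addr0.
- exact/iso_star/iso_ee.
- exact: star_ee_eex.
Qed.

Lemma Hl_move i k r al : fLam S al -> Hl i al -> k != i -> k != rev_ord i ->
  level (al * bar r) /\ Hl k (r * al * bar r).
Proof.
move=> hal h ki ki'; have [y [ht tt _ te]] := exists_shift S r ki ki'.
have := sub_conj HN ht tt h; rewrite (long_conj (EU_unitary ht) tt te) //.
by move=> /(sub_cancel_l HH HU h) /heis_split; apply; idx.
Qed.

Lemma Hl_level i al : fLam S al -> Hl i al -> level al.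
Proof.
move=> hal h; have [k [k1 k2 _ _]] := exists_index i i hn.
by have [+ _] := Hl_move 1 hal h k1 k2; rewrite bar1 mulr1.
Qed.

Lemma Hl_flevel i r al : fLam S al -> Hl i al -> flevel (r * al * bar r).
Proof.
move=> hal h; split=> [|k]; first exact: Lam_conj.
have [l [l1 l2 l3 l4]] := exists_index i k hn.
have [_] := Hl_move 1 hal h l1 l2; rewrite bar1 mulr1 mul1r => hl.
have kl : k != l by idx.
have kl' : k != rev_ord l by idx.
by have [] := Hl_move r hal hl kl kl'.
Qed.

Lemma Hl0 i : Hl i 0.
Proof. by rewrite /Hl raddf0 scaler0 oppr0 trv00; exact: sub1. Qed.
Lemma HlD i a b : Hl i a -> Hl i b -> Hl i (a + b).
Proof.
move=> ha hb; have := subM HH ha hb; rewrite trv_mul ?mulmx0 //; last exact/iso_star/iso_ee.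
by rewrite addr0 scaler0 subr0 /Hl [(a + b)%:M]raddfD /= scalerDr opprD.
Qed.
Lemma HlN i a : Hl i a -> Hl i (- a).
Proof. by move=> ha; apply: (subV HH ha); rewrite raddfN; exact: long_inv. Qed.

(** Directions e_j and e_{-j} at the same e_i do not commute: the commutator lies in the centre of
    the Heisenberg group and is the long root element sought. *)
Lemma flevel_min x : level x -> flevel (x - lam * bar x).
Proof.
move=> hx; split=> [|i]; first exact: Lam_min.
have [j [j1 j2 _ _]] := exists_index i i hn.
set y := bar (x * bar (mu j)).
have hy : level y by apply/level_bar/levelMr.
have ii : star (ee i) *m ee i = 0 by exact/iso_star/iso_ee.
have k1 : rev_ord j != i by idx.
have k2 : rev_ord j != rev_ord i by idx.
have hA := hy i j j1 j2; have hB := EU_short (S := S) 1%:M k1 k2.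
have AA := short_inv S y%:M j2; have BB := short_inv S 1%:M k2.
have := sub_comm_r HH HN hB BB hA AA.
set v := ee j *m y%:M; set w := ee (rev_ord j) *m 1%:M.
have iv : star (ee i) *m v = 0 by exact: star_ee_eex.
have iw : star (ee i) *m w = 0 by exact: star_ee_eex.
set c := - (li *: (star v *m w - star w *m v)).
have E : trv (ee i) 0 c *m (trv (ee i) w 0 *m trv (ee i) v 0) = trv (ee i) v 0 *m trv (ee i) w 0.
  rewrite !trv_mul ?mulmxDr ?iv ?iw ?mulmx0 ?addr0 //.
  rewrite star0 !mul0mx addr0 scaler0 subr0 !add0r [w + v]addrC; congr trv.
  by rewrite /c -opprD -scalerDr subrK.
have jw : star v *m w = (x * bar (mu j) * mu j)%:M.
  by rewrite /v /w mulmx1 starM -mulmxA star_ee_rev adj_scalar barK -scalar_mxM.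
rewrite -E -!mulmxA (mulmxA (trv (ee i) v 0)) (proj1 AA) mul1mx (proj1 BB) mulmx1 /c.
rewrite (star_sym _ w v) jw muK adj_scalar /Hl [(_ - _)%:M]raddfB /=.
by rewrite scale_scalar_mx.
Qed.

(** The commutator of a short root element of [H] with an arbitrary long one is evaluated by
    [long_conj], and [heis_split] isolates its long part. *)
Lemma flevel_conj_Lam z al : level z -> fLam S al -> flevel (z * al * bar z).
Proof.
move=> hz hal; split=> [|k]; first exact: Lam_conj.
have [i [i1 i2 _ _]] := exists_index k k hn.
have ki : k != i by idx.
have ki' : k != rev_ord i by idx.
have [y [ht tt ey te]] := exists_shift S z ki ki'.
have hy : level y by rewrite ey; apply/level_bar/levelMr.
have h1 : rev_ord i != k by idx.
have h2 : rev_ord i != rev_ord k by idx.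
have hT := hy _ _ h1 h2; have hL := EU_long (n := n) i (al := al%:M).
have {}hL : EU (trv (ee i) 0 (- (li *: al%:M))) by apply: hL; rewrite /Lam1 scal11.
have LL := long_inv S i al%:M.
have := sub_comm_r HH HN hL LL hT tt.
rewrite (long_conj (EU_unitary ht) tt te) // => /(sub_conj HN (EUV hL LL) (inv2_sym LL)).
rewrite !mulmxA (proj2 LL) mul1mx -!mulmxA (proj2 LL) mulmx1.
by case/heis_split.
Qed.

Lemma gen_add_elim (P Q : R -> Prop) x : gen_add P x -> Q 0 -> (forall x, P x -> Q x) ->
  (forall x y, Q x -> Q y -> Q (x + y)) -> (forall x, Q x -> Q (- x)) -> Q x.
Proof. by move=> h q0 qP qD qN; elim: h => *; auto. Qed.

Lemma flevelD a b : flevel a -> flevel b -> flevel (a + b).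
Proof. by move=> [h1 h2] [h3 h4]; split=> [|i]; [exact: LamD|exact: HlD]. Qed.

Lemma level_form_ideal : form_ideal bar lam (fLam S) level flevel.
Proof.
have [i0 _] := level_indices.
have f0 : flevel 0 by split=> [|i]; [exact: Lam0|exact: Hl0].
have fN x : flevel x -> flevel (- x) by move=> [h1 h2]; split=> [|i]; [exact: LamN|exact: HlN].
have fI x : flevel x -> level x by move=> [h1 h2]; exact: (@Hl_level i0).
split; last split; last split; last split => //; last split; last split.
- split; first by split; [exact: level0|split; [exact: levelD|exact: levelN]].
  by split=> r x hx; [exact: levelMl|exact: levelMr].
- move=> y; split=> [hy|[x [hx ->]]]; last exact: level_bar.
  by exists (bar y); rewrite barK; split=> //; exact: level_bar.
- by split=> //; split=> //; exact: flevelD.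
- move=> x [xi [y [hxi [hy ->]]]]; apply: flevelD; first exact: flevel_min.
  apply: (gen_add_elim hy) => //; last exact: flevelD.
  by move=> z [zeta [a [hz [ha ->]]]]; exact: flevel_conj_Lam.
- by move=> x hx; split; [exact: fI|case: hx].
- by move=> a x [h1 h2]; exact: (@Hl_flevel i0).
Qed.

Lemma EU_rel_level s : EU_rel bar lam (fLam S) level flevel s -> H s.
Proof.
move=> hs; suff [] : H s /\ EU s by [].
apply: (hs (fun s => H s /\ EU s)) => [|t []//|e e' t he h1 h2 [ht ht']|t].
- split; first by split; [exact: sub1|exact: EU1].
  split=> [a b [h1 h2] [h3 h4]|a [h1 h2]]; first by split; [exact: subM|exact: EUM].
  by have [b hb ab] := EU_inv h2; exists b; split; [split=> //; exact: subV ab|].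
- by split; [exact: HN|exact: EU_normalized].
- move=> /rel_gensP [[p [q [x [h1 h2 hx ->]]]]|[p [al [[h1 h2] ->]]]]; split.
  + have := level_bar (levelMr (bar (mu q)) hx); rewrite muKV barK => hx'.
    by rewrite [x]mx11_scalar; exact: hx'.
  + exact: EU_short.
  + by have := HlN (h2 p); rewrite opprK /Hl -mx11_scalar.
  + by apply: EU_long; have := LamN h1; rewrite opprK.
Qed.

End Level.

(** * The form defect modulo Gamma *)

Section PhiMod.
Variables (R : nzRingType) (S : form_ring R) (n : nat) (I G : R -> Prop).
Local Notation bar := (fbar S).
Local Notation lam := (flam S).
Local Notation N := (n + n)%N.
Local Notation col := 'cV[R]_N.
Local Notation mem := (mem_mx I).
Local Notation G1 := (G1 G).
Local Notation phi := (phi S).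
Local Notation ff := (ff S).
Implicit Types (u v w : col) (s t : 'M[R]_N).
Hypothesis hI : form_ideal bar lam (fLam S) I G.

Lemma phiV s s' u : inv2 s s' -> phi s' u = - phi s (s' *m u).
Proof.
move=> [ss _]; have := phiM S s s' u; rewrite ss phi1 => /eqP; rewrite eq_sym addr_eq0 => /eqP ->.
by rewrite opprK.
Qed.

Lemma mem_ff_near s u v : mem (s - 1%:M) -> mem (ff (s *m u) (s *m v) - ff u v).
Proof.
move=> h.
have -> : ff (s *m u) (s *m v) - ff u v =
    ff (s *m u) ((s - 1%:M) *m v) + ff ((s - 1%:M) *m u) v.
  by rewrite !mulmxBl !mul1mx ffDr ffNr ffDl ffNl addrA subrK.
apply: (mem_mxD hI); rewrite !ffdef; first by apply: (mem_mxMr hI); exact: (mem_mxMl hI).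
by apply: (mem_mxMl hI); apply: (mem_mxMl hI); apply: (mem_adj hI); exact: (mem_mxMl hI).
Qed.

Lemma phi_add s u v : unitary S s -> mem (ff (s *m v) (s *m u) - ff v u) ->
  G1 (phi s (u + v) - (phi s u + phi s v)).
Proof.
move=> hs h; rewrite phiD // addrC addrA addNr add0r; exact: (G1_min hI).
Qed.

Lemma G1_trans (a b c : 'M[R]_1) : G1 (a - b) -> G1 (b - c) -> G1 (a - c).
Proof.
by move=> h1 h2; have := G1D hI h1 h2; rewrite addrA subrK.
Qed.

(** The defects of [t] and [t'] cancel up to congruent columns, and those of [s] at t' u and at u
    combine by additivity modulo Gamma. *)
Lemma phi_step t t' s s' u : unitary S t -> unitary S s -> inv2 t t' -> inv2 s s' ->
  mem (s - 1%:M) -> G1 (phi (t *m s *m t' *m s') u - phi s ((t' - 1%:M) *m u)).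
Proof.
move=> ht hs tt ss ms; rewrite !phiM (phiV u ss) mulmxBl mul1mx.
set w := s' *m u; rewrite (phiV w tt).
have hw : mem (w - u).
  have := mem_mxMl hI u (mem_inv hI ss ms); rewrite mulmxBl mul1mx; exact.
have h1 : G1 (phi t (s *m (t' *m w)) - phi t (t' *m w)).
  apply: (phi_congr hI) => //.
  by have := mem_mxMl hI (t' *m w) ms; rewrite mulmxBl mul1mx.
have h2 : G1 (phi s (t' *m w) - (phi s w + phi s (t' *m w - w))).
  rewrite -{1}(subrK w (t' *m w)) addrC; rewrite [_ - w + w]addrC.
  by rewrite addrC; apply: phi_add => //; exact: mem_ff_near.
have h3 : G1 (phi s (t' *m w - w) - phi s (t' *m u - u)).
  apply: (phi_congr hI) => //.
  have -> : t' *m w - w - (t' *m u - u) = t' *m (w - u) - (w - u) by rewrite mulmxBr; abel.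
  by apply: (mem_mxD hI); [exact: (mem_mxMr hI)|exact: (mem_mxN hI)].
have E (a b c d f g : 'M[R]_1) : a - b + (c - (d + f) + (f - g)) = a + c - b - d - g by abel.
by have := G1D hI h1 (G1D hI h2 h3); rewrite E.
Qed.

Lemma phi_conj_step t t' s u : unitary S t -> unitary S s -> inv2 t t' -> mem (s - 1%:M) ->
  G1 (phi (t *m s *m t') u - phi s (t' *m u)).
Proof.
move=> ht hs tt ms; rewrite !phiM (phiV u tt).
have := mem_mxMl hI (t' *m u) ms; rewrite mulmxBl mul1mx.
have E (a b c : 'M[R]_1) : a + c - b - c = a - b by abel.
by move=> /(phi_congr hI ht); rewrite E.
Qed.

Lemma phi_ee s p (x : 'M_1) : phi s (@ee R n p *m x) = adj S x *m phi s (ee R p) *m x.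
Proof. by rewrite /phi mulmxA !ffM mulmxBr mulmxBl. Qed.

(** The defect is additive modulo Gamma when [s] preserves f modulo [I], so basis vectors
    suffice. *)
Lemma mem_sum_ee s : unitary S s -> (forall u v, mem (ff (s *m u) (s *m v) - ff u v)) ->
  (forall p, G1 (phi s (@ee R n p))) -> forall u, G1 (phi s u).
Proof.
move=> hs h1 h2 u; rewrite (col_sum u); apply: (big_ind (fun u => G1 (phi s u))) => [|v w hv hw|p _].
- by rewrite /phi mulmx0 ff0l subrr; exact: (G1_0 hI).
- have := G1D hI (phi_add hs (h1 w v)) (G1D hI hv hw); rewrite subrK; exact.
- by rewrite phi_ee; exact: (G1_conj hI).
Qed.

End PhiMod.

(** * Elements of the subgroup close to root elements *)

Section Near.
Variables (R : nzRingType) (S : form_ring R) (n : nat).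
Local Notation bar := (fbar S).
Local Notation lam := (flam S).
Local Notation li := (fbar S (flam S)).
Local Notation N := (n + n)%N.
Local Notation col := 'cV[R]_N.
Local Notation ee := (@ee R n).
Local Notation mu := (@mu R S n).
Local Notation EU := (@EU R bar lam n (fLam S)).
Local Notation trv := (trv S).
Local Notation star := (star S).
Local Notation phi := (phi S).
Local Notation ff := (ff S).
Implicit Types (u v w : col) (p q i j k l : 'I_N) (x y : 'M[R]_1).
Variable H : 'M[R]_N -> Prop.
Hypotheses (HH : is_subgroup H) (HU : forall s, H s -> unitary S s) (HN : normalized_by EU H).
Hypotheses (hn : (3 <= n)%N) (LF : locally_finite S).
Implicit Types (s t e : 'M[R]_N).
Local Notation I := (level S H).
Local Notation G := (flevel S H).
Local Notation mem := (mem_mx I).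
Local Notation G1 := (G1 G).
Let hI := level_form_ideal HH HU HN hn.

(* [H] contains [t] up to a unitary factor congruent to [1], whose form defect is that of [s]
   after the substitution [B]. *)
Definition near s t (B : 'M[R]_N) : Prop := exists r,
  [/\ unitary S r, mem (r - 1%:M), H (t *m r) & forall u, G1 (phi r u - phi s (B *m u))].

(** [e, t r] = [e, t] t [e, r] t', so [r] is replaced by t [e, r] t', whose defect at [u] is that of
    [r] at (e' - 1) t' u. *)
Lemma near_step s t t' B e e' : unitary S t -> inv2 t t' -> EU e -> inv2 e e' -> near s t B ->
  near s (e *m t *m e' *m t') (B *m (e' - 1%:M) *m t').
Proof.
move=> ht tt he ee' [r [hr mr Hr hB]].
have [r' rr] := unitary_inv2 hr.
have eU := EU_unitary he.
have ms0 : mem (e *m r *m e' *m r' - 1%:M).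
  have -> : e *m r *m e' *m r' - 1%:M = e *m (r - 1%:M) *m e' *m r' + (r' - 1%:M).
    by rewrite mulmxBr mulmx1 mulmxBl (proj1 ee') mulmxBl mul1mx addrA subrK.
  apply: (mem_mxD hI); last exact: (mem_inv hI rr).
  by apply: (mem_mxMl hI); apply: (mem_mxMl hI); exact: (mem_mxMr hI).
have U0 : unitary S (e *m r *m e' *m r').
  apply: unitaryM; last exact: unitaryV rr.
  by apply: unitaryM; [exact: unitaryM|exact: unitaryV ee'].
exists (t *m (e *m r *m e' *m r') *m t'); split.
- by apply: unitaryM; [exact: unitaryM|exact: unitaryV tt].
- have -> : t *m (e *m r *m e' *m r') *m t' - 1%:M = t *m (e *m r *m e' *m r' - 1%:M) *m t'.
    by rewrite mulmxBr mulmx1 mulmxBl (proj1 tt).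
  by apply: (mem_mxMl hI); exact: (mem_mxMr hI).
- have := sub_comm_l HH HN he ee' Hr (inv2_mul tt rr); congr H.
  by rewrite !mulmxA -(mulmxA _ t' t) (proj2 tt) mulmx1 -(mulmxA _ e' e) (proj2 ee') mulmx1.
- move=> u; apply: (G1_trans hI (phi_conj_step hI u ht U0 tt ms0)).
  apply: (G1_trans hI (phi_step hI _ eU hr ee' rr mr)).
  by rewrite -!mulmxA; exact: hB.
Qed.

Lemma UR_comm_sub r r' e e' : U_rel bar lam (fLam S) I G r -> EU e -> inv2 r r' -> inv2 e e' ->
  H (e *m r *m e' *m r').
Proof.
move=> hr he rr' ee'; have h := UR_EU_comm hI hn LF hr he rr' ee'.
apply: (EU_rel_level HH HN hn); apply: (ERV h).
by have := inv2_mul (inv2_mul rr' ee') (inv2_mul (inv2_sym rr') (inv2_sym ee')); rewrite !mulmxA.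
Qed.

Lemma short_img p q x w : star (ee p) *m w = 0 ->
  trv (ee p) (ee q *m x) 0 *m w = w + ee p *m (star (ee q *m x) *m w).
Proof. by move=> h; rewrite trv0E h mulmx0 scaler0 subr0. Qed.

(** Three commutators move the short root element around until the accumulated substitution is zero.
    The remaining factor then lies in U(I, Gamma), its commutators with EU lie in [H], and a fourth
    commutator yields a genuine short root element of [H]. *)
Lemma level_of_near i l x s : l != i -> l != rev_ord i -> unitary S s -> mem (s - 1%:M) ->
  H (trv (ee i) (ee l *m x) 0 *m s) -> I (x 0 0).
Proof.
move=> li1 li2 hs ms hH; have [q [q1 q2 q3 q4]] := exists_index i l hn.
have lq : l != q by idx.
have lq' : l != rev_ord q by idx.
have ql' : rev_ord l != q by idx.
have ql : q != rev_ord l by idx.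
have l1 : rev_ord l != i by idx.
have l2 : rev_ord l != rev_ord i by idx.
have qq' : q != rev_ord (rev_ord l) by idx.
have n0 : near s (trv (ee i) (ee l *m x) 0) 1%:M.
  by exists s; split=> // u; rewrite mul1mx subrr; exact: (G1_0 hI).
have US p q' (z : 'M_1) : q' != p -> q' != rev_ord p -> unitary S (trv (ee p) (ee q' *m z) 0).
  by move=> h1 h2; apply: EU_unitary; exact: EU_short.
have [y1 [e1 ie1 c1]] := short_commutator S 1%:M x li1 li2 q1 q2 lq lq'.
have := near_step (US _ _ _ li1 li2) (short_inv S x li2) e1 ie1 n0; rewrite c1 !mul1mx => n1.
have [y2 [e2 ie2 c2]] := short_commutator S 1%:M x q1 q2 l1 l2 ql qq'.
have := near_step (US _ _ _ q1 q2) (short_inv S x q2) e2 ie2 n1; rewrite c2 !mul1mx => n2.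
set x' := - (lam *: adj S x).
(* Read from its other vector, the root element offers the index [i] as direction for the next
   commutator. *)
have flip : trv (ee i) (ee (rev_ord l) *m x) 0 = trv (ee (rev_ord l)) (ee i *m x') 0.
  by rewrite trv_swap /x' mulmxN mulmxZ //; exact: lamC.
rewrite flip in n2.
have i1 : i != rev_ord l by idx.
have i2 : i != rev_ord (rev_ord l) by idx.
have iq : i != q by idx.
have iq' : i != rev_ord q by idx.
have [y3 [e3 ie3 c3]] := short_commutator S 1%:M x' i1 i2 ql qq' iq iq'.
have := near_step (US _ _ _ i1 i2) (short_inv S x' i2) e3 ie3 n2; rewrite c3 !mul1mx.
move=> [r [hr mr Hr hB]].
have UR : U_rel bar lam (fLam S) I G r.
  apply/(U_relP); split=> // u; have := hB u; set B := _ *m _ *m u.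
  (* The factors of [B], applied from right to left, shrink the support: e_q and e_{-i}, then
     e_{-l}, then e_{-l} and e_i, which the last factor fixes before 1 is subtracted. *)
  have -> : B = 0.
    rewrite /B -!mulmxA; move: (trv (ee (rev_ord l)) _ 0 *m u) => {B}u.
    have [a1 [a2 ->]] : exists a1 a2 : 'M_1, (trv (ee q) (ee (rev_ord i) *m - y3) 0 - 1%:M) *m u =
        ee q *m a1 + ee (rev_ord i) *m a2.
      exists (star (ee (rev_ord i) *m - y3) *m u), (li *: (y3 *m (star (ee q) *m u))).
      have E (b1 b2 b3 : col) : b1 + b2 - b3 - b1 = b2 - b3 by abel.
      rewrite mulmxBl mul1mx trv0E E mulmxN mulNmx scalerN opprK.
      by rewrite mulmxZ ?mulmxA //; exact: liC.
    have [a3 ->] : exists a3 : 'M_1, trv (ee i) (ee q *m - x) 0 *m (ee q *m a1 + ee (rev_ord i) *m a2) =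
        ee q *m a3 + ee (rev_ord i) *m a2.
      have fq : trv (ee i) (ee q *m - x) 0 *m ee q = ee q by apply: short_fix; idx.
      exists (a1 + li *: (x *m (mu i)%:M *m a2)); rewrite mulmxDr (mulmxA (trv _ _ _)) fq mulmxDr.
      rewrite -addrA; congr (_ + _); rewrite mulmxA trv0E star_ee_rev starM -(mulmxA _ _ (ee (rev_ord i))).
      rewrite star_ee_ee; last by idx.
      rewrite !mulmx0 addr0 mulmxBl addrC; congr (_ + _).
      rewrite mulmxN mulNmx scalerN mulNmx opprK mulmxZ; last exact: liC.
      by rewrite -scalemxAl !mulmxA.
    have [a4 ->] : exists a4 : 'M_1, (trv (ee (rev_ord l)) (ee (rev_ord q) *m - y2) 0 - 1%:M) *m
        (ee q *m a3 + ee (rev_ord i) *m a2) = ee (rev_ord l) *m a4.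
      have z : star (ee (rev_ord l)) *m (ee q *m a3 + ee (rev_ord i) *m a2) = 0.
        by rewrite mulmxDr !mulmxA !star_ee_ee ?mul0mx ?addr0 //; idx.
      eexists; rewrite mulmxBl mul1mx short_img // addrC addKr; reflexivity.
    have [a5 ->] : exists a5 : 'M_1, trv (ee i) (ee l *m - x) 0 *m (ee (rev_ord l) *m a4) =
        ee (rev_ord l) *m a4 + ee i *m a5.
      have z : star (ee i) *m (ee (rev_ord l) *m a4) = 0 by apply: star_ee_eex; idx.
      eexists; rewrite short_img //; reflexivity.
    have f1 : trv (ee q) (ee (rev_ord l) *m - y1) 0 *m ee (rev_ord l) = ee (rev_ord l).
      by apply: short_fix; idx.
    have f2 : trv (ee q) (ee (rev_ord l) *m - y1) 0 *m ee i = ee i by apply: short_fix; idx.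
    by rewrite mulmxBl mul1mx mulmxDr !(mulmxA (trv _ _ _)) f1 f2 subrr.
  by rewrite /phi mulmx0 ff0l subrr subr0.
have q5 : q != rev_ord i by idx.
have qi : q != i by idx.
(* The commutator of the product with one more elementary matrix splits into a short root element
   and a conjugate of a commutator of [r]; the latter is in [H]. *)
have [y4 [e4 ie4 c4]] := short_commutator S 1%:M x' ql qq' i1 i2 qi q5.
set T := trv (ee (rev_ord l)) (ee q *m x') 0 in Hr c4.
have TT : inv2 T (trv (ee (rev_ord l)) (ee q *m - x') 0) by exact: short_inv.
set T' := trv (ee (rev_ord l)) (ee q *m - x') 0 in TT c4.
have [r' rr] := unitary_inv2 hr.
have eT : EU T by exact: EU_short.
have h1 := sub_conj HN eT TT (UR_comm_sub UR e4 rr ie4).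
have h2 := sub_comm_l HH HN e4 ie4 Hr (inv2_mul TT rr).
have hs4 : H (trv (ee (rev_ord l)) (ee i *m x') 0).
  rewrite mul1mx in c4; rewrite -c4; apply: (sub_cancel_r HH HU h1); move: h2; congr H.
  have K (u v w : 'M[R]_N) : v *m w = 1%:M -> u *m v *m w = u by move=> h; rewrite -mulmxA h mulmx1.
  by rewrite !mulmxA (K _ _ _ (proj2 TT)) (K _ _ _ (proj2 ie4)).
have lx : I (x' 0 0).
  by rewrite [x']mx11_scalar in hs4; exact: (Hs_level HH HN hn i1 i2 hs4).
have := level_bar HH HN hn lx; rewrite /x' !mxE barN barM barK => h.
have := levelN HH (levelMr HH HN hn lam h).
by rewrite mulNr opprK -mulrA li_lam mulr1.
Qed.

(** It suffices to treat e_p. Two commutators replace [s] by some [r] in [H] whose defect comes from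
    e_p alone, like that of a long root element. Comparing [r] with this root element through the
    relative commutator formula puts its coefficient into Gamma. *)
Lemma sub_near1_phi s u : H s -> mem (s - 1%:M) -> G1 (phi s u).
Proof.
move=> hs ms; have us := HU hs.
apply: (mem_sum_ee hI) => // [{}u v|p]; first exact: (mem_ff_near hI).
have [q [q1 q2 _ _]] := exists_index p p hn.
(* The sign makes the long root element with coefficient [al] compensate the defect. *)
set al := (- phi s (ee p)) 0 0.
have alE : phi s (ee p) = - al%:M by rewrite /al -mx11_scalar opprK.
have hal : fLam S al by exact: (Lam1N (unitary_phi (ee p) us)).
have Ial : I al.
  have := mem_mxN hI (mem_ff_near hI (ee p) (ee p) ms); exact.
suff h : G al.
  have := fg_N hI h; rewrite /G1 alE !mxE mulr1n; exact.
have q1' : rev_ord q != p by idx.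
have q2' : rev_ord q != rev_ord p by idx.
have pq : p != q by idx.
have pq' : p != rev_ord q by idx.
have n0 : near s 1%:M 1%:M.
  by exists s; rewrite mul1mx; split=> // {}u; rewrite mul1mx subrr; exact: (G1_0 hI).
have i1 : inv2 (1%:M : 'M[R]_N) 1%:M by split; rewrite mulmx1.
have U1 := @unitary1 R S n.
have step e e' B : EU e -> inv2 e e' -> near s 1%:M B -> near s 1%:M (B *m (e' - 1%:M)).
  by move=> he ee' /(near_step U1 i1 he ee'); rewrite !mulmx1 (proj1 ee').
have := step _ _ _ (EU_short 1%:M q1' q2') (short_inv S 1%:M q2')
  (step _ _ _ (EU_short 1%:M pq pq') (short_inv S 1%:M pq') n0).
rewrite mul1mx => - [r [hr mr Hr hB]]; rewrite mul1mx in Hr.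
(* The central unit produced by the two substitutions, which together map w to e_p c h(e_p, w); it
   cancels in the defect because bar c c = 1. *)
set c := li * (li * mu q).
have cC : central c.
  move=> z; rewrite /c -!mulrA (muC S q z) (mulrA li z) (liC S z) -(mulrA z) (mulrA li z) (liC S z).
  by rewrite -!mulrA.
have cc : bar c * c = 1.
  rewrite /c !barM barK -!mulrA (mulrA lam li) lam_li mul1r (mulrA lam li) lam_li mul1r.
  exact: muVl.
have BE w : (trv (ee q) (ee p *m - 1%:M) 0 - 1%:M) *m
    ((trv (ee p) (ee (rev_ord q) *m - 1%:M) 0 - 1%:M) *m w) = ee p *m (c *: (star (ee p) *m w)).
  have dE u1 v (z : col) : (trv u1 v 0 - 1%:M) *m z = u1 *m (star v *m z) - li *: (v *m (star u1 *m z)).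
    by rewrite mulmxBl mul1mx trv0E; abel.
  rewrite [X in _ *m X]dE !mulmxN !mulmx1 mulNmx scalerN opprK starN.
  set b := star (ee p) *m w; move: (- star _ *m w) => a; set z := ee p *m a + _.
  have pz : star (ee p) *m z = 0.
    rewrite mulmxDr mulmxA (iso_star (iso_ee _ _)) mul0mx add0r mulmxZ; last exact: liC.
    by rewrite mulmxA star_ee_ee ?mul0mx ?scaler0 //; idx.
  have qz : star (ee q) *m z = li *: ((mu q)%:M *m b).
    rewrite mulmxDr mulmxA star_ee_ee ?mul0mx ?add0r; last by idx.
    by rewrite mulmxZ ?mulmxA ?star_ee_rev //; exact: liC.
  rewrite dE starN mulNmx pz qz oppr0 mulmx0 sub0r mulNmx scalerN opprK.
  rewrite mul_scalar_mx (mulmxZ _ _ cC) (mulmxZ _ _ (@liC _ S)) (mulmxZ _ _ (@muC _ S _ q)).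
  by rewrite !scalerA /c mulrA.
have hB' w : G1 (phi r w - adj S (star (ee p) *m w) *m phi s (ee p) *m (star (ee p) *m w)).
  have := hB w; rewrite -mulmxA BE phi_ee adjZ // mulmxZ //.
  by rewrite -!scalemxAl scalerA cC cc scale1r.
(* Modulo Gamma the defects of [L] and [r] are opposite, so L r lies in U(I, Gamma), although [L] is
   not known to lie in [H]. *)
set L := trv (ee p) 0 (- (li *: al%:M)).
have eL : EU L by apply: EU_long; rewrite /Lam1 scal11.
have LL := long_inv S p al%:M; rewrite -/L in LL; set L' := trv _ _ _ in LL.
have UL := EU_unitary eL.
have mL : mem (L - 1%:M).
  rewrite /L trvdef star0 mulmx0 mul0mx scaler0 subr0 addr0 addrC addKr.
  apply: (mem_mxMl hI); apply: (mem_mxMr hI) => i j; rewrite !mxE !ord1 mulr1n.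
  by apply: (fi_N hI); exact: (fi_l hI).
have phiL w : G1 (phi L w - adj S (star (ee p) *m w) *m al%:M *m (star (ee p) *m w)).
  set y := star (ee p) *m w; set d := ee p *m (- (li *: al%:M) *m y).
  have hal1 : Lam1 S (al%:M) by rewrite /Lam1 scal11.
  have Lw : L *m w = w + d.
    rewrite /L trvE star0 !mul0mx mulmx0 scaler0 addr0 subr0 /d mulmxA.
    by rewrite -!mulmxA.
  have dd : ff d d = 0 by rewrite /d ffM ff_ee0 ?neq_rev // mulmx0 mul0mx.
  have dw : star d *m w = adj S y *m al%:M *m y.
    rewrite /d starM adjM adjN adjZ ?barK; last exact: liC.
    by rewrite -[- (lam *: _)](Lam1_skew hal1) !mulmxA.
  have E (b1 b2 b3 b4 : 'M[R]_1) : b1 + b2 + (b3 + 0) - b1 - (b3 + b4) = b2 - b4 by abel.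
  rewrite /phi Lw ffDl !ffDr dd -dw star_ff E; apply: (G1_min hI).
  rewrite ffdef; apply: (mem_mxMr hI); apply: (mem_mxMr hI); apply: (mem_mxMl hI) => i j.
  by rewrite !mxE !ord1 mulr1n; apply: (fi_N hI); exact: (fi_l hI).
have UR : U_rel bar lam (fLam S) I G (L *m r).
  apply/U_relP; split; first exact: unitaryM.
    have -> : L *m r - 1%:M = L *m (r - 1%:M) + (L - 1%:M) by rewrite mulmxBr mulmx1 addrA subrK.
    by apply: (mem_mxD hI) => //; exact: (mem_mxMr hI).
  move=> w; rewrite phiM.
  have h1 : G1 (phi L (r *m w) - phi L w).
    apply: (phi_congr hI) => //.
    have := mem_mxMl hI w mr; rewrite mulmxBl mul1mx; exact.
  have := G1D hI h1 (G1D hI (phiL w) (hB' w)); rewrite alE mulmxN mulNmx opprK.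
  have E (a b d f : 'M[R]_1) : a - b + (b - f + (d + f)) = a + d by abel.
  by rewrite E.
have [k [k1 k2 _ _]] := exists_index p p hn.
have [y [ht tt _ te]] := exists_shift S 1 k1 k2.
have [r' rr] := unitary_inv2 hr.
have h1 := UR_comm_sub UR ht (inv2_mul LL rr) tt.
have h2 := sub_conj HN eL LL (sub_comm_l HH HN ht tt Hr rr).
set t := trv (ee k) _ _ in ht tt te h1 h2; set t' := trv (ee k) _ _ in tt h1 h2.
have : H (t *m L *m t' *m L').
  apply: (sub_cancel_r HH HU h2); move: h1; congr H.
  by rewrite !mulmxA -(mulmxA _ L' L) (proj2 LL) mulmx1 -(mulmxA _ t' t) (proj2 tt) mulmx1.
rewrite /L (long_conj (EU_unitary ht) tt te) // -/L => /(sub_conj HN (EUV eL LL) (inv2_sym LL)).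
rewrite !mulmxA (proj2 LL) mul1mx -!mulmxA (proj2 LL) mulmx1 => /(heis_split HH HU HN hn).
case=> [||_]; try idx.
rewrite bar1 mulr1 mul1r => hk.
by have := Hl_flevel HH HU HN hn 1 hal hk; rewrite bar1 mulr1 mul1r.
Qed.

End Near.

(** * The sandwich theorem *)

Section Sandwich.
Variables (R : nzRingType) (S : form_ring R) (n : nat).
Local Notation bar := (fbar S).
Local Notation lam := (flam S).
Local Notation li := (fbar S (flam S)).
Local Notation N := (n + n)%N.
Local Notation col := 'cV[R]_N.
Local Notation eD := (@ee _ n).
Local Notation trvD D' := (@trv _ D' n).
Local Notation ee := (@ee R n).
Local Notation mu := (@mu R S n).
Local Notation EU := (@EU R bar lam n (fLam S)).
Local Notation trv := (trv S).
Local Notation star := (star S).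
Local Notation phi := (phi S).
Local Notation ff := (ff S).
Implicit Types (u v w : col) (p q i j k l : 'I_N).
Variable H : 'M[R]_N -> Prop.
Hypotheses (HH : is_subgroup H) (HU : forall s, H s -> unitary S s).
Hypotheses (hn : (3 <= n)%N) (LF : locally_finite S).
Implicit Types (s t e : 'M[R]_N).

(** e g e' = g [g', e] with g' the inverse of g, and [CU_EU_comm] puts this commutator into EU(I,
    Gamma). *)
Lemma sandwich_normalized (I G : R -> Prop) : form_ideal bar lam (fLam S) I G ->
  (forall s, EU_rel bar lam (fLam S) I G s -> H s) ->
  (forall s, H s -> CU_rel bar lam (fLam S) I G s) -> normalized_by EU H.
Proof.
move=> hI h1 h2 e e' g he ee1 ee2 hg.
have [g' gg] := unitary_inv2 (HU hg).
have hg' := subV HH hg gg.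
have := subM HH hg (h1 _ (CU_EU_comm hI hn LF (h2 _ hg') he (inv2_sym gg) (conj ee1 ee2))).
by rewrite !mulmxA (proj1 gg) mul1mx.
Qed.

Section Exists.
Hypothesis HN : normalized_by EU H.
Local Notation I := (level S H).
Local Notation G := (flevel S H).
Local Notation mem := (mem_mx I).
Local Notation G1 := (G1 G).
Let hI := level_form_ideal HH HU HN hn.

(** By [level_of_near] the image of [H] over R / I contains no nontrivial short root element, so it
    consists of central scalars. *)
Lemma scalar_mod_level s : H s -> exists2 c, forall x : R, I (c * x - x * c) & mem (s - c%:M).
Proof.
(* The case of 1 in [I] is separated because the quotient must be a nonzero ring. *)
move=> hs; have [h1|h1] := boolp.pselect (I 1).
  have a x : I x by rewrite -[x]mulr1; exact: (fi_l hI).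
  by exists 1 => [x|i j]; exact: a.
have [Q [T [f [hf surj Lsurj ker]]]] := quotient_form_ring hI h1.
have LQ : locally_finite T by case: hf => f1 f2 _; exact: (locally_finite_image f1 f2).
pose K (t : 'M[Q]_N) := exists2 s, H s & map_mx f s = t.
have lift1 (x : 'M[Q]_1) : exists x' : 'M[R]_1, map_mx f x' = x.
  by have [y hy] := surj (x 0 0); exists y%:M; rewrite map_scalar_mx hy -mx11_scalar.
have KH : is_subgroup K.
  split; first by exists 1%:M; [exact: sub1|rewrite map_mx1].
  split=> [a b [a1 ha <-] [b1 hb <-]|a [a1 ha <-]].
    by exists (a1 *m b1); [exact: subM|rewrite map_mxM].
  have [b ab] := unitary_inv2 (HU ha); have [e1 e2] := map_inv2 f ab.
  by exists (map_mx f b); split=> //; exists b => //; exact: subV ab.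
have KU (z : 'M[Q]_N) : K z -> unitary T z by move=> [s1 hs1 <-]; apply: (map_unitary hf) => //; exact: HU.
have KN : normalized_by (Defs.EU (fbar T) (flam T) (fLam T) (n := n)) K.
  move=> e e' g he e1 e2 [g1 hg <-].
  have surj2 x : exists z, f z = x /\ f z = x by have [z hz] := surj x; exists z.
  have [e0 [h0 hef _]] := EU_lift hf hf surj2 Lsurj he.
  have [e0' _ ee0] := EU_inv h0.
  exists (e0 *m g1 *m e0'); first exact: (sub_conj HN).
  have := map_inv2 f ee0; rewrite hef => h; rewrite !map_mxM hef.
  by rewrite (inv2_uniq h (conj e1 e2)).
have NS p q (x : 'M[Q]_1) : q != p -> q != rev_ord p -> K (trvD T (eD p) (eD q *m x) 0) -> x = 0.
  move=> h3 h4 [s1 hs1]; have [x' <-] := lift1 x; rewrite -(map_short hf) => e.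
  have TT := short_inv S x' h4; set t := trv _ _ _ in e TT; set t' := trv _ _ _ in TT.
  have tU : unitary S t by apply: EU_unitary; exact: EU_short.
  have h : I (x' 0 0).
    apply: (@level_of_near _ _ _ _ HH HU HN hn LF p q x' (t' *m s1)) => //.
    - by apply: unitaryM; [exact: unitaryV TT|exact: HU].
    - move=> i j; apply/ker; have := map_mxM f t' s1.
      rewrite e -map_mxM (proj2 TT) map_mx1 => /matrixP /(_ i j).
      by rewrite !mxE rmorphB /= => ->; rewrite rmorph_nat subrr.
    - by rewrite mulmxA (proj1 TT) mul1mx.
  by apply/matrixP => i j; rewrite !ord1 !mxE; apply/ker.
have Ks : K (map_mx f s) by exists s.
have [c0 hc e] := scalar_of_no_short KH KU KN hn NS LQ Ks.
have [c hc0] := surj c0; exists c => [x|i j]; apply/ker.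
  by rewrite rmorphB !rmorphM /= hc0 hc subrr.
rewrite !mxE; have := congr1 (fun A : 'M[Q]_N => A i j) e; rewrite !mxE rmorphB /= => ->.
by rewrite rmorphMn /= hc0 subrr.
Qed.

(** * Elements congruent to a scalar modulo the level *)

Section Element.
Variables (s : 'M[R]_N) (c : R).
Hypotheses (hs : H s) (hc : forall x : R, I (c * x - x * c)) (mc : mem (s - c%:M)).

Lemma mem_comm_scalar a b (A : 'M[R]_(a, b)) : mem (c%:M *m A - A *m c%:M).
Proof.
move=> i j; rewrite mul_scalar_mx; have -> : (c *: A - A *m c%:M) i j = c * A i j - A i j * c.
  by rewrite !mxE (bigD1 j) //= big1 => [|k /negPf h]; rewrite !mxE ?eqxx ?addr0 // h mulr0.
exact: hc.
Qed.

Lemma scalar_act u : mem (s *m u - u *m c%:M).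
Proof.
have -> : s *m u - u *m c%:M = (s - c%:M) *m u + (c%:M *m u - u *m c%:M).
  by rewrite mulmxBl addrA subrK.
by apply: (mem_mxD hI); [exact: (mem_mxMl hI)|exact: mem_comm_scalar].
Qed.

Lemma mem_ff_congr u u' v v' : mem (u - u') -> mem (v - v') -> mem (ff u v - ff u' v').
Proof.
move=> h1 h2; have -> : ff u v - ff u' v' = ff (u - u') v + ff u' (v - v').
  by rewrite ffDl ffNl ffDr ffNr addrA subrK.
apply: (mem_mxD hI); rewrite !ffdef; last exact: (mem_mxMr hI).
by apply: (mem_mxMl hI); apply: (mem_mxMl hI); exact: (mem_adj hI).
Qed.

(** Compare h(s e_p, s e_{-p}) = mu p with its value when [s] is replaced by the scalar. *)
Lemma scalar_norm : I (bar c * c - 1).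
Proof.
have [p _] := level_indices hn.
have e := unitary_star (ee p) (ee (rev_ord p)) (HU hs).
have h u v : mem (star (s *m u) *m (s *m v) - star (u *m c%:M) *m (v *m c%:M)).
  have E (a b a' b' : 'M[R]_1) : a + lam *: adj S b - (a' + lam *: adj S b') =
      a - a' + lam *: adj S (b - b') by rewrite adjB scalerBr; abel.
  rewrite !star_ff E; apply: (mem_mxD hI); first by apply: mem_ff_congr; exact: scalar_act.
  rewrite -mulmx_central; last exact: lamC.
  apply: (mem_mxMl hI); apply: (mem_adj hI).
  by apply: mem_ff_congr; exact: scalar_act.
have := fi_l hI (- bar (mu p)) (h (ee p) (ee (rev_ord p)) 0 0).
rewrite e starM adj_scalar -mulmxA (mulmxA (star _)) star_ee_rev -!scalar_mxM !mxE !mulr1n.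
by rewrite (mulrA (bar c)) -(muC S p (bar c)) mulNr mulrBr !mulrA muVl mul1r opprB.
Qed.

Lemma scalar_ff u v : mem (ff (s *m u) (s *m v) - ff u v).
Proof.
have h := mem_ff_congr (scalar_act u) (scalar_act v).
have -> : ff (s *m u) (s *m v) - ff u v = ff (s *m u) (s *m v) - ff (u *m c%:M) (v *m c%:M) +
   (- ((bar c)%:M *m (c%:M *m ff u v - ff u v *m c%:M)) + (bar c * c - 1)%:M *m ff u v).
  rewrite ffM adj_scalar [(bar c * c - 1)%:M]raddfB /= scalar_mxM mulmxBl mul1mx mulmxBr opprB !mulmxA.
  have E (a b d f : 'M[R]_1) : a - d = a - b + (b - f + (f - d)) by abel.
  exact: E.
apply: (mem_mxD hI) => //; apply: (mem_mxD hI).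
  by apply: (mem_mxN hI); apply: (mem_mxMr hI); exact: mem_comm_scalar.
by apply: (mem_mxMl hI) => i j; rewrite !ord1 scal11; exact: scalar_norm.
Qed.

(** The defect of s t = t s r is computed in two ways; [s] acts as [c] modulo [I], so the defect of
    [t] at s u becomes bar c (phi t u) c. *)
Lemma commutator_mod s' t t' : unitary S t -> inv2 s s' -> inv2 t t' ->
  [/\ unitary S (s' *m t' *m s *m t), mem (s' *m t' *m s *m t - 1%:M) &
  forall u, G1 (phi (s' *m t' *m s *m t) u -
    (phi s (t *m u) - phi s u + (phi t u - (bar c)%:M *m phi t u *m c%:M)))].
Proof.
move=> ht ss tt; set r := _ *m t; have hU := HU hs.
have e : s *m t = t *m s *m r.
  by rewrite /r !mulmxA -(mulmxA t) (proj1 ss) mulmx1 (proj1 tt) mul1mx.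
have mr : mem (r - 1%:M).
  have -> : r - 1%:M = s' *m t' *m ((s - c%:M) *m t - t *m (s - c%:M) + (c%:M *m t - t *m c%:M)).
    have -> : (s - c%:M) *m t - t *m (s - c%:M) + (c%:M *m t - t *m c%:M) = s *m t - t *m s.
      have E (a b d f : 'M[R]_N) : a - b - (d - f) + (b - f) = a - d by abel.
      by rewrite mulmxBl mulmxBr E.
    rewrite mulmxBr /r !mulmxA; congr (_ - _).
    by rewrite -(mulmxA _ t' t) (proj2 tt) mulmx1 (proj2 ss).
  apply: (mem_mxMr hI); apply: (mem_mxD hI); last exact: mem_comm_scalar.
  by apply: (mem_mxD hI); [exact: (mem_mxMl hI)|apply: (mem_mxN hI); exact: (mem_mxMr hI)].
split=> //.
  apply: unitaryM => //; apply: unitaryM => //; apply: unitaryM; [exact: unitaryV ss|exact: unitaryV tt].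
move=> u; have := phiM S s t u; rewrite e !phiM.
have mu1 : mem (r *m u - u) by have := mem_mxMl hI u mr; rewrite mulmxBl mul1mx.
have h1 : G1 (phi s (r *m u) - phi s u) by exact: (phi_congr hI).
have h2 : G1 (phi t (s *m (r *m u)) - (bar c)%:M *m phi t u *m c%:M).
  have -> : (bar c)%:M *m phi t u *m c%:M = phi t (u *m c%:M).
    by rewrite /phi mulmxA !ffM adj_scalar mulmxBr mulmxBl.
  apply: (phi_congr hI) => //.
  have -> : s *m (r *m u) - u *m c%:M = s *m (r *m u - u) + (s *m u - u *m c%:M).
    by rewrite mulmxBr addrA subrK.
  by apply: (mem_mxD hI); [exact: (mem_mxMr hI)|exact: scalar_act].
have E (a b d f g h k : 'M[R]_1) : a + b + d = f + g ->
    d - (f - h + (g - k)) = - ((b - h) + (a - k)).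
  move=> h0; have -> : d = f + g - a - b by rewrite -h0; abel.
  by abel.
move=> h0; rewrite (E _ _ _ _ _ _ _ h0).
by apply: (G1N hI); exact: (G1D hI).
Qed.

(** For elementary [t] the commutator lies in [H] and is congruent to 1, so its defect is in Gamma
    by [sub_near1_phi]; what remains is a relation on the defect of [s]. *)
Lemma commutator_EU s' t t' u : EU t -> inv2 s s' -> inv2 t t' ->
  G1 (phi s (t *m u) - phi s u + (phi t u - (bar c)%:M *m phi t u *m c%:M)).
Proof.
move=> ht ss tt; have [h1 h2 /(_ u) h3] := commutator_mod (EU_unitary ht) ss tt.
have hr : H (s' *m t' *m s *m t).
  rewrite -!mulmxA; apply: (subM HH); first exact: subV ss.
  by rewrite mulmxA; apply: (sub_conj HN) => //; [exact: EUV tt|exact: inv2_sym].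
have := G1B hI (sub_near1_phi HH HU HN hn LF u hr h2) h3.
by rewrite opprB addrC subrK.
Qed.

(** A short root element sending e_p to e_p + e_k has no defect at e_p. Hence [s] has the same
    defect at both columns modulo Gamma, and additivity isolates e_k. *)
Lemma sub_phi u : G1 (phi s u).
Proof.
apply: (mem_sum_ee hI (HU hs)) => [|k]; first exact: scalar_ff.
have [p [p1 p2 _ _]] := exists_index k k hn.
have kp : k != p by idx.
have kp' : k != rev_ord p by idx.
have [y [ht tt _ te]] := exists_shift S 1 kp kp'.
have [s' ss] := unitary_inv2 (HU hs).
have := commutator_EU (ee p) ht ss tt.
have -> : phi (trv (ee k) (ee (rev_ord p) *m y%:M) 0) (ee p) = 0.
  rewrite /phi te mulmx1 ffDl !ffDr !ff_ee0 ?neq_rev ?addr0 ?subrr //; idx.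
rewrite mulmx0 mul0mx subr0 addr0 te mulmx1.
have := phi_add hI (HU hs) (scalar_ff (ee k) (ee p)).
set a := phi s (_ + _); move: (phi s (ee p)) (phi s (ee k)) => b d h1 h2.
have -> : d = (a - b) - (a - (b + d)) by abel.
exact: (G1B hI).
Qed.

(** A long root element realises [a] as a defect; since the defects of [s] lie in Gamma,
    [commutator_EU] reduces to the claim. *)
Lemma Lam_scalar a : Lam1 S a -> G1 (a - (bar c)%:M *m a *m c%:M).
Proof.
move=> ha; have [p0 _] := level_indices hn.
have [p pp] : exists p : 'I_N, epos p.
  by case: (boolP (epos p0)) => h; [exists p0|exists (rev_ord p0); rewrite epos_rev].
have m1 : mu p = 1 by rewrite /mu pp.
set t := trv (ee p) 0 (- (li *: a)).
have ht : EU t by exact: EU_long.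
have tt := long_inv S p a; rewrite -/t in tt; set t' := trv _ _ _ in tt.
have [s' ss] := unitary_inv2 (HU hs).
have := commutator_EU (ee (rev_ord p)) ht ss tt.
have f0 : ff (ee (rev_ord p)) (ee p) = 0.
  rewrite [LHS]mx11_scalar ffE big1 ?raddf0 // => q hq; rewrite !ee_entry.
  case: eqP => [e|_]; last by rewrite bar0 mul0r.
  by move: hq; rewrite e epos_rev pp.
have f1 : ff (ee p) (ee (rev_ord p)) = 1%:M.
  by have := star_ff S (ee p) (ee (rev_ord p)); rewrite f0 adj0 scaler0 addr0 star_ee_rev m1.
have -> : phi t (ee (rev_ord p)) = a.
  rewrite /phi.
  have -> : t *m ee (rev_ord p) = ee (rev_ord p) + ee p *m - (li *: a).
    by rewrite /t trvE star0 !mul0mx !mulmx0 scaler0 addr0 subr0 star_ee_rev m1 mulmx1.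
  have z1 : ff (ee (rev_ord p)) (ee (rev_ord p)) = 0 by apply: ff_ee0; idx.
  have z2 : ff (ee p) (ee p) = 0 by apply: ff_ee0; idx.
  rewrite ffDl !ffDr !ffMr !ffMl f0 f1 z1 z2 !(mulmx0, mul0mx, addr0).
  rewrite adjN adjZ; last exact: liC.
  by rewrite barK mulmx1 add0r subr0 -(Lam1_skew ha).
move=> h; have := G1B hI h (G1B hI (sub_phi (t *m ee (rev_ord p))) (sub_phi (ee (rev_ord p)))).
by rewrite addrC addKr.
Qed.

Lemma CU_rel_of_scalar_mod : CU_rel bar lam (fLam S) I G s.
Proof.
split=> [|t ht]; first exact: HU.
have [s' ss] := unitary_inv2 (HU hs); have [t' tt] := unitary_inv2 ht.
have [h1 h2 h3] := commutator_mod ht ss tt.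
exists (s' *m t' *m s *m t); split; last first.
  by rewrite !mulmxA -(mulmxA t) (proj1 ss) mulmx1 (proj1 tt) mul1mx.
apply/U_relP; split=> // u.
have := G1D hI (h3 u) (G1D hI (G1B hI (sub_phi (t *m u)) (sub_phi u)) (Lam_scalar (unitary_phi u ht))).
by rewrite subrK.
Qed.
End Element.

Lemma sub_CU_rel s : H s -> CU_rel bar lam (fLam S) I G s.
Proof. by move=> hs; have [c h1 h2] := scalar_mod_level hs; exact: CU_rel_of_scalar_mod h2. Qed.

(** * Uniqueness of the form ideal *)

Section Unique.
Variables (I' G' : R -> Prop).
Hypotheses (hI' : form_ideal bar lam (fLam S) I' G').
Hypothesis hE : forall s, EU_rel bar lam (fLam S) I' G' s -> H s.
Hypothesis hC : forall s, H s -> CU_rel bar lam (fLam S) I' G' s.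

Lemma UR_inv s s' : U_rel bar lam (fLam S) I' G' s -> inv2 s s' -> U_rel bar lam (fLam S) I' G' s'.
Proof.
move=> hs ss; have [_ [_ h]] := UR_subgroup n hI'; have [b [hb [e1 e2]]] := h _ hs.
by rewrite (inv2_uniq ss (conj e1 e2)).
Qed.

Lemma UR_sub_comm s s' t t' : H s -> EU t -> inv2 s s' -> inv2 t t' ->
  U_rel bar lam (fLam S) I' G' (t *m s *m t' *m s').
Proof.
move=> hs ht ss tt; apply: (UR_inv (CU_comm hI' (hC hs) (EU_unitary ht) ss tt)).
by have := inv2_mul (inv2_mul ss tt) (inv2_mul (inv2_sym ss) (inv2_sym tt)); rewrite !mulmxA.
Qed.

(** Conversely to EU(I', G') being inside [H], a commutator of a short root element of [H] lies in
    U(I', G'), and one of its entries is [x] up to units and [bar]. *)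
Lemma level_unique x : I' x <-> I x.
Proof.
split=> [hx i j h1 h2|hx]; first by apply: hE; apply: (ER_short hI') => //; rewrite scal11.
have [i [l [l1 l2]]] := level_indices hn.
have [q [q1 q2 q3 q4]] := exists_index i l hn.
have lq : l != q by idx.
have lq' : l != rev_ord q by idx.
have [y [ht tt e]] := short_commutator S 1%:M x%:M l1 l2 q1 q2 lq lq'.
have := UR_sub_comm (hx i l l1 l2) ht (short_inv S x%:M l2) tt; rewrite e mul1mx.
move=> /U_relP [_ /(_ q (rev_ord i)) + _].
have E (A B : 'M[R]_N) p1 p2 : (A - B) p1 p2 = A p1 p2 - B p1 p2 by rewrite !mxE.
have e1 : ((1%:M : 'M[R]_N) q (rev_ord i)) = 0 by rewrite mxE (negPf q2).
rewrite E e1 subr0 -mul_ee short_coord (negPf q1) !ee_entry (negPf q2) !eqxx scal11 mulr1 addr0 sub0r.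
move=> /(fi_N hI') /(fi_l hI' lam) /(fi_r hI' (bar (mu i))).
by rewrite opprK !mulrA lam_li mul1r muKV.
Qed.

(** A commutator of a long root element of [H], conjugated so as to remove that element, is a
    transvection in U(I', G') whose defect at e_{-k} is exactly [a]. *)
Lemma flevel_unique a : G' a <-> G a.
Proof.
split=> [ha|[ha hl]].
  by split=> [|i]; [exact: (fg_Lam hI')|apply: hE; apply: (ER_long hI'); rewrite scal11].
have [k0 _] := level_indices hn.
have [k pk] : exists k : 'I_N, epos k.
  by case: (boolP (epos k0)) => h; [exists k0|exists (rev_ord k0); rewrite epos_rev].
have m1 : mu k = 1 by rewrite /mu pk.
have [p [p1 p2 _ _]] := exists_index k k hn.
have kp : k != p by idx.
have kp' : k != rev_ord p by idx.
have [y [ht tt _ te]] := exists_shift S 1 kp kp'.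
have LL := long_inv S p a%:M; have hL := hl p; rewrite /Hl in hL.
have UL := HU hL.
have := UR_sub_comm hL ht LL tt; rewrite (long_conj (EU_unitary ht) tt te) //.
set L := trv (ee p) 0 _ in LL hL UL *; set L' := trv (ee p) 0 _ in LL *.
move=> h; have := UR_normal hI' (unitaryV UL LL) (inv2_sym LL) h.
rewrite !mulmxA (proj2 LL) mul1mx -!mulmxA (proj2 LL) mulmx1 bar1 !mulr1 mul1r.
move=> /U_relP [_ _ /(_ (ee (rev_ord k)))].
have f0 : ff (ee (rev_ord k)) (ee k) = 0.
  rewrite [LHS]mx11_scalar ffE big1 ?raddf0 // => q hq; rewrite !ee_entry.
  case: eqP => [e|_]; last by rewrite bar0 mul0r.
  by move: hq; rewrite e epos_rev pk.
have f1 : ff (ee k) (ee (rev_ord k)) = 1%:M.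
  by have := star_ff S (ee k) (ee (rev_ord k)); rewrite f0 adj0 scaler0 addr0 star_ee_rev m1.
set c := - (li *: a%:M).
have -> : phi (trv (ee k) (ee p *m a%:M) c) (ee (rev_ord k)) = a%:M.
  rewrite /phi.
  have -> : trv (ee k) (ee p *m a%:M) c *m ee (rev_ord k) =
      ee (rev_ord k) + (ee p *m - (li *: a%:M) + ee k *m c).
    rewrite trvE star_ee_rev m1 !mulmx1 starM -mulmxA star_ee_ee; last by idx.
    rewrite !mulmx0 addr0 -addrA; congr (_ + (_ + _)).
    by rewrite mulmxN mulmxZ //; exact: liC.
  have z1 : ff (ee (rev_ord k)) (ee (rev_ord k)) = 0 by apply: ff_ee0; idx.
  have z2 : ff (ee k) (ee k) = 0 by apply: ff_ee0; idx.
  have z3 : ff (ee p) (ee p) = 0 by apply: ff_ee0; idx.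
  have z4 : ff (ee p) (ee k) = 0 by apply: ff_ee0; idx.
  have z5 : ff (ee k) (ee p) = 0 by apply: ff_ee0; idx.
  have z6 : ff (ee p) (ee (rev_ord k)) = 0 by apply: ff_ee0; idx.
  have z7 : ff (ee (rev_ord k)) (ee p) = 0 by apply: ff_ee0; idx.
  rewrite !ffDl !ffDr !ffMr !ffMl f0 f1 z1 z2 z3 z4 z5 z6 z7 !(mulmx0, mul0mx, addr0, add0r).
  have hal1 : Lam1 S (a%:M) by rewrite /Lam1 scal11.
  rewrite /c adjN adjZ; last exact: liC.
  by rewrite barK mulmx1 subr0 -(Lam1_skew hal1).
by move=> h'; rewrite -[a]scal11; exact: h'.
Qed.

End Unique.
End Exists.
End Sandwich.

Theorem theorem4p14 (R : nzRingType) (inv : R -> R) (lam : R) (Lam : R -> Prop)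
  (n : nat) (hn : (3 <= n)%N)
  (Hinv : is_involution inv) (Hlc : central lam) (Hll : lam * inv lam = 1)
  (HLam : form_parameter inv lam Lam) (Hqf : quasi_finite inv lam)
  (H : 'M[R]_(n + n) -> Prop) (HH : is_subgroup H)
  (HU : forall s, H s -> U_grp inv lam Lam s) :
  normalized_by (EU inv lam Lam) H <->
  exists I Gam : R -> Prop,
    (form_ideal inv lam Lam I Gam /\
     (forall s, EU_rel inv lam Lam I Gam s -> H s) /\
     (forall s, H s -> CU_rel inv lam Lam I Gam s)) /\
    (forall I' Gam' : R -> Prop,
       form_ideal inv lam Lam I' Gam' ->
       (forall s, EU_rel inv lam Lam I' Gam' s -> H s) ->
       (forall s, H s -> CU_rel inv lam Lam I' Gam' s) ->
       (forall x, I' x <-> I x) /\ (forall x, Gam' x <-> Gam x)).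
Proof.
pose S := FormRing Hinv Hlc Hll HLam.
have LF : locally_finite S by exact: quasi_finite_locally_finite.
split=> [HN|[I [Gam [[hI [h1 h2]] _]]]]; last exact: (@sandwich_normalized R S n H HH HU hn LF I Gam).
exists (level S H), (flevel S H); split; first split.
- exact: (@level_form_ideal R S n H HH HU HN hn).
- split=> s; first exact: (@EU_rel_level R S n H HH HN hn).
  exact: (@sub_CU_rel R S n H HH HU hn LF HN).
- move=> I' Gam' hI' h1 h2; split=> x.
    exact: (@level_unique R S n H hn I' Gam' hI' h1 h2 x).
  exact: (@flevel_unique R S n H HU hn I' Gam' hI' h1 h2 x).
Qed.
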